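(* The pre-dual of the space $\mathrm{BMO}_{(13)(2)}(\mathbb T^{\vec 1})$, $\vec 1=(1,1,1)$, is equal to the space $$H^1_{\mathrm{Re}}(\mathbb T^{(1,1)})\otimes L^1(\mathbb T)+L^1(\mathbb T)\otimes H^1_{\mathrm{Re}}(\mathbb T^{(1,1)}):=\{f+g:\ f\in H^1_{\mathrm{Re}}(\mathbb T^{(1,1)})\otimes L^1(\mathbb T),\ g\in L^1(\mathbb T)\otimes H^1_{\mathrm{Re}}(\mathbb T^{(1,1)})\}.$$
   Context: $\mathbb T$ is the unit circle; $\mathbb T^{\vec 1}=\mathbb T^3$ has variables $(x_1,x_2,x_3)$, and $H_i$ is the Hilbert transform in the $i$-th variable. $H^1_{\mathrm{Re}}(\mathbb T^{(1,1)})\otimes L^1(\mathbb T)=\{f\in L^1(\mathbb T^3): H_1f,H_2f,H_1H_2f\in L^1(\mathbb T^3)\}$ with norm $\|f\|_1+\|H_1f\|_1+\|H_2f\|_1+\|H_1H_2f\|_1$; $L^1(\mathbb T)\otimes H^1_{\mathrm{Re}}(\mathbb T^{(1,1)})$ is defined in the same way with $H_2,H_3,H_2H_3$. The sum space carries the quotient norm $\inf\{\|f\|+\|g\|\}$ over all decompositions $f+g$ of a given element. $H^1_{\mathrm{Re}}(\mathbb T^{(1,1)})$ is the product Hardy space $\{f\in L^1(\mathbb T^2):H_1f,H_2f,H_1H_2f\in L^1(\mathbb T^2)\}$, and product BMO in two variables is its dual (Chang–Fefferman). $\mathrm{BMO}_{(13)(2)}(\mathbb T^{\vec 1})$ is the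 space of functions $b(x_1,x_2,x_3)$ which are uniformly in $x_3$ in product BMO in the variables $(x_1,x_2)$ and uniformly in $x_1$ in product BMO in the variables $(x_2,x_3)$, normed by $\max\{\sup_{x_3}\|b(\cdot,\cdot,x_3)\|_{\mathrm{BMO}},\sup_{x_1}\|b(x_1,\cdot,\cdot)\|_{\mathrm{BMO}}\}$. ''The pre-dual of $X$ is equal to $Y$'' means that the Banach space dual of $Y$ is $X$, under the integral pairing on $\mathbb T^3$ and up to equivalence of norms. *)

(* Defs.v *)
From HB Require Import structures.
From mathcomp Require Import all_boot all_order all_algebra.
From mathcomp Require Import all_classical all_reals all_analysis.
From mathcomp Require Import ess_sup_inf complex.
Set Implicit Arguments.
Unset Strict Implicit.
Unset Printing Implicit Defensive.
Import Order.TTheory GRing.Theory Num.Theory.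
Import numFieldNormedType.Exports.
Import ComplexField.Normc.
Local Open Scope classical_set_scope.
Local Open Scope ring_scope.
Local Open Scope complex_scope.

(* Function spaces are given by a predicate on functions [T -> R[i]] and a
   (semi)norm; almost everywhere equal functions are different Rocq functions
   at distance zero. *)

Definition cL1 (R : realType) (d : measure_display) (T : measurableType d)
    (mu : {measure set T -> \bar R}) (f : T -> R[i]) : Prop :=
  mu.-integrable setT (fun x => (complex.Re (f x))%:E) /\
  mu.-integrable setT (fun x => (complex.Im (f x))%:E).

Definition cint (R : realType) (d : measure_display) (T : measurableType d)
    (mu : {measure set T -> \bar R}) (f : T -> R[i]) : R[i] :=
  (\int[mu]_x complex.Re (f x)) +i* (\int[mu]_x complex.Im (f x)).

Definition norm1 (R : realType) (d : measure_display) (T : measurableType d)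
    (mu : {measure set T -> \bar R}) (f : T -> R[i]) : R :=
  \int[mu]_x normc (f x).

Definition bounded_fct (R : realType) (T : Type) (f : T -> R[i]) : Prop :=
  exists M : R, forall x, normc (f x) <= M.

(* [e] is a family of characters indexed by the frequencies [Z]. *)
Definition fourier_coef (R : realType) (d : measure_display)
    (T : measurableType d) (mu : {measure set T -> \bar R})
    (Z : Type) (e : Z -> T -> R[i]) (f : T -> R[i]) (n : Z) : R[i] :=
  cint mu (fun x => f x * (e n x)^*).

(* [g] is an integrable function whose Fourier series is the image of that of
   [f] under the multiplier [m]; on the torus it is unique almost everywhere.
   For [f] integrable, this says that the distribution obtained from [f] by
   applying the multiplier is the L^1 function [g]. *)
Definition mult_image (R : realType) (d : measure_display)
    (T : measurableType d) (mu : {measure set T -> \bar R})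
    (Z : Type) (e : Z -> T -> R[i]) (m : Z -> R[i]) (f g : T -> R[i]) : Prop :=
  cL1 mu g /\ forall n, fourier_coef mu e g n = m n * fourier_coef mu e f n.

Definition mult_in_L1 (R : realType) (d : measure_display)
    (T : measurableType d) (mu : {measure set T -> \bar R})
    (Z : Type) (e : Z -> T -> R[i]) (m : Z -> R[i]) (f : T -> R[i]) : Prop :=
  exists g, mult_image mu e m f g.

Definition mult_op (R : realType) (d : measure_display)
    (T : measurableType d) (mu : {measure set T -> \bar R})
    (Z : Type) (e : Z -> T -> R[i]) (m : Z -> R[i]) (f : T -> R[i]) :
    T -> R[i] :=
  xget (fun=> 0) [set g | mult_image mu e m f g].

Definition H1Re (R : realType) (d : measure_display)
    (T : measurableType d) (mu : {measure set T -> \bar R})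
    (Z : Type) (e : Z -> T -> R[i]) (m1 m2 : Z -> R[i]) (f : T -> R[i]) :
    Prop :=
  [/\ cL1 mu f, mult_in_L1 mu e m1 f, mult_in_L1 mu e m2 f
    & mult_in_L1 mu e m1 (mult_op mu e m2 f)].

Definition H1Re_norm (R : realType) (d : measure_display)
    (T : measurableType d) (mu : {measure set T -> \bar R})
    (Z : Type) (e : Z -> T -> R[i]) (m1 m2 : Z -> R[i]) (f : T -> R[i]) : R :=
  norm1 mu f + norm1 mu (mult_op mu e m1 f) + norm1 mu (mult_op mu e m2 f)
  + norm1 mu (mult_op mu e m1 (mult_op mu e m2 f)).

(* Bounded linear functionals on the normed space [V] with norm [N]; the values
   of [L] outside [V] are irrelevant. *)
Definition bounded_functional (R : realType) (T : Type)
    (V : set (T -> R[i])) (N : (T -> R[i]) -> R) (L : (T -> R[i]) -> R[i]) :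
    Prop :=
  (forall (a : R[i]) f g, V f -> V g ->
     L (fun x => a * f x + g x) = a * L f + L g) /\
  (exists C : R, forall f, V f -> normc (L f) <= C * N f).

Definition functional_norm (R : realType) (T : Type)
    (V : set (T -> R[i])) (N : (T -> R[i]) -> R) (L : (T -> R[i]) -> R[i]) :
    \bar R :=
  ereal_sup [set (normc (L f))%:E | f in [set f | V f /\ N f <= 1]].

(* The integral of [f * b] need not converge for all [f] in [V], so the integral
   pairing is required to agree with [L] on the bounded elements of [V], for
   which it converges absolutely as soon as [b] is integrable. *)
Definition represents (R : realType) (d : measure_display)
    (T : measurableType d) (mu : {measure set T -> \bar R})
    (V : set (T -> R[i])) (b : T -> R[i]) (L : (T -> R[i]) -> R[i]) : Prop :=
  forall f, V f -> bounded_fct f -> L f = cint mu (fun x => f x * b x).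

(* [X] with norm [NX] is the dual of [V] with norm [N], up to equivalence of
   norms, the functional attached to [b] being the integral against [b]. *)
Definition is_dual (R : realType) (d : measure_display)
    (T : measurableType d) (mu : {measure set T -> \bar R})
    (V : set (T -> R[i])) (N : (T -> R[i]) -> R)
    (X : set (T -> R[i])) (NX : (T -> R[i]) -> \bar R) : Prop :=
  [/\ forall b, X b ->
        exists L, bounded_functional V N L /\ represents mu V b L,
      forall b L L', X b ->
        bounded_functional V N L -> represents mu V b L ->
        bounded_functional V N L' -> represents mu V b L' ->
        forall f, V f -> L f = L' f,
      forall L, bounded_functional V N L ->
        exists b, X b /\ represents mu V b L,
      forall L b b', bounded_functional V N L ->
        X b -> represents mu V b L -> X b' -> represents mu V b' L ->
        {ae mu, forall x, b x = b' x}
    & exists c C : R, [/\ 0 < c, 0 < C &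
        forall b L, X b -> bounded_functional V N L -> represents mu V b L ->
        (c%:E * NX b <= functional_norm V N L)%E /\
        (functional_norm V N L <= C%:E * NX b)%E]].

(* The unit circle is parametrised by x |-> exp(2 i pi x), x in [0, 1], and
   carries the normalised arc length; points outside [0, 1] are negligible. *)
Definition circle (R : realType) : measurableType _ := measurableTypeR R.

Definition circle_mu (R : realType) : probability (circle R) R :=
  uniform_prob (@ltr01 R).

Definition circle_char (R : realType) (n : int) (x : circle R) : R[i] :=
  cos (2 * pi * n%:~R * x) +i* sin (2 * pi * n%:~R * x).

Definition hilbert_mult (R : realType) (n : int) : R[i] :=
  0 -i* (sgz n)%:~R.

Definition torus2 (R : realType) : measurableType _ :=
  (circle R * circle R)%type.

Definition torus2_mu (R : realType) : probability (torus2 R) R :=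
  (circle_mu R \x circle_mu R)%E.

Definition torus2_char (R : realType) (n : int * int) (x : torus2 R) : R[i] :=
  circle_char n.1 x.1 * circle_char n.2 x.2.

Definition torus3 (R : realType) : measurableType _ :=
  (circle R * circle R * circle R)%type.

Definition torus3_mu (R : realType) : probability (torus3 R) R :=
  (torus2_mu R \x circle_mu R)%E.

Definition torus3_char (R : realType) (n : int * int * int) (x : torus3 R) :
    R[i] :=
  torus2_char n.1 x.1 * circle_char n.2 x.2.

Definition H1_T2 (R : realType) : set (torus2 R -> R[i]) :=
  [set f | H1Re (torus2_mu R) (@torus2_char R)
             (fun n => hilbert_mult R n.1) (fun n => hilbert_mult R n.2) f].

Definition H1_T2_norm (R : realType) (f : torus2 R -> R[i]) : R :=
  H1Re_norm (torus2_mu R) (@torus2_char R)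
    (fun n => hilbert_mult R n.1) (fun n => hilbert_mult R n.2) f.

(* H^1_Re(T^(1,1)) (x) L^1(T): Hilbert transforms in x_1 and x_2. *)
Definition H1_L1 (R : realType) : set (torus3 R -> R[i]) :=
  [set f | H1Re (torus3_mu R) (@torus3_char R)
             (fun n => hilbert_mult R n.1.1) (fun n => hilbert_mult R n.1.2) f].

Definition H1_L1_norm (R : realType) (f : torus3 R -> R[i]) : R :=
  H1Re_norm (torus3_mu R) (@torus3_char R)
    (fun n => hilbert_mult R n.1.1) (fun n => hilbert_mult R n.1.2) f.

(* L^1(T) (x) H^1_Re(T^(1,1)): Hilbert transforms in x_2 and x_3. *)
Definition L1_H1 (R : realType) : set (torus3 R -> R[i]) :=
  [set f | H1Re (torus3_mu R) (@torus3_char R)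
             (fun n => hilbert_mult R n.1.2) (fun n => hilbert_mult R n.2) f].

Definition L1_H1_norm (R : realType) (f : torus3 R -> R[i]) : R :=
  H1Re_norm (torus3_mu R) (@torus3_char R)
    (fun n => hilbert_mult R n.1.2) (fun n => hilbert_mult R n.2) f.

Definition sum_space (R : realType) : set (torus3 R -> R[i]) :=
  [set h | exists f g, [/\ H1_L1 f, L1_H1 g & h = (fun x => f x + g x)]].

Definition sum_norm (R : realType) (h : torus3 R -> R[i]) : R :=
  inf [set r : R | exists f g, [/\ H1_L1 f, L1_H1 g,
         h = (fun x => f x + g x) & r = H1_L1_norm f + L1_H1_norm g]].

(* Norm of [b] in product BMO, the dual of the product Hardy space: the norm of
   the functional given by integration against [b]. That functional is unique
   on [H1_T2] because bounded functions are dense there, and the infimum is +oo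
   when it does not exist, that is, when [b] is not in product BMO. *)
Definition BMO_norm (R : realType) (b : torus2 R -> R[i]) : \bar R :=
  ereal_inf [set functional_norm (@H1_T2 R) (@H1_T2_norm R) L | L in
    [set L | [/\ cL1 (torus2_mu R) b,
                 bounded_functional (@H1_T2 R) (@H1_T2_norm R) L
               & represents (torus2_mu R) (@H1_T2 R) b L]]].

(* Suprema over x_3 and over x_1 are essential, as [b] is only defined almost
   everywhere. *)
Definition BMO_13_2_norm (R : realType) (b : torus3 R -> R[i]) : \bar R :=
  Order.max
    (ess_sup (circle_mu R) (fun x3 => BMO_norm (fun y => b (y.1, y.2, x3))))
    (ess_sup (circle_mu R) (fun x1 => BMO_norm (fun y => b (x1, y.1, y.2)))).

Definition BMO_13_2 (R : realType) : set (torus3 R -> R[i]) :=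
  [set b | cL1 (torus3_mu R) b /\ (BMO_13_2_norm b < +oo)%E].

(* Main.v *)
Require Import Defs.
From mathcomp Require Import all_boot all_order all_algebra.
From mathcomp Require Import all_classical all_reals all_analysis.
From mathcomp Require Import measurable_realfun ess_sup_inf complex ring lra.
Set Implicit Arguments.
Unset Strict Implicit.
Unset Printing Implicit Defensive.
Import Order.TTheory GRing.Theory Num.Theory.
Import numFieldNormedType.Exports.
Import ComplexField.Normc.
Local Open Scope classical_set_scope.
Local Open Scope ring_scope.
Local Open Scope complex_scope.

(* Everything rests on the Fejer means [S_N]: convolutions with nonnegative trigonometric kernels of
   integral 1. They contract L^1 and tend to the identity there; being Fourier multipliers they
   commute with the Hilbert transforms, so the same holds in the Hardy spaces and in their sum, where
   trigonometric polynomials are therefore dense. A function [b] represents a functional of norm at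
   most [M] on the sum space if and only if |int q b| <= M |q| for all bounded [q] in either summand.
   This in turn holds if and only if almost all slices of [b] have product BMO norm at most [M]:
   in one direction integrate the bounds on the slices over the remaining variable, the bounded [q]
   being approximated by [S_N q], whose slices are trigonometric polynomials; in the other, test the
   bound on the products of an element of H^1(T^2) with a Fejer kernel in the remaining variable, and
   use that the slices of [S_N b] tend to those of [b] in L^1, along a subsequence that depends on the
   slice. Finally the Hardy norm is at most four times the L^2 norm, so the values of a bounded
   functional at the characters are square summable, and Riesz-Fischer yields a representing [b]. *)

(** * Complex-valued integrable functions *)

(** A product of [b] with an unbounded element of a Hardy space may fail to be integrable, so every
    inequality is tested on bounded functions only. This creates a difficulty in the sum space: the
    summands of a near-optimal decomposition of a bounded function are not known to be bounded.
    Passing to the means removes it, because they turn each summand into a trigonometric polynomial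
    without increasing its norm. The slices raise another difficulty. The bound on a slice must hold
    for all test functions of H^1(T^2) at once, so the exceptional null set may not depend on the
    test function. It is therefore extracted from [b] alone, through the L^1 distance between the
    slices of S_N b and those of [b]. A Hilbert transform is determined only almost everywhere. It
    is handled as a relation between integrable functions, read off their Fourier coefficients, and
    every norm is computed from arbitrary witnesses of that relation. Product BMO is normed as a
    dual space, so both constants in the final equivalence of norms are 1. *)

Section complex_facts.
Context {R : realType}.
Implicit Types z w : R[i].

Lemma Re_add z w : complex.Re (z + w) = complex.Re z + complex.Re w.
Proof. by case: z w => [a b] [c d]. Qed.

Lemma Im_add z w : complex.Im (z + w) = complex.Im z + complex.Im w.
Proof. by case: z w => [a b] [c d]. Qed.

Lemma Re_mul z w : complex.Re (z * w) =
  complex.Re z * complex.Re w - complex.Im z * complex.Im w.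
Proof. by case: z w => [a b] [c d]. Qed.

Lemma Im_mul z w : complex.Im (z * w) =
  complex.Re z * complex.Im w + complex.Im z * complex.Re w.
Proof. by case: z w => [a b] [c d]. Qed.

Lemma cRe_conj z : complex.Re (Num.conj z) = complex.Re z.
Proof. by case: z. Qed.

Lemma cIm_conj z : complex.Im (Num.conj z) = - complex.Im z.
Proof. by case: z. Qed.

Lemma complex_eq z w : complex.Re z = complex.Re w ->
  complex.Im z = complex.Im w -> z = w.
Proof. by case: z w => [a b] [c d] /= -> ->. Qed.

Lemma normcE2 z : normc z = Num.sqrt (complex.Re z ^+ 2 + complex.Im z ^+ 2).
Proof. by case: z. Qed.

Lemma normc_ge0 z : 0 <= normc z.
Proof. by rewrite normcE2 sqrtr_ge0. Qed.

Lemma normcD z w : normc (z + w) <= normc z + normc w.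
Proof. exact: le_normcD. Qed.

Lemma normcB z w : normc (z - w) <= normc z + normc w.
Proof. by rewrite -(normcN w); exact: le_normcD. Qed.

Lemma normc_conj z : normc (Num.conj z) = normc z.
Proof. by rewrite !normcE2 cRe_conj cIm_conj sqrrN. Qed.

Lemma Re_le_normc z : `|complex.Re z| <= normc z.
Proof.
by rewrite normcE2 -(sqrtr_sqr (complex.Re z)) ler_wsqrtr// lerDl sqr_ge0.
Qed.

Lemma Im_le_normc z : `|complex.Im z| <= normc z.
Proof.
by rewrite normcE2 -(sqrtr_sqr (complex.Im z)) ler_wsqrtr// lerDr sqr_ge0.
Qed.

Lemma normc_real (a : R) : normc a%:C = `|a|.
Proof. by rewrite /normc /= expr0n addr0 sqrtr_sqr. Qed.

Lemma normc_le_ReIm z : normc z <= `|complex.Re z| + `|complex.Im z|.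
Proof.
case: z => a b; rewrite /= -[leRHS]ger0_norm ?addr_ge0// -sqrtr_sqr.
rewrite ler_wsqrtr// sqrrD !real_normK ?num_real//.
by rewrite addrAC lerDl mulrn_wge0// mulr_ge0.
Qed.

Lemma csqr_normc z : (normc z ^+ 2)%:C = z * Num.conj z.
Proof.
case: z => a b; apply: complex_eq; rewrite /= ?mulrN ?opprK.
  by rewrite sqr_sqrtr ?addr_ge0 ?sqr_ge0// !expr2.
by rewrite (mulrC b a) addNr.
Qed.

(** For nonzero [z] the factor is conj(z)/|z|. It serves to rotate a complex integral onto the
    positive half-line. *)
Lemma normc_dir z : exists u : R[i], normc u = 1 /\ u * z = (normc z)%:C.
Proof.
have [->|z0] := eqVneq z 0.
  by exists 1; rewrite normc1 mulr0 normc0.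
exists (Num.conj z / (normc z)%:C).
have nz : normc z != 0 by apply: contra_neq z0 => /eq0_normc.
split.
  rewrite normcM normc_conj normcV normc_real ger0_norm ?normc_ge0//.
  by rewrite divff.
rewrite mulrAC (mulrC (Num.conj z)) -csqr_normc expr2.
rewrite rmorphM/= mulfK//.
by rewrite (inj_eq (@complexI R) _ 0).
Qed.

Lemma normc_sum I (s : seq I) (F : I -> R[i]) :
  normc (\sum_(i <- s) F i) <= \sum_(i <- s) normc (F i).
Proof.
elim/big_ind2: _ => // [|x1 x2 y1 y2 h1 h2]; first by rewrite normc0.
exact: le_trans (normcD _ _) (lerD h1 h2).
Qed.

End complex_facts.

Section complex_measurable.
Context {R : realType} {d : measure_display} {T : measurableType d}.
Implicit Types f g : T -> R[i].

Definition cmeas f := measurable_fun setT (fun x => complex.Re (f x)) /\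
  measurable_fun setT (fun x => complex.Im (f x)).

Lemma cmeas_cst c : cmeas (fun=> c).
Proof. by split; exact: measurable_cst. Qed.

Lemma cmeasD f g : cmeas f -> cmeas g -> cmeas (fun x => f x + g x).
Proof.
move=> [f1 f2] [g1 g2]; split.
  by under eq_fun do rewrite Re_add; exact: measurable_funD.
by under eq_fun do rewrite Im_add; exact: measurable_funD.
Qed.

Lemma cmeasM f g : cmeas f -> cmeas g -> cmeas (fun x => f x * g x).
Proof.
move=> [f1 f2] [g1 g2]; split.
  under eq_fun do rewrite Re_mul.
  by apply: measurable_funB; exact: measurable_funM.
under eq_fun do rewrite Im_mul.
by apply: measurable_funD; exact: measurable_funM.
Qed.

Lemma cmeas_conj f : cmeas f -> cmeas (fun x => Num.conj (f x)).
Proof.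
move=> [f1 f2]; split.
  by under eq_fun do rewrite cRe_conj.
by under eq_fun do rewrite cIm_conj; exact: measurableT_comp.
Qed.

Lemma cmeas_sum I (s : seq I) (F : I -> T -> R[i]) :
  (forall i, cmeas (F i)) -> cmeas (fun x => \sum_(i <- s) F i x).
Proof.
move=> mF; elim: s => [|i s ih].
  by under eq_fun do rewrite big_nil; exact: cmeas_cst.
by under eq_fun do rewrite big_cons; exact: cmeasD.
Qed.

Lemma measurable_normc f : cmeas f -> measurable_fun setT (fun x => normc (f x)).
Proof.
move=> [f1 f2]; under eq_fun do rewrite normcE2.
have msqrt : measurable_fun setT (@Num.sqrt R).
  by apply: continuous_measurable_fun; exact: sqrt_continuous.
by apply: (measurableT_comp msqrt); apply: measurable_funD; apply: measurable_funX.
Qed.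

End complex_measurable.

Lemma cmeas_comp {R : realType} d d' (T : measurableType d) (T' : measurableType d')
    (h : T' -> R[i]) (p : T -> T') :
  cmeas h -> measurable_fun setT p -> cmeas (fun x => h (p x)).
Proof.
by move=> [h1 h2] mp; split;
  [exact: (measurableT_comp h1 mp)|exact: (measurableT_comp h2 mp)].
Qed.

Section complex_integral.
Context {R : realType} {d : measure_display} {T : measurableType d}.
Variable mu : probability T R.
Implicit Types f g : T -> R[i].

Lemma fine_probability_setT : fine (mu setT) = 1.
Proof. by rewrite probability_setT. Qed.

Lemma cL1_cmeas f : cL1 mu f -> cmeas f.
Proof.
by move=> [/measurable_int f1 /measurable_int f2]; split; apply/measurable_EFinP.
Qed.

Lemma cL1_normc f : cL1 mu f -> mu.-integrable setT (EFin \o (fun x => normc (f x))).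
Proof.
move=> L; have m := measurable_normc (cL1_cmeas L); case: L => i1 i2.
have := integrableD measurableT (integrable_norm i1) (integrable_norm i2).
apply: le_integrable => //; first exact/measurable_EFinP.
move=> x _ /=; rewrite lee_fin ger0_norm ?normc_ge0// ger0_norm ?addr_ge0//.
exact: normc_le_ReIm.
Qed.

Lemma cL1_dom f (g : T -> R) : cmeas f -> mu.-integrable setT (EFin \o g) ->
  (forall x, normc (f x) <= g x) -> cL1 mu f.
Proof.
move=> [f1 f2] ig fg; split; apply: le_integrable ig => //;
  (try exact/measurable_EFinP); move=> x _ /=; rewrite lee_fin.
  exact: le_trans (Re_le_normc _) (le_trans (fg x) (ler_norm _)).
exact: le_trans (Im_le_normc _) (le_trans (fg x) (ler_norm _)).
Qed.

Lemma cL1_bounded f M : cmeas f -> (forall x, normc (f x) <= M) -> cL1 mu f.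
Proof.
by move=> mf fM; apply: (@cL1_dom _ (cst M)) => //; exact: finite_measure_integrable_cst.
Qed.

Lemma cL1_cst c : cL1 mu (fun=> c).
Proof. by apply: (@cL1_bounded _ (normc c)) => //; exact: cmeas_cst. Qed.

Lemma cL1D f g : cL1 mu f -> cL1 mu g -> cL1 mu (fun x => f x + g x).
Proof.
move=> [f1 f2] [g1 g2]; split.
  by under eq_fun do rewrite Re_add EFinD; exact: integrableD.
by under eq_fun do rewrite Im_add EFinD; exact: integrableD.
Qed.

Lemma cL1M f g M : cL1 mu f -> cmeas g -> (forall x, normc (g x) <= M) ->
  cL1 mu (fun x => f x * g x).
Proof.
move=> Lf mg gM; apply: (@cL1_dom _ (fun x => M * normc (f x))).
- by apply: cmeasM => //; exact: cL1_cmeas Lf.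
- rewrite [_ \o _](_ : _ = (fun x => M%:E * (normc (f x))%:E)%E)//.
  by apply: integrableZl => //; exact: cL1_normc.
- by move=> x; rewrite normcM mulrC ler_wpM2r ?normc_ge0.
Qed.

Lemma cL1Ml f g M : cL1 mu f -> cmeas g -> (forall x, normc (g x) <= M) ->
  cL1 mu (fun x => g x * f x).
Proof. by under eq_fun do rewrite mulrC; exact: cL1M. Qed.

Lemma cL1Z c f : cL1 mu f -> cL1 mu (fun x => c * f x).
Proof. by move=> L; apply: (@cL1Ml f _ (normc c)) => //; exact: cmeas_cst. Qed.

Lemma cL1B f g : cL1 mu f -> cL1 mu g -> cL1 mu (fun x => f x - g x).
Proof.
move=> Lf /(cL1Z (-1)) Lg; have := cL1D Lf Lg.
by under eq_fun do rewrite mulN1r.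
Qed.

Lemma cL1_sum I (s : seq I) (F : I -> T -> R[i]) :
  (forall i, cL1 mu (F i)) -> cL1 mu (fun x => \sum_(i <- s) F i x).
Proof.
move=> LF; elim: s => [|i s ih].
  by under eq_fun do rewrite big_nil; exact: cL1_cst.
by under eq_fun do rewrite big_cons; exact: cL1D.
Qed.

Lemma cL1_conj f : cL1 mu f -> cL1 mu (fun x => Num.conj (f x)).
Proof.
move=> L; apply: (@cL1_dom _ (fun x => normc (f x))).
- by apply: cmeas_conj; exact: cL1_cmeas L.
- exact: cL1_normc.
- by move=> x; rewrite normc_conj.
Qed.

Lemma cintD f g : cL1 mu f -> cL1 mu g ->
  cint mu (fun x => f x + g x) = cint mu f + cint mu g.
Proof.
move=> [f1 f2] [g1 g2]; apply: complex_eq; rewrite /= -RintegralD//.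
  by congr (Rintegral _ _ _); apply/funext => x; rewrite Re_add.
by congr (Rintegral _ _ _); apply/funext => x; rewrite Im_add.
Qed.

Lemma cintZ c f : cL1 mu f -> cint mu (fun x => c * f x) = c * cint mu f.
Proof.
move=> [f1 f2].
have Z (h : T -> R) k : mu.-integrable setT (EFin \o h) ->
    mu.-integrable setT (EFin \o (fun x => k * h x)).
  by move=> ih; rewrite [_ \o _](_ : _ = (fun x => k%:E * (h x)%:E)%E)//; exact: integrableZl.
apply: complex_eq; rewrite /= ?Re_mul ?Im_mul /=.
  rewrite -!RintegralZl// -RintegralB//; [|exact: Z..].
  by congr (Rintegral _ _ _); apply/funext => x; rewrite Re_mul.
rewrite -!RintegralZl// -RintegralD//; [|exact: Z..].
by congr (Rintegral _ _ _); apply/funext => x; rewrite Im_mul.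
Qed.

Lemma cintZr c f : cL1 mu f -> cint mu (fun x => f x * c) = cint mu f * c.
Proof. by move=> L; under eq_fun do rewrite mulrC; rewrite cintZ// mulrC. Qed.

Lemma cintB f g : cL1 mu f -> cL1 mu g ->
  cint mu (fun x => f x - g x) = cint mu f - cint mu g.
Proof.
move=> Lf Lg; rewrite -mulN1r -(cintZ (-1))// -cintD//; last exact: cL1Z.
by congr (cint mu _); apply/funext => x; rewrite mulN1r.
Qed.

Lemma cint_cst c : cint mu (fun=> c) = c.
Proof.
by apply: complex_eq; rewrite /= Rintegral_cst// fine_probability_setT mulr1.
Qed.

Lemma cint_sum I (s : seq I) (F : I -> T -> R[i]) :
  (forall i, cL1 mu (F i)) ->
  cint mu (fun x => \sum_(i <- s) F i x) = \sum_(i <- s) cint mu (F i).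
Proof.
move=> LF; elim: s => [|i s ih].
  by rewrite big_nil; under eq_fun do rewrite big_nil; exact: cint_cst.
rewrite big_cons -ih -cintD//; last exact: cL1_sum.
by under eq_fun do rewrite big_cons.
Qed.

Lemma cint_conj f : cL1 mu f -> cint mu (fun x => Num.conj (f x)) = Num.conj (cint mu f).
Proof.
move=> [f1 f2]; apply: complex_eq; rewrite ?cRe_conj ?cIm_conj /=.
  by congr (Rintegral _ _ _); apply/funext => x; rewrite cRe_conj.
rewrite -mulN1r -RintegralZl//.
by congr (Rintegral _ _ _); apply/funext => x; rewrite cIm_conj mulN1r.
Qed.

Lemma norm1_ge0 f : 0 <= norm1 mu f.
Proof. by apply: Rintegral_ge0 => x _; exact: normc_ge0. Qed.

Lemma EFin_norm1 f : cL1 mu f -> (norm1 mu f)%:E = (\int[mu]_x (normc (f x))%:E)%E.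
Proof. by move=> L; rewrite /norm1 fineK// integrable_fin_num//; exact: cL1_normc. Qed.

(** After rotation by a unimodular constant u the integral equals its own real part, and |Re (u f)|
    <= |f| pointwise. Comparing real and imaginary parts separately would lose a constant. *)
Lemma normc_cint_le f : cL1 mu f -> normc (cint mu f) <= norm1 mu f.
Proof.
move=> L; have [u [u1 uE]] := normc_dir (cint mu f).
have -> : normc (cint mu f) = complex.Re (cint mu (fun x => u * f x)).
  by rewrite cintZ// uE.
have Lu := cL1Z u L.
apply: le_trans (ler_norm _) _ => /=.
apply: le_trans (le_normr_Rintegral measurableT (proj1 Lu)) _.
apply: le_Rintegral => //; [exact: (integrable_norm (proj1 Lu))|exact: cL1_normc|].
by move=> x _; apply: le_trans (Re_le_normc _) _; rewrite normcM u1 mul1r.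
Qed.

Lemma norm1D f g : cL1 mu f -> cL1 mu g ->
  norm1 mu (fun x => f x + g x) <= norm1 mu f + norm1 mu g.
Proof.
move=> Lf Lg; have If := cL1_normc Lf; have Ig := cL1_normc Lg.
rewrite /norm1 -RintegralD//; apply: le_Rintegral => //.
- exact: cL1_normc (cL1D Lf Lg).
- rewrite [_ \o _](_ : _ = (fun x => (normc (f x))%:E + (normc (g x))%:E)%E)//.
  exact: integrableD.
- by move=> x _; exact: normcD.
Qed.

Lemma norm1Z c f : cL1 mu f -> norm1 mu (fun x => c * f x) = normc c * norm1 mu f.
Proof.
move=> L; rewrite /norm1 -RintegralZl//; last exact: cL1_normc.
by congr (Rintegral _ _ _); apply/funext => x; rewrite normcM.
Qed.

Lemma norm1_distC f g : norm1 mu (fun x => f x - g x) = norm1 mu (fun x => g x - f x).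
Proof.
by congr (Rintegral _ _ _); apply/funext => x; rewrite -normcN opprB.
Qed.

Lemma norm1B f g : cL1 mu f -> cL1 mu g ->
  norm1 mu (fun x => f x - g x) <= norm1 mu f + norm1 mu g.
Proof.
move=> Lf Lg; have := norm1D Lf (cL1Z (-1) Lg).
by rewrite norm1Z// normcN normc1 mul1r; under eq_fun do rewrite mulN1r.
Qed.

Lemma norm1_tri f g h : cL1 mu f -> cL1 mu g -> cL1 mu h ->
  norm1 mu (fun x => f x - h x) <=
  norm1 mu (fun x => f x - g x) + norm1 mu (fun x => g x - h x).
Proof.
move=> Lf Lg Lh; have := norm1D (cL1B Lf Lg) (cL1B Lg Lh).
by under eq_fun do rewrite addrA subrK.
Qed.

Lemma norm1_le_dist f g : cL1 mu f -> cL1 mu g ->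
  norm1 mu f <= norm1 mu g + norm1 mu (fun x => f x - g x).
Proof.
move=> Lf Lg; have := norm1D Lg (cL1B Lf Lg).
by under eq_fun do rewrite addrC subrK.
Qed.

Lemma norm1_cst c : norm1 mu (fun=> c) = normc c.
Proof. by rewrite /norm1 Rintegral_cst// fine_probability_setT mulr1. Qed.

Lemma norm1_le_sup f M : cL1 mu f -> (forall x, normc (f x) <= M) -> norm1 mu f <= M.
Proof.
move=> L fM; rewrite -[leRHS]mulr1 -[X in _ * X]fine_probability_setT.
rewrite -Rintegral_cst//; apply: le_Rintegral => //; first exact: cL1_normc.
exact: finite_measure_integrable_cst.
Qed.

Lemma norm1M f g M : cL1 mu f -> cmeas g -> (forall x, normc (g x) <= M) ->
  norm1 mu (fun x => f x * g x) <= M * norm1 mu f.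
Proof.
move=> Lf mg gM; rewrite /norm1 -RintegralZl//; last exact: cL1_normc.
apply: le_Rintegral => //; first exact: cL1_normc (cL1M Lf mg gM).
  rewrite [_ \o _](_ : _ = (fun x => M%:E * (normc (f x))%:E)%E)//.
  by apply: integrableZl => //; exact: cL1_normc.
by move=> x _; rewrite normcM mulrC ler_wpM2r ?normc_ge0.
Qed.

Lemma norm1_eq0_ae f g : cL1 mu f -> cL1 mu g -> norm1 mu (fun x => f x - g x) = 0 ->
  {ae mu, forall x, f x = g x}.
Proof.
move=> Lf Lg n0; have LB := cL1B Lf Lg.
have h := EFin_norm1 LB; rewrite n0 in h.
have H : ae_eq mu setT (fun x => (normc (f x - g x))%:E) (cst 0%E).
  apply/(ae_eq_integral_abs mu measurableT) => //.
    exact: measurable_int (cL1_normc LB).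
  rewrite [RHS]h; apply: eq_integral => x _.
  by rewrite gee0_abs ?lee_fin ?normc_ge0.
apply: (filterS _ H) => x /(_ I) {}h; apply/eqP; rewrite -subr_eq0.
by apply/eqP/eq0_normc/EFin_inj.
Qed.

End complex_integral.

(** * Summation kernels *)

Section vanishing_sequences.
Context {R : realType}.
Implicit Types u v : nat -> R.

(** One-sided: the upper limit of [u] is at most 0. For nonnegative sequences this is convergence to
    0, and a single upper bound is then enough to transfer it. *)
Definition vanishes u := forall eps, 0 < eps ->
  exists N0, forall N, (N0 <= N)%N -> u N <= eps.

Lemma vanishes_le u v : vanishes u -> (forall N, v N <= u N) -> vanishes v.
Proof.
move=> hu vu eps e0; have [N0 h] := hu eps e0; exists N0 => N /h.
exact: le_trans.
Qed.

Lemma vanishesD u v : vanishes u -> vanishes v -> vanishes (fun N => u N + v N).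
Proof.
move=> hu hv eps e0; have e2 : 0 < eps / 2 by rewrite divr_gt0.
have [N1 h1] := hu _ e2; have [N2 h2] := hv _ e2.
exists (maxn N1 N2) => N; rewrite geq_max => /andP[/h1 a /h2 b].
by rewrite (splitr eps) lerD.
Qed.

Lemma vanishesZ k u : 0 <= k -> vanishes u -> vanishes (fun N => k * u N).
Proof.
rewrite le_eqVlt => /orP[/eqP<- _ eps e0|k0 hu eps e0].
  by exists 0%N => N _; rewrite mul0r ltW.
have [N0 h] := hu (eps / k) (divr_gt0 e0 k0); exists N0 => N /h.
by rewrite ler_pdivlMr// mulrC.
Qed.

Lemma vanishes0 : vanishes (fun=> 0).
Proof. by move=> eps e0; exists 0%N => N _; rewrite ltW. Qed.

(** This is how limits are turned into exact inequalities: a quantity that does not depend on N is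
    bounded by a vanishing sequence. *)
Lemma vanishes_const k : vanishes (fun=> k) -> k <= 0.
Proof.
move=> h; rewrite leNgt; apply/negP => k0.
have [N0 /(_ N0 (leqnn _))] := h (k / 2) (divr_gt0 k0 (ltr0Sn _ 1)); lra.
Qed.

Lemma vanishes_cvg u : (forall N, 0 <= u N) -> vanishes u -> u @ \oo --> 0.
Proof.
move=> u0 hu; apply/cvgrPdist_le => eps e0; have [N0 h] := hu eps e0.
exists N0 => // N /= /h; rewrite sub0r normrN ger0_norm//.
Qed.

Lemma cvg_vanishes u : u @ \oo --> 0 -> vanishes u.
Proof.
move=> /cvgrPdist_le hu eps e0; have [N0 _ h] := hu eps e0.
by exists N0 => N /h; rewrite sub0r normrN; apply: le_trans; rewrite ler_norm.
Qed.

Lemma ecvg_vanishes u : (u N)%:E @[N --> \oo] --> 0%E -> vanishes u.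
Proof. by move=> /fine_cvgP[_ h]; apply: cvg_vanishes. Qed.

End vanishing_sequences.

Section summation_kernels.
Context {R : realType} {d : measure_display} {T : measurableType d}.
Variable mu : probability T R.
Variables (Z : countType) (e : Z -> T -> R[i]) (s : nat -> seq Z) (c : nat -> R).
Implicit Types f g : T -> R[i].

Definition fkernel N x y := (c N)%:C * \sum_(n <- s N) e n x * Num.conj (e n y).

Definition smooth N f x :=
  (c N)%:C * \sum_(n <- s N) fourier_coef mu e f n * e n x.

(** The properties of the Fejer kernels that survive tensor products. Convergence of the means is
    kept apart, since it is proved by estimates on the circle and by density on products. *)
Record kernel_system : Prop := KernelSystem {
  char_meas : forall n, cmeas (e n);
  char_norm : forall n x, normc (e n x) = 1;
  char_orth : forall n m, cint mu (fun x => e n x * Num.conj (e m x)) = (n == m)%:R;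
  fkernel_real : forall N x y, complex.Im (fkernel N x y) = 0;
  fkernel_ge0 : forall N x y, 0 <= complex.Re (fkernel N x y);
  fkernel_int : forall N x, cint mu (fun y => fkernel N x y) = 1 }.

Hypothesis KS : kernel_system.

Lemma conj_char_meas n : cmeas (fun x => Num.conj (e n x)).
Proof. exact/cmeas_conj/(char_meas KS). Qed.

Lemma conj_char_norm n x : normc (Num.conj (e n x)) = 1.
Proof. by rewrite normc_conj (char_norm KS). Qed.

Lemma cL1_char n : cL1 mu (e n).
Proof.
by apply: (@cL1_bounded _ _ _ _ _ 1) => [|x]; [exact: char_meas|rewrite (char_norm KS)].
Qed.

Lemma cL1_mul_char f n : cL1 mu f -> cL1 mu (fun x => f x * e n x).
Proof.
by move=> L; apply: (cL1M (M := 1) L) => [|x]; [exact: char_meas|rewrite (char_norm KS)].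
Qed.

Lemma cL1_mul_conj f n : cL1 mu f -> cL1 mu (fun x => f x * Num.conj (e n x)).
Proof.
move=> L; apply: (cL1M (M := 1) L) => [|x]; first exact: conj_char_meas.
by rewrite conj_char_norm.
Qed.

Lemma fourier_coefD f g n : cL1 mu f -> cL1 mu g ->
  fourier_coef mu e (fun x => f x + g x) n = fourier_coef mu e f n + fourier_coef mu e g n.
Proof.
move=> Lf Lg; rewrite /fourier_coef -cintD//; [|exact: cL1_mul_conj..].
by under eq_fun do rewrite mulrDl.
Qed.

Lemma fourier_coefZ a f n : cL1 mu f ->
  fourier_coef mu e (fun x => a * f x) n = a * fourier_coef mu e f n.
Proof.
move=> Lf; rewrite /fourier_coef -cintZ//; last exact: cL1_mul_conj.
by under eq_fun do rewrite -mulrA.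
Qed.

Lemma fourier_coefB f g n : cL1 mu f -> cL1 mu g ->
  fourier_coef mu e (fun x => f x - g x) n = fourier_coef mu e f n - fourier_coef mu e g n.
Proof.
move=> Lf Lg; rewrite /fourier_coef -cintB//; [|exact: cL1_mul_conj..].
by under eq_fun do rewrite mulrBl.
Qed.

Lemma fourier_coef_sum I (r : seq I) (F : I -> T -> R[i]) n :
  (forall i, cL1 mu (F i)) ->
  fourier_coef mu e (fun x => \sum_(i <- r) F i x) n = \sum_(i <- r) fourier_coef mu e (F i) n.
Proof.
move=> LF; rewrite /fourier_coef -cint_sum; last by move=> i; exact: cL1_mul_conj.
by under eq_fun do rewrite mulr_suml.
Qed.

Lemma fourier_coef_char k n : fourier_coef mu e (e k) n = (k == n)%:R.
Proof. exact: char_orth. Qed.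

Lemma normc_fourier_coef f n : cL1 mu f -> normc (fourier_coef mu e f n) <= norm1 mu f.
Proof.
move=> L; apply: le_trans (normc_cint_le (cL1_mul_conj n L)) _.
rewrite -[leRHS]mul1r; apply: norm1M => // [|x]; first exact: conj_char_meas.
by rewrite conj_char_norm.
Qed.

Lemma cmeas_smooth N f : cmeas (smooth N f).
Proof.
apply: cmeasM; first exact: cmeas_cst.
apply: cmeas_sum => n; apply: cmeasM; first exact: cmeas_cst.
exact: char_meas.
Qed.

Lemma smooth_bounded N f : bounded_fct (smooth N f).
Proof.
exists (`|c N| * \sum_(n <- s N) normc (fourier_coef mu e f n)) => x.
rewrite normcM normc_real ler_wpM2l//.
apply: le_trans (normc_sum _ _) _; apply: ler_sum => n _.
by rewrite normcM (char_norm KS) mulr1.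
Qed.

Lemma cL1_smooth N f : cL1 mu (smooth N f).
Proof. by have [M h] := smooth_bounded N f; exact: cL1_bounded (cmeas_smooth _ _) h. Qed.

Lemma smoothD N f g : cL1 mu f -> cL1 mu g ->
  smooth N (fun x => f x + g x) = (fun x => smooth N f x + smooth N g x).
Proof.
move=> Lf Lg; apply/funext => x; rewrite /smooth -mulrDr -big_split/=.
by congr (_ * _); apply: eq_bigr => n _; rewrite fourier_coefD// mulrDl.
Qed.

Lemma smoothB N f g : cL1 mu f -> cL1 mu g ->
  smooth N (fun x => f x - g x) = (fun x => smooth N f x - smooth N g x).
Proof.
move=> Lf Lg; apply/funext => x; rewrite /smooth -mulrBr -sumrB/=.
by congr (_ * _); apply: eq_bigr => n _; rewrite fourier_coefB// mulrBl.
Qed.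

Lemma smoothZ N a f : cL1 mu f ->
  smooth N (fun x => a * f x) = (fun x => a * smooth N f x).
Proof.
move=> Lf; apply/funext => x; rewrite /smooth [RHS]mulrCA; congr (_ * _).
by rewrite mulr_sumr; apply: eq_bigr => n _; rewrite fourier_coefZ// mulrA.
Qed.

(** The kernel is Hermitian by its formula, and a real Hermitian kernel is symmetric. *)
Lemma fkernelC N x y : fkernel N x y = fkernel N y x.
Proof.
have -> : fkernel N x y = Num.conj (fkernel N x y).
  apply: complex_eq; first by rewrite cRe_conj.
  by rewrite cIm_conj !(fkernel_real KS) oppr0.
rewrite /fkernel rmorphM rmorph_sum/=.
congr (_ * _); first by apply: complex_eq; rewrite ?cRe_conj ?cIm_conj /= ?oppr0.
by apply: eq_bigr => n _; rewrite rmorphM /= conjCK mulrC.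
Qed.

Lemma cmeas_fkernel N x : cmeas (fkernel N x).
Proof.
apply: cmeasM; first exact: cmeas_cst.
apply: cmeas_sum => n; apply: cmeasM; first exact: cmeas_cst.
exact: conj_char_meas.
Qed.

Lemma fkernel_bounded N x y : normc (fkernel N x y) <= `|c N| * (size (s N))%:R.
Proof.
rewrite normcM normc_real ler_wpM2l//; apply: le_trans (normc_sum _ _) _.
rewrite -sum1_size natr_sum; apply: ler_sum => n _.
by rewrite normcM (char_norm KS) conj_char_norm mulr1.
Qed.

Lemma normc_fkernel N x y : (normc (fkernel N x y))%:C = fkernel N x y.
Proof.
rewrite normcE2 (fkernel_real KS) expr0n addr0 sqrtr_sqr ger0_norm ?(fkernel_ge0 KS)//.
by apply: complex_eq; rewrite //= (fkernel_real KS).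
Qed.

Lemma cL1_fkernel_mul N x f : cL1 mu f -> cL1 mu (fun y => fkernel N x y * f y).
Proof. by move=> L; apply: cL1Ml L (cmeas_fkernel _ _) (fkernel_bounded _ _). Qed.

Lemma cL1_fkernel N x : cL1 mu (fkernel N x).
Proof. exact: cL1_bounded (cmeas_fkernel _ _) (fkernel_bounded _ _). Qed.

Lemma smoothE N f x : cL1 mu f -> smooth N f x = cint mu (fun y => fkernel N x y * f y).
Proof.
move=> L; transitivity (cint mu (fun y => (c N)%:C *
    \sum_(n <- s N) e n x * (f y * Num.conj (e n y)))); last first.
  congr (cint mu _); apply/funext => y; rewrite /fkernel -mulrA; congr (_ * _).
  by rewrite mulr_suml; apply: eq_bigr => n _; ring.
have Ln n : cL1 mu (fun y => e n x * (f y * Num.conj (e n y))).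
  by apply: cL1Z; exact: cL1_mul_conj.
rewrite cintZ; last exact: cL1_sum.
rewrite cint_sum//; congr (_ * _); apply: eq_bigr => n _.
by rewrite cintZ ?(mulrC (e n x))//; exact: cL1_mul_conj.
Qed.

(* [fkernel] is symmetric. *)
Lemma smoothE_conj N f x : cL1 mu f -> smooth N f x =
  (c N)%:C * \sum_(n <- s N) cint mu (fun y => f y * e n y) * Num.conj (e n x).
Proof.
move=> L; rewrite smoothE//; transitivity (cint mu (fun y => (c N)%:C *
    \sum_(n <- s N) Num.conj (e n x) * (f y * e n y))).
  congr (cint mu _); apply/funext => y; rewrite fkernelC /fkernel -mulrA; congr (_ * _).
  by rewrite mulr_suml; apply: eq_bigr => n _; ring.
have Ln n : cL1 mu (fun y => Num.conj (e n x) * (f y * e n y)).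
  by apply: cL1Z; exact: cL1_mul_char.
rewrite cintZ; last exact: cL1_sum.
rewrite cint_sum//; congr (_ * _); apply: eq_bigr => n _.
by rewrite cintZ; [rewrite mulrC|exact: cL1_mul_char].
Qed.

Lemma cL1_smoothM N f g : cL1 mu g -> cL1 mu (fun x => smooth N f x * g x).
Proof. by move=> L; have [M h] := smooth_bounded N f; exact: cL1Ml L (cmeas_smooth _ _) h. Qed.

Lemma cL1_Msmooth N f g : cL1 mu f -> cL1 mu (fun x => f x * smooth N g x).
Proof. by move=> L; have [M h] := smooth_bounded N g; exact: cL1M L (cmeas_smooth _ _) h. Qed.

(** Symmetry of the kernel makes the means self-adjoint for the bilinear pairing. Both sides expand
    into the same finite sum of products of integrals, so linearity of the integral suffices. *)
Lemma cint_smoothC N f g : cL1 mu f -> cL1 mu g ->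
  cint mu (fun x => smooth N f x * g x) = cint mu (fun x => f x * smooth N g x).
Proof.
move=> Lf Lg; transitivity ((c N)%:C * \sum_(n <- s N)
    fourier_coef mu e f n * cint mu (fun y => g y * e n y)).
  rewrite (_ : (fun x => _) = fun x => (c N)%:C *
    \sum_(n <- s N) fourier_coef mu e f n * (g x * e n x)); last first.
    apply/funext => x; rewrite /smooth -mulrA; congr (_ * _).
    by rewrite mulr_suml; apply: eq_bigr => n _; ring.
  have Ln n : cL1 mu (fun x => fourier_coef mu e f n * (g x * e n x)).
    by apply: cL1Z; exact: cL1_mul_char.
  rewrite cintZ; last exact: cL1_sum.
  rewrite cint_sum//; congr (_ * _); apply: eq_bigr => n _.
  by rewrite cintZ//; exact: cL1_mul_char.
rewrite (_ : (fun x => f x * _) = fun x => (c N)%:C *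
  \sum_(n <- s N) cint mu (fun y => g y * e n y) * (f x * Num.conj (e n x))); last first.
  apply/funext => x; rewrite smoothE_conj// mulrCA; congr (_ * _).
  by rewrite mulr_sumr; apply: eq_bigr => n _; ring.
have Ln n : cL1 mu (fun x => cint mu (fun y => g y * e n y) * (f x * Num.conj (e n x))).
  by apply: cL1Z; exact: cL1_mul_conj.
rewrite cintZ; last exact: cL1_sum.
rewrite cint_sum//; congr (_ * _); apply: eq_bigr => n _.
by rewrite cintZ; [rewrite mulrC|exact: cL1_mul_conj].
Qed.

Lemma smooth1 N : smooth N (fun=> 1) = fun=> 1.
Proof.
apply/funext => x; rewrite smoothE; last exact: cL1_cst.
by under eq_fun do rewrite mulr1; rewrite (fkernel_int KS).
Qed.

Lemma norm1_fkernel N x : norm1 mu (fkernel N x) = 1.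
Proof.
have := congr1 (@complex.Re R) (fkernel_int KS N x); rewrite /= => <-.
congr (Rintegral _ _ _); apply/funext => y.
by have /= <- := congr1 (@complex.Re R) (normc_fkernel N x y).
Qed.

(** The mean at [x] is an average of [f] against a nonnegative kernel of integral 1. *)
Lemma normc_smooth_le N f x M : cL1 mu f -> (forall y, normc (f y) <= M) ->
  normc (smooth N f x) <= M.
Proof.
move=> L fM; rewrite smoothE//; apply: le_trans (normc_cint_le (cL1_fkernel_mul _ _ L)) _.
rewrite -[leRHS]mulr1 -(norm1_fkernel N x).
under eq_fun do rewrite mulrC.
have [Mf ?] := L.
have := @norm1M _ _ _ mu (fkernel N x) f M (cL1_fkernel N x) (cL1_cmeas L) fM.
by under eq_fun do rewrite mulrC.
Qed.

(* [|smooth f| <= smooth |f|], and [smooth] preserves integrals. *)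
Lemma norm1_smooth N f : cL1 mu f -> norm1 mu (smooth N f) <= norm1 mu f.
Proof.
move=> L; pose h x : R[i] := (normc (f x))%:C.
have Lh : cL1 mu h.
  split; first exact: cL1_normc.
  by rewrite [X in integrable _ _ X](_ : _ = EFin \o cst 0)//; exact: finite_measure_integrable_cst.
have E : cint mu (smooth N h) = (norm1 mu f)%:C.
  have := cint_smoothC N Lh (cL1_cst mu 1).
  under eq_fun do rewrite mulr1; move=> ->; rewrite smooth1.
  under eq_fun do rewrite mulr1; apply: complex_eq => //=.
  by rewrite Rintegral_cst// mul0r.
have <- : complex.Re (cint mu (smooth N h)) = norm1 mu f by rewrite E.
apply: le_Rintegral => //.
- exact/cL1_normc/cL1_smooth.
- exact: proj1 (cL1_smooth N h).
- move=> x _; rewrite smoothE//; apply: le_trans (normc_cint_le (cL1_fkernel_mul _ _ L)) _.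
  rewrite smoothE//= le_eqVlt; apply/orP; left; apply/eqP.
  congr (Rintegral _ _ _); apply/funext => y.
  by rewrite normcM Re_mul /h /= mulr0 subr0 -[in RHS]normc_fkernel.
Qed.

(** The Fourier multiplier of the mean: a frequency counts as often as it is listed. For
    [fejer_freq] it is the triangular weight max(0, 1 - |k| / (N + 1)). *)
Definition smooth_weight N k := (c N)%:C * (count_mem k (s N))%:R.

Lemma fourier_coef_smooth N f k :
  fourier_coef mu e (smooth N f) k = smooth_weight N k * fourier_coef mu e f k.
Proof.
rewrite /smooth fourier_coefZ; last first.
  by apply: cL1_sum => n; apply: cL1Z; exact: cL1_char.
rewrite fourier_coef_sum; last by move=> n; apply: cL1Z; exact: cL1_char.
rewrite /smooth_weight -mulrA; congr (_ * _).
elim: (s N) => [|n r ih]; first by rewrite big_nil mul0r.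
rewrite big_cons ih fourier_coefZ; last exact: cL1_char.
rewrite fourier_coef_char /= natrD mulrDl; congr (_ + _).
by case: eqVneq => [->|_]; rewrite ?mulr1 ?mul1r ?mulr0 ?mul0r.
Qed.

(** Two Fourier multipliers commute. This is what lets the means act on Hardy spaces. *)
Lemma mult_image_smooth m N f g : mult_image mu e m f g ->
  mult_image mu e m (smooth N f) (smooth N g).
Proof.
move=> [Lg h]; split; first exact: cL1_smooth.
by move=> n; rewrite !fourier_coef_smooth h mulrCA.
Qed.

Definition smooths_to f := vanishes (fun N => norm1 mu (fun x => smooth N f x - f x)).

(** The two errors differ by S_N (f - g) - (f - g). Each of its terms has norm at most that of f -
    g, whence the factor 2. *)
Lemma norm1_smooth_dist N f g : cL1 mu f -> cL1 mu g ->
  norm1 mu (fun x => smooth N f x - f x) <=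
  norm1 mu (fun x => smooth N g x - g x) + 2 * norm1 mu (fun x => f x - g x).
Proof.
move=> Lf Lg; have Lfg := cL1B Lf Lg.
have := norm1B (cL1_smooth N (fun x => f x - g x)) Lfg.
rewrite smoothB// => h.
have L1 := cL1B (cL1_smooth N f) Lf; have L2 := cL1B (cL1_smooth N g) Lg.
apply: le_trans (norm1_le_dist L1 L2) _; rewrite lerD2l.
have := norm1_smooth N Lfg; rewrite smoothB// => h'.
rewrite (_ : (fun x => _) = fun x => smooth N f x - smooth N g x - (f x - g x)); last first.
  by apply/funext => x; ring.
by apply: le_trans h _; lra.
Qed.

(** The contraction property makes the set of functions recovered by their means closed in L^1. One
    third of eps pays for the approximant, two thirds for the factor 2 above. *)
Lemma smooths_to_closure f : cL1 mu f ->
  (forall eps, 0 < eps -> exists g, [/\ cL1 mu g, smooths_to g &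
    norm1 mu (fun x => f x - g x) <= eps]) -> smooths_to f.
Proof.
move=> Lf h eps e0; have e3 : 0 < eps / 3 by rewrite divr_gt0.
have [g [Lg cg fg]] := h _ e3; have [N0 h0] := cg _ e3; exists N0 => N /h0 hN.
by apply: le_trans (norm1_smooth_dist N Lf Lg) _; lra.
Qed.

Lemma smooths_toD f g : cL1 mu f -> cL1 mu g -> smooths_to f -> smooths_to g ->
  smooths_to (fun x => f x + g x).
Proof.
move=> Lf Lg cf cg; apply: vanishes_le (vanishesD cf cg) _ => N; rewrite smoothD//.
have := norm1D (cL1B (cL1_smooth N f) Lf) (cL1B (cL1_smooth N g) Lg).
by under eq_fun do rewrite addrACA -opprD.
Qed.

Lemma smooths_toZ a f : cL1 mu f -> smooths_to f -> smooths_to (fun x => a * f x).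
Proof.
move=> Lf cf; apply: vanishes_le (vanishesZ (normc_ge0 a) cf) _ => N.
rewrite smoothZ// -norm1Z; last exact: cL1B (cL1_smooth _ _) Lf.
by under [X in _ <= norm1 _ X]eq_fun do rewrite mulrBr.
Qed.

Lemma smooths_to0 : smooths_to (fun=> 0).
Proof.
have := smooths_toZ 0 (cL1_cst mu 1).
rewrite mul0r; apply.
apply: vanishes_le (vanishes0) _ => N; rewrite smooth1.
by under eq_fun do rewrite subrr; rewrite norm1_cst normc0.
Qed.

Lemma smooths_to_sum I (r : seq I) (F : I -> T -> R[i]) :
  (forall i, cL1 mu (F i)) -> (forall i, smooths_to (F i)) ->
  smooths_to (fun x => \sum_(i <- r) F i x).
Proof.
move=> LF cF; elim: r => [|i r ih].
  by under eq_fun do rewrite big_nil; exact: smooths_to0.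
under eq_fun do rewrite big_cons.
by apply: smooths_toD => //; exact: cL1_sum.
Qed.

End summation_kernels.

(** * Convergence of the means: from a generating family of sets to all of L^1 *)

Section density.
Context {R : realType} {d : measure_display} {T : measurableType d}.
Variable mu : probability T R.
Variables (Z : countType) (e : Z -> T -> R[i]) (s : nat -> seq Z) (c : nat -> R).
Hypothesis KS : kernel_system mu e s c.

Definition cindic (A : set T) (x : T) : R[i] := (\1_A x)%:C.

Lemma cindicE A x : cindic A x = (x \in A)%:R%:C.
Proof. by rewrite /cindic indicE. Qed.

Lemma cmeas_real (f : T -> R) : measurable_fun setT f -> cmeas (fun x => (f x)%:C).
Proof. by move=> mf; split=> //; exact: measurable_cst. Qed.

Lemma cindic_le1 A x : normc (cindic A x) <= 1.
Proof. by rewrite normc_real indicE; case: (x \in A); rewrite ?normr1 ?normr0. Qed.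

Lemma cmeas_cindic A : measurable A -> cmeas (cindic A).
Proof. by move=> mA; apply: cmeas_real; exact: measurable_indic. Qed.

Lemma cL1_cindic A : measurable A -> cL1 mu (cindic A).
Proof. by move=> mA; apply: cL1_bounded (cmeas_cindic mA) (cindic_le1 A). Qed.

Lemma cindicD A B : B `<=` A -> cindic (A `\` B) = (fun x => cindic A x - cindic B x).
Proof.
move=> BA; apply/funext => x; rewrite /cindic -rmorphB/= !indicE in_setD.
congr (_ %:C); have [xB|xB] := boolP (x \in B); rewrite ?andbT ?andbF ?subr0//.
by rewrite (_ : x \in A) ?subrr//; move: xB; rewrite !inE; exact: BA.
Qed.

Lemma norm1_cindicB A B : measurable A -> measurable B -> B `<=` A ->
  norm1 mu (fun x => cindic A x - cindic B x) = fine (mu A) - fine (mu B).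
Proof.
move=> mA mB BA; rewrite -cindicD// /norm1.
rewrite (_ : (fun x => _) = \1_(A `\` B)); last first.
  by apply/funext => x; rewrite normc_real ger0_norm.
rewrite /Rintegral integral_indic ?setIT//; last exact: measurableD.
rewrite measureD//; last by rewrite ltey_eq fin_num_measure.
by rewrite setIidr// fineB// fin_num_measure.
Qed.

(** Dynkin's argument: the measurable sets whose indicator is recovered by its means form a
    lambda-system, by linearity for proper differences and by L^1 closure for increasing unions. *)
Lemma smooths_to_cindic (G : set (set T)) : measurable = <<s G >> -> setI_closed G ->
  (forall A, G A -> smooths_to mu e s c (cindic A)) ->
  forall A, measurable A -> smooths_to mu e s c (cindic A).
Proof.
move=> mG GI hG.
pose H := [set A | measurable A /\ smooths_to mu e s c (cindic A)].
suff : measurable `<=` H by move=> h A /h [].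
rewrite mG; apply: lambda_system_subset => //; last first.
  by move=> A GA; split; [rewrite mG; exact: sub_gen_smallest|exact: hG].
split=> //.
- split; first exact: measurableT.
  apply: vanishes_le vanishes0 _ => N.
  rewrite (_ : cindic setT = fun=> 1); last first.
    by apply/funext => x; rewrite /cindic indicT.
  by rewrite (smooth1 KS); under eq_fun do rewrite subrr; rewrite norm1_cst normc0.
- move=> A B BA [mA hA] [mB hB]; split; first exact: measurableD.
  rewrite cindicD//.
  have := smooths_toD KS (cL1_cindic mA) (cL1Z (-1) (cL1_cindic mB)) hA
    (smooths_toZ KS (-1) (cL1_cindic mB) hB).
  by under eq_fun do rewrite mulN1r.
- move=> F ndF hF; have mF i : measurable (F i) by have [] := hF i.
  have mU : measurable (\bigcup_i F i) by exact: bigcupT_measurable.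
  split=> //; apply: (smooths_to_closure KS); first exact: cL1_cindic.
  (* For nested sets the L^1 distance between indicators is the difference of the measures, which
     tends to 0 by continuity from below. *)
  move=> eps e0; have /fine_cvgP[_] : mu (F n) @[n --> \oo] --> (fine (mu (\bigcup_i F i)))%:E.
    by rewrite fineK ?fin_num_measure//; exact: nondecreasing_cvg_mu.
  move=> /cvgrPdist_le /(_ _ e0) [n _ /(_ n (leqnn n)) hn].
  exists (cindic (F n)); split; [exact: cL1_cindic|by have [] := hF n|].
  rewrite norm1_cindicB//; last exact: bigcup_sup.
  exact: le_trans (ler_norm _) hn.
Qed.

Import HBSimple.

(** Indicators give simple functions by linearity, simple functions are dense in real L^1, and a
    complex function is assembled from its real and imaginary parts. *)
Lemma smooths_to_cL1 (G : set (set T)) : measurable = <<s G >> -> setI_closed G ->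
  (forall A, G A -> smooths_to mu e s c (cindic A)) ->
  forall f, cL1 mu f -> smooths_to mu e s c f.
Proof.
move=> mG GI hG.
have hA := smooths_to_cindic mG GI hG.
have hS (g : {sfun T >-> R}) : cL1 mu (fun x => (g x)%:C) /\
    smooths_to mu e s c (fun x => (g x)%:C).
  have -> : (fun x => (g x)%:C) = fun x =>
      \sum_(y <- finmap.enum_fset (fset_set (range g))) y%:C * cindic (g @^-1` [set y]) x.
    apply/funext => x; rewrite fimfunE fsbig_finite//= rmorph_sum/=.
    by apply: eq_bigr => y _; rewrite rmorphM.
  have m y : measurable (g @^-1` [set y]) by exact: measurable_sfunP.
  split; first by apply: cL1_sum => y; apply: cL1Z; exact: cL1_cindic.
  apply: (smooths_to_sum KS) => y; first by apply: cL1Z; exact: cL1_cindic.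
  by apply: (smooths_toZ KS); [exact: cL1_cindic|exact: hA].
have hR (f : T -> R) : mu.-integrable setT (EFin \o f) ->
    cL1 mu (fun x => (f x)%:C) /\ smooths_to mu e s c (fun x => (f x)%:C).
  move=> intf; have Lf : cL1 mu (fun x => (f x)%:C).
    split=> //=; rewrite [X in integrable _ _ X](_ : _ = EFin \o cst 0)//.
    exact: finite_measure_integrable_cst.
  split=> //; apply: (smooths_to_closure KS) => // eps e0.
  have [g_ [ig _ /fine_cvgP[_ /cvgrPdist_le/(_ _ e0)[n _ /(_ n (leqnn n)) h]]]] :=
    approximation_sfun_integrable measurableT intf.
  have [Lg Sg] := hS (g_ n); exists (fun x => (g_ n x)%:C); split=> //.
  apply: le_trans h; rewrite sub0r normrN; apply: le_trans _ (ler_norm _).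
  rewrite le_eqVlt; apply/orP; left; apply/eqP; congr fine; apply: eq_integral => x _.
  by rewrite -rmorphB normc_real.
move=> f [f1 f2]; have [L1 S1] := hR _ f1; have [L2 S2] := hR _ f2.
rewrite (_ : f = fun x => (complex.Re (f x))%:C + 'i * (complex.Im (f x))%:C).
  by apply: (smooths_toD KS) => //; [exact: cL1Z|exact: smooths_toZ].
by apply/funext => x; rewrite [LHS]complexE.
Qed.

End density.

(** * Fubini's theorem and tensor products for complex functions *)

Section complex_fubini.
Context {R : realType} {d1 d2 : measure_display}
  {T1 : measurableType d1} {T2 : measurableType d2}.
Variables (mu1 : probability T1 R) (mu2 : probability T2 R).

Definition prod_prob : probability (T1 * T2)%type R := (mu1 \x mu2)%E.

Lemma Rfubini (f : T1 * T2 -> R) : prod_prob.-integrable setT (EFin \o f) ->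
  [/\ {ae mu2, forall y, mu1.-integrable setT (EFin \o (fun x => f (x, y)))},
    mu2.-integrable setT (EFin \o (fun y => \int[mu1]_x f (x, y))) &
    \int[prod_prob]_z f z = \int[mu2]_y \int[mu1]_x f (x, y)].
Proof.
move=> intf; have ae := ae_integrable2 intf.
have mG := measurable_fubini_G intf.
have mF : measurable_fun setT (EFin \o (fun y => \int[mu1]_x f (x, y))).
  by apply/measurable_EFinP; exact: (measurableT_comp (fine_measurable _) mG).
split=> //.
- have mf := measurable_int _ intf.
  have mA : measurable_fun setT (fun y => \int[mu1]_x `|(f (x, y))%:E|)%E.
    apply: (measurable_fun_fubini_tonelli_G (abse \o (EFin \o f))) => //=.
    exact: measurableT_comp.
  have iA : mu2.-integrable setT (fun y => \int[mu1]_x `|(f (x, y))%:E|)%E.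
    apply/integrableP; split=> //.
    apply: le_lt_trans ((integrable21ltyP mu1 mu2 mf).1 intf).
    rewrite le_eqVlt; apply/orP; left; apply/eqP; apply: eq_integral => y _.
    by rewrite gee0_abs//; exact: integral_ge0.
  apply: le_integrable iA => // y _ /=.
  rewrite [leRHS]gee0_abs; last exact: integral_ge0.
  have : (`|\int[mu1]_x (f (x, y))%:E| <= \int[mu1]_x `|(f (x, y))%:E|)%E.
    apply: le_abse_integral => //.
    exact: (measurableT_comp mf (pair2_measurable y)).
  apply: le_trans; rewrite /Rintegral.
  (* [fine] sends infinite values to 0, so the bound by the integral of |f| persists at the
     exceptional y. *)
  by case: (\int[mu1]_x _)%E => [r| |] //=; rewrite ?normr0 ?leey.
- rewrite /Rintegral -integral21_prod_meas1//; congr fine.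
  apply: ae_eq_integral => //; apply: filterS ae => y iy _ /=.
  by rewrite /fubini_G fineK//; exact: integrable_fin_num.
Qed.

Lemma cfubini (f : T1 * T2 -> R[i]) : cL1 prod_prob f ->
  [/\ {ae mu2, forall y, cL1 mu1 (fun x => f (x, y))},
    cL1 mu2 (fun y => cint mu1 (fun x => f (x, y))) &
    cint prod_prob f = cint mu2 (fun y => cint mu1 (fun x => f (x, y)))].
Proof.
move=> [/Rfubini[a1 i1 E1] /Rfubini[a2 i2 E2]]; split.
- by apply: filterS2 a1 a2 => y h1 h2; split.
- by split.
- by apply: complex_eq.
Qed.

Lemma norm1_fubini (f : T1 * T2 -> R[i]) : cL1 prod_prob f ->
  mu2.-integrable setT (EFin \o (fun y => norm1 mu1 (fun x => f (x, y)))) /\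
  norm1 prod_prob f = \int[mu2]_y norm1 mu1 (fun x => f (x, y)).
Proof. by move=> /cL1_normc/Rfubini[]. Qed.

Lemma cmeas_fst (f : T1 -> R[i]) : cmeas f -> cmeas (fun z : T1 * T2 => f z.1).
Proof. by move=> mf; apply: cmeas_comp mf _; exact: measurable_fst. Qed.

Lemma cmeas_snd (f : T2 -> R[i]) : cmeas f -> cmeas (fun z : T1 * T2 => f z.2).
Proof. by move=> mf; apply: cmeas_comp mf _; exact: measurable_snd. Qed.

Variables (f : T1 -> R[i]) (g : T2 -> R[i]) (Mf Mg : R).
Hypotheses (mf : cmeas f) (fM : forall x, normc (f x) <= Mf).
Hypotheses (mg : cmeas g) (gM : forall x, normc (g x) <= Mg).

Definition tensor (f : T1 -> R[i]) (g : T2 -> R[i]) z := f z.1 * g z.2.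

Lemma tensor_bounded z : normc (tensor f g z) <= Mf * Mg.
Proof. by rewrite normcM ler_pM ?normc_ge0. Qed.

Lemma cmeas_tensor : cmeas (tensor f g).
Proof. by apply: cmeasM; [exact: cmeas_fst|exact: cmeas_snd]. Qed.

Lemma cL1_tensor : cL1 prod_prob (tensor f g).
Proof. exact: cL1_bounded cmeas_tensor tensor_bounded. Qed.

Lemma cint_tensor : cint prod_prob (tensor f g) = cint mu1 f * cint mu2 g.
Proof.
have Lf : cL1 mu1 f := cL1_bounded _ mf fM; have Lg : cL1 mu2 g := cL1_bounded _ mg gM.
have [_ _ ->] := cfubini cL1_tensor.
by rewrite -cintZ//; congr (cint _ _); apply/funext => y; rewrite -cintZr.
Qed.

Lemma norm1_tensor : norm1 prod_prob (tensor f g) = norm1 mu1 f * norm1 mu2 g.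
Proof.
have Lf : cL1 mu1 f := cL1_bounded _ mf fM; have Lg : cL1 mu2 g := cL1_bounded _ mg gM.
have [_ ->] := norm1_fubini cL1_tensor.
rewrite -RintegralZl//; last exact: cL1_normc.
congr (Rintegral _ _ _); apply/funext => y.
rewrite /norm1 mulrC -RintegralZl//; last exact: cL1_normc.
by congr (Rintegral _ _ _); apply/funext => x; rewrite normcM mulrC.
Qed.

End complex_fubini.

(** * Products of systems of characters *)

Section product_systems.
Context {R : realType} {d1 d2 : measure_display}
  {T1 : measurableType d1} {T2 : measurableType d2}.
Variables (mu1 : probability T1 R) (mu2 : probability T2 R).
Variables (Z1 Z2 : countType) (e1 : Z1 -> T1 -> R[i]) (e2 : Z2 -> T2 -> R[i]).
Variables (s1 : nat -> seq Z1) (s2 : nat -> seq Z2) (c1 c2 : nat -> R).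
Hypotheses (KS1 : kernel_system mu1 e1 s1 c1) (KS2 : kernel_system mu2 e2 s2 c2).

Definition prod_char (n : Z1 * Z2) (z : T1 * T2) := e1 n.1 z.1 * e2 n.2 z.2.
(** Both factors use the same index N, so that the means on a product still form a single
    sequence. *)
Definition prod_freq N := [seq (a, b) | a <- s1 N, b <- s2 N].
Definition prod_coef N := c1 N * c2 N.

Local Notation mu := (prod_prob mu1 mu2).
Local Notation K := (fkernel prod_char prod_freq prod_coef).
Local Notation S := (smooth mu prod_char prod_freq prod_coef).

Lemma prod_fkernel N x y :
  K N x y = fkernel e1 s1 c1 N x.1 y.1 * fkernel e2 s2 c2 N x.2 y.2.
Proof.
rewrite /fkernel rmorphM /= mulrACA; congr (_ * _).
rewrite big_distrl /= big_allpairs_dep /=; apply: eq_bigr => a _.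
by rewrite big_distrr; apply: eq_bigr => b _ /=; rewrite /prod_char rmorphM /=; ring.
Qed.

Lemma prod_kernel_system : kernel_system mu prod_char prod_freq prod_coef.
Proof.
split.
- move=> n; apply: cmeas_tensor; [exact: char_meas KS1 _|exact: char_meas KS2 _].
- by move=> n x; rewrite normcM (char_norm KS1) (char_norm KS2) mulr1.
- move=> n m; transitivity (cint mu (tensor (fun x => e1 n.1 x * Num.conj (e1 m.1 x))
      (fun y => e2 n.2 y * Num.conj (e2 m.2 y)))).
    by congr (cint _ _); apply/funext => z; rewrite /tensor /prod_char rmorphM mulrACA.
  rewrite (@cint_tensor _ _ _ _ _ mu1 mu2 _ _ 1 1).
  + rewrite (char_orth KS1) (char_orth KS2) -natrM mulnb.
    by case: n m => [a b] [a' b']; rewrite xpair_eqE.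
  + by apply: cmeasM; [exact: char_meas KS1 _|exact: conj_char_meas KS1 _].
  + by move=> x; rewrite normcM (char_norm KS1) (conj_char_norm KS1) mulr1.
  + by apply: cmeasM; [exact: char_meas KS2 _|exact: conj_char_meas KS2 _].
  + by move=> x; rewrite normcM (char_norm KS2) (conj_char_norm KS2) mulr1.
- move=> N x y; rewrite prod_fkernel Im_mul (fkernel_real KS1) (fkernel_real KS2).
  by rewrite mulr0 mul0r addr0.
- move=> N x y; rewrite prod_fkernel Re_mul (fkernel_real KS1) mul0r subr0.
  by rewrite mulr_ge0// ?(fkernel_ge0 KS1) ?(fkernel_ge0 KS2).
- move=> N x; transitivity (cint mu (tensor (fkernel e1 s1 c1 N x.1) (fkernel e2 s2 c2 N x.2))).
    by congr (cint _ _); apply/funext => z; rewrite prod_fkernel.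
  rewrite (cint_tensor _ _ (cmeas_fkernel KS1 N x.1) (fkernel_bounded KS1 N x.1)
    (cmeas_fkernel KS2 N x.2) (fkernel_bounded KS2 N x.2)).
  by rewrite (fkernel_int KS1) (fkernel_int KS2) mulr1.
Qed.

Lemma fourier_coef_tensor f g Mf Mg n : cmeas f -> (forall x, normc (f x) <= Mf) ->
  cmeas g -> (forall x, normc (g x) <= Mg) ->
  fourier_coef mu prod_char (tensor f g) n =
  fourier_coef mu1 e1 f n.1 * fourier_coef mu2 e2 g n.2.
Proof.
move=> mf fM mg gM; rewrite /fourier_coef.
transitivity (cint mu (tensor (fun x => f x * Num.conj (e1 n.1 x))
    (fun y => g y * Num.conj (e2 n.2 y)))).
  by congr (cint _ _); apply/funext => z; rewrite /tensor /prod_char rmorphM mulrACA.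
rewrite (@cint_tensor _ _ _ _ _ mu1 mu2 _ _ Mf Mg)//.
+ by apply: cmeasM => //; exact: conj_char_meas KS1 _.
+ by move=> x; rewrite normcM (conj_char_norm KS1) mulr1.
+ by apply: cmeasM => //; exact: conj_char_meas KS2 _.
+ by move=> x; rewrite normcM (conj_char_norm KS2) mulr1.
Qed.

Lemma smooth_tensor f g Mf Mg N : cmeas f -> (forall x, normc (f x) <= Mf) ->
  cmeas g -> (forall x, normc (g x) <= Mg) ->
  S N (tensor f g) = tensor (smooth mu1 e1 s1 c1 N f) (smooth mu2 e2 s2 c2 N g).
Proof.
move=> mf fM mg gM; apply/funext => z; rewrite /tensor /smooth rmorphM /= mulrACA.
congr (_ * _); rewrite big_distrl /= big_allpairs_dep /=; apply: eq_bigr => a _.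
rewrite big_distrr; apply: eq_bigr => b _ /=.
by rewrite (fourier_coef_tensor _ mf fM mg gM)/= /prod_char mulrACA.
Qed.

Lemma setI_closed_rectangles :
  setI_closed [set A `*` B | A in @measurable _ T1 & B in @measurable _ T2].
Proof.
move=> _ _ [A mA [B mB <-]] [A' mA' [B' mB' <-]].
by exists (A `&` A'); [exact: measurableI|exists (B `&` B'); [exact: measurableI|rewrite setXI]].
Qed.

(** Rectangles form a generating family stable under intersection, and their indicators are tensor
    products. For these, S(f x g) - f x g is (Sf - f) x Sg + f x (Sg - g), where x is the tensor
    product, and all undifferenced factors are bounded by 1. *)
Lemma prod_smooths_to :
  (forall f, cL1 mu1 f -> smooths_to mu1 e1 s1 c1 f) ->
  (forall f, cL1 mu2 f -> smooths_to mu2 e2 s2 c2 f) ->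
  forall f, cL1 mu f -> smooths_to mu prod_char prod_freq prod_coef f.
Proof.
move=> h1 h2; apply: (smooths_to_cL1 prod_kernel_system).
- exact: measurable_prod_measurableType.
- exact: setI_closed_rectangles.
move=> _ [A mA [B mB <-]].
set f : T1 -> R[i] := cindic A; set g : T2 -> R[i] := cindic B.
have -> : cindic (A `*` B) = tensor f g.
  apply/funext => z; rewrite /tensor /f /g /cindic -rmorphM/= !indicE -natrM mulnb.
  by rewrite in_setX.
have mf : cmeas f := cmeas_cindic mA; have mg : cmeas g := cmeas_cindic mB.
have Lf : cL1 mu1 f := cL1_cindic _ mA; have Lg : cL1 mu2 g := cL1_cindic _ mB.
apply: vanishes_le (vanishesD (h1 _ Lf) (h2 _ Lg)) _ => N.
rewrite (smooth_tensor _ mf (cindic_le1 A) mg (cindic_le1 B)).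
set Sf := smooth _ _ _ _ _ f; set Sg := smooth _ _ _ _ _ g.
have Sf1 x : normc (Sf x) <= 1 := normc_smooth_le KS1 N x Lf (cindic_le1 A).
have Sg1 x : normc (Sg x) <= 1 := normc_smooth_le KS2 N x Lg (cindic_le1 B).
have mSf : cmeas Sf := cmeas_smooth KS1 N f.
have mSg : cmeas Sg := cmeas_smooth KS2 N g.
have mBf : cmeas (fun x => Sf x - f x) := cL1_cmeas (cL1B (cL1_smooth KS1 N f) Lf).
have mBg : cmeas (fun x => Sg x - g x) := cL1_cmeas (cL1B (cL1_smooth KS2 N g) Lg).
have Bf2 x : normc (Sf x - f x) <= 2.
  by apply: le_trans (normcB _ _) _; rewrite (_ : 2 = 1 + 1)// lerD// cindic_le1.
have Bg2 x : normc (Sg x - g x) <= 2.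
  by apply: le_trans (normcB _ _) _; rewrite (_ : 2 = 1 + 1)// lerD// cindic_le1.
rewrite (_ : (fun z => _) = fun z => tensor (fun x => Sf x - f x) Sg z +
    tensor f (fun x => Sg x - g x) z); last first.
  by apply/funext => z; rewrite /tensor; ring.
apply: le_trans (norm1D (cL1_tensor _ _ mBf Bf2 mSg Sg1)
  (cL1_tensor _ _ mf (cindic_le1 A) mBg Bg2)) _.
rewrite (norm1_tensor _ _ mBf Bf2 mSg Sg1) (norm1_tensor _ _ mf (cindic_le1 A) mBg Bg2).
apply: lerD.
  rewrite -[leRHS]mulr1 ler_wpM2l ?norm1_ge0//; apply: norm1_le_sup => //.
  exact: cL1_smooth KS2 N g.
rewrite -[leRHS]mul1r ler_wpM2r ?norm1_ge0//; apply: norm1_le_sup => //.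
exact: cindic_le1.
Qed.

End product_systems.

(** * Fejer means on the circle *)

Section circle_characters.
Context {R : realType}.
Implicit Types (n m : int) (x y : circle R).

Lemma circle_charD n m x : circle_char (n + m) x = circle_char n x * circle_char m x.
Proof.
rewrite /circle_char rmorphD /= mulrDr mulrDl.
by apply: complex_eq; rewrite /= ?cosD ?sinD //; ring.
Qed.

Lemma circle_char_conj n x : Num.conj (circle_char n x) = circle_char (- n) x.
Proof. by apply: complex_eq; rewrite ?cRe_conj ?cIm_conj /= rmorphN /= mulrN mulNr ?cosN ?sinN. Qed.

Lemma circle_char0 x : circle_char 0 x = 1.
Proof. by rewrite /circle_char mulr0 mul0r cos0 sin0. Qed.

Lemma circle_char_norm n x : normc (circle_char n x) = 1.
Proof. by rewrite /= cos2Dsin2 sqrtr1. Qed.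

Lemma circle_charX k x : circle_char (k%:Z) x = circle_char 1 x ^+ k.
Proof.
elim: k => [|k ih]; first exact: circle_char0.
by rewrite exprS -ih -circle_charD -intS.
Qed.

Lemma measurable_cos : measurable_fun setT (@cos R).
Proof. by apply: continuous_measurable_fun; exact: continuous_cos. Qed.

Lemma measurable_sin : measurable_fun setT (@sin R).
Proof. by apply: continuous_measurable_fun; exact: continuous_sin. Qed.

Lemma circle_char_meas n : cmeas (@circle_char R n).
Proof.
have ml : measurable_fun setT (fun x : R => 2 * pi * n%:~R * x) by exact: mulrl_measurable.
by split; [exact: (measurableT_comp measurable_cos ml)|exact: (measurableT_comp measurable_sin ml)].
Qed.

Lemma uniform_FTC (f F : R -> R) : (forall x, `|f x| <= 1) -> continuous f ->
  (forall x : R, is_derive x (1 : R) F (f x)) -> F 1 = F 0 ->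
  \int[circle_mu R]_x f x = 0.
Proof.
move=> f1 cf dF F10.
have mf : measurable_fun setT f by exact: continuous_measurable_fun.
have intf : (circle_mu R).-integrable setT (EFin \o f).
  apply: measurable_bounded_integrable => //; first by rewrite ltey_eq fin_num_measure.
  by exists 1; split=> // M M1 x _ /=; exact: le_trans (f1 x) (ltW M1).
have int1 : (circle_mu R).-integrable setT (EFin \o cst 1).
  exact: finite_measure_integrable_cst.
have dG (x : R) : is_derive x (1 : R) (fun x => x + F x) (1 + f x).
  by apply: is_deriveD.
have cG : continuous (fun x : R => x + F x).
  by move=> x; apply: differentiable_continuous; apply/derivable1_diffP; have [] := dG x.
(* [integral_uniform] takes a nonnegative integrand; 1 + f is one because |f| <= 1, and x + F is its
   antiderivative. *)
have : \int[circle_mu R]_x (1 + f x) = 1.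
  rewrite /Rintegral (@integral_uniform _ _ _ (@ltr01 R) (fun x => (1 + f x)%:E)); last 2 first.
  - by apply/measurable_EFinP; apply: measurable_funD => //; exact: measurable_cst.
  - by move=> x; rewrite lee_fin -lerBlDl sub0r; have := f1 x; rewrite ler_norml => /andP[].
  rewrite (@continuous_FTC2 _ _ (fun x => x + F x))//.
  + by rewrite subr0 invr1 mul1e F10 -EFinB/=; ring.
  + apply: continuous_subspaceT => x; apply: cvgD; [exact: cvg_cst|exact: cf].
  + split.
    * by move=> x _; have [] := dG x.
    * by apply: cvg_at_right_filter; exact: cG.
    * by apply: cvg_at_left_filter; exact: cG.
  + by move=> x _; rewrite derive1E; have [_ ->] := dG x.
rewrite RintegralD// Rintegral_cst// fine_probability_setT mulr1; lra.
Qed.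

Lemma cint_circle_char n : cint (circle_mu R) (circle_char n) = (n == 0)%:R.
Proof.
have [->|n0] := eqVneq n 0.
  rewrite (_ : circle_char 0 = fun=> 1) ?cint_cst//.
  by apply/funext => x; exact: circle_char0.
pose k : R := 2 * pi * n%:~R.
have k0 : k != 0.
  by rewrite /k !mulf_eq0 intr_eq0 (negbTE n0) (gt_eqF (pi_gt0 R)) pnatr_eq0.
have ck : continuous (fun x : R => k * x) by exact: mulrl_continuous.
have dk (x : R) : is_derive x (1 : R) (fun x => k * x) k.
  by apply: is_derive_eq; rewrite /GRing.scale/= mulr1.
(* Periodicity settles the natural multiples of 2 pi, and parity the negative ones. The
   antiderivatives used below thus agree at 0 and 1. *)
have e1 : sin k = 0 /\ cos k = 1.
  have ej (j : nat) : sin (2 * pi * j%:R : R) = 0 /\ cos (2 * pi * j%:R : R) = 1.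
    have -> : 2 * pi * j%:R = 0 + pi *+ 2 *+ j :> R by rewrite add0r mulr_natl mulr_natr.
    by rewrite (periodicn (@sinD2pi R)) (periodicn (@cosD2pi R)) sin0 cos0.
  rewrite /k; case: n {n0 k k0 ck dk} => j; first exact: ej.
  rewrite NegzE rmorphN/= mulrN sinN cosN.
  by have [-> ->] := ej j.+1; rewrite oppr0.
apply: complex_eq => /=.
- apply: (@uniform_FTC (fun x => cos (k * x)) (fun x => k^-1 * sin (k * x))).
  + by move=> x; exact: cos_max.
  + by move=> x; apply: continuous_comp; [exact: ck|exact: continuous_cos].
  + move=> x; apply: is_derive_eq; rewrite /GRing.scale/=.
    by field.
  + by rewrite mulr1 mulr0 e1.1 sin0.
- apply: (@uniform_FTC (fun x => sin (k * x)) (fun x => - k^-1 * cos (k * x))).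
  + by move=> x; exact: sin_max.
  + by move=> x; apply: continuous_comp; [exact: ck|exact: continuous_sin].
  + move=> x; apply: is_derive_eq; rewrite /GRing.scale/=.
    by field.
  + by rewrite mulr1 mulr0 e1.2 cos0.
Qed.

(* A frequency occurs with its multiplicity in the Fejer mean, so that the weight is constant. *)
Definition fejer_freq (N : nat) : seq int :=
  [seq a%:Z - b%:Z | a <- iota 0 N.+1, b <- iota 0 N.+1].
Definition fejer_coef (N : nat) : R := N.+1%:R^-1.

(** A one-sided Dirichlet sum, geometric of ratio exp(2 i pi (x - y)). Its squared modulus divided
    by N + 1 is the Fejer kernel, which explains why that kernel is real and nonnegative. *)
Definition dirichlet N x y : R[i] :=
  \sum_(a <- iota 0 N.+1) (circle_char 1 x * circle_char (-1) y) ^+ a.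

Lemma fejer_kernelE N x y : fkernel (@circle_char R) fejer_freq fejer_coef N x y =
  (N.+1%:R^-1 * normc (dirichlet N x y) ^+ 2)%:C.
Proof.
rewrite rmorphM/= csqr_normc /fkernel; congr (_ * _).
rewrite /dirichlet rmorph_sum big_distrl big_allpairs_dep/=; apply: eq_bigr => a _.
rewrite big_distrr; apply: eq_bigr => b _ /=.
rewrite rmorphXn rmorphM /= !circle_char_conj !exprMn -!circle_charX.
have X k z : circle_char (-1) z ^+ k = circle_char (- k%:Z) z :> R[i].
  by rewrite -[in RHS]circle_char_conj circle_charX rmorphXn /= circle_char_conj.
by rewrite !X opprD opprK !circle_charD; ring.
Qed.

Lemma circle_kernel_system :
  kernel_system (circle_mu R) (@circle_char R) fejer_freq fejer_coef.
Proof.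
split.
- exact: circle_char_meas.
- exact: circle_char_norm.
- move=> n m; rewrite -subr_eq0 -cint_circle_char; congr (cint _ _).
  by apply/funext => x; rewrite circle_char_conj -circle_charD.
- by move=> N x y; rewrite fejer_kernelE.
- by move=> N x y; rewrite fejer_kernelE/= mulr_ge0// sqr_ge0.
- move=> N x; rewrite /fkernel cintZ; last first.
    apply: cL1_sum => n; apply: cL1Z; apply: (@cL1_bounded _ _ _ _ _ 1).
      by apply: cmeas_conj; exact: circle_char_meas.
    by move=> y; rewrite normc_conj circle_char_norm.
  have L (n : int) : cL1 (circle_mu R) (fun y => circle_char n x * Num.conj (circle_char n y)).
    apply: cL1Z; apply: (@cL1_bounded _ _ _ _ _ 1).
      by apply: cmeas_conj; exact: circle_char_meas.
    by move=> y; rewrite normc_conj circle_char_norm.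
  rewrite cint_sum// big_allpairs_dep.
  (* For each [a], only b = a gives the zero frequency, and every other term integrates to 0. The N
     + 1 diagonal terms cancel the normalisation. *)
  rewrite (eq_big_seq (fun=> 1)); last first.
    move=> a; rewrite mem_iota add0n => /andP[_ aN].
    rewrite (bigD1_seq a) ?iota_uniq ?mem_iota// subrr.
    rewrite big1; last first.
      move=> b ba; rewrite cintZ; last first.
        apply: (@cL1_bounded _ _ _ _ _ 1).
          by apply: cmeas_conj; exact: circle_char_meas.
        by move=> y; rewrite normc_conj circle_char_norm.
      under [X in cint _ X]eq_fun do rewrite circle_char_conj.
      by rewrite cint_circle_char oppr_eq0 subr_eq0 eqz_nat eq_sym (negbTE ba) mulr0.
    rewrite [LHS]addr0 -[RHS](cint_cst (circle_mu R)); congr (cint _ _).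
    by apply/funext => y; rewrite circle_char_conj oppr0 !circle_char0 mulr1.
  rewrite big_const_seq count_predT size_iota iter_addr_0.
  rewrite -[in X in _ * X](rmorph_nat (real_complex R)) -rmorphM/= mulVf//.
Qed.

(** The hypothesis keeps x - y at distance [delta] from the integers. With z the ratio of the
    geometric sum D, the telescoping identity gives |D| |z - 1| <= 2, whose square is the 4, while
    |z - 1|^2 = 2 - 2 cos(2 pi (x - y)) is at least the denominator. *)
Lemma fejer_kernel_le (delta : R) N x y : 0 < delta -> delta <= `|x - y| <= 1 - delta ->
  normc (fkernel (@circle_char R) fejer_freq fejer_coef N x y) <=
  (4 / (2 - 2 * cos (2 * pi * delta))) / N.+1%:R.
Proof.
move=> d0 /andP[dt td]; set t := `|x - y| in dt td.
have pi0 := pi_gt0 R.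
have mcos (u v : R) : 0 <= u -> u <= v -> v <= 1 / 2 -> cos (2 * pi * v) <= cos (2 * pi * u).
  move=> u0 uv v1; rewrite leNgt ltr_cos ?in_itv/=.
  - by rewrite -leNgt ler_pM2l// mulr_gt0.
  - by apply/andP; split; nra.
  - by apply/andP; split; nra.
have cosd : cos (2 * pi * delta) < 1.
  by rewrite -[ltRHS]cos0 ltr_cos ?in_itv/=; [nra|apply/andP; split; nra..].
(* The cosine decreases on the first half period; beyond it, |x - y| is reflected to 1 - |x - y|. *)
have cost : cos (2 * pi * (x - y)) <= cos (2 * pi * delta).
  have -> : cos (2 * pi * (x - y)) = cos (2 * pi * t).
    rewrite -[LHS]cos_norm normrM ger0_norm//; nra.
  have [t1|t1] := leP t (1 / 2); first by apply: mcos => //; lra.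
  have -> : cos (2 * pi * t) = cos (2 * pi * (1 - t)).
    rewrite (_ : 2 * pi * (1 - t) = pi *+ 2 - 2 * pi * t); last by rewrite -mulr_natl; ring.
    by rewrite cosB cos2pi sin2pi mul1r mul0r addr0.
  by apply: mcos; lra.
rewrite fejer_kernelE normc_real ger0_norm; last by rewrite mulr_ge0// ?invr_ge0// sqr_ge0.
rewrite mulrC ler_pM2r ?invr_gt0// ler_pdivlMr; last lra.
set z := circle_char 1 x * circle_char (-1) y.
have nz : normc (z - 1) ^+ 2 = 2 - 2 * cos (2 * pi * (x - y)).
  have -> : z = cos (2 * pi * (x - y)) +i* sin (2 * pi * (x - y)).
    apply: complex_eq; rewrite /z /= rmorphN /= !mulr1 mulrN1 mulNr cosN sinN mulrBr.
      by rewrite cosB; ring.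
    by rewrite sinB; ring.
  have := cos2Dsin2 (2 * pi * (x - y)).
  by rewrite /= sqr_sqrtr ?addr_ge0 ?sqr_ge0// oppr0 addr0 sqrrB; lra.
have D2 : normc (dirichlet N x y) * normc (z - 1) <= 2.
  rewrite -normcM mulrC /dirichlet -/z -[iota 0 N.+1]/(index_iota 0 N.+1) big_mkord -subrX1.
  apply: le_trans (normcB _ _) _.
  have zk k : normc (z ^+ k) = 1.
    elim: k => [|k ih]; first by rewrite normc1.
    by rewrite exprS normcM ih mulr1 normcM !circle_char_norm mulr1.
  by rewrite zk normc1.
apply: le_trans (_ : (normc (dirichlet N x y) * normc (z - 1)) ^+ 2 <= _).
  by rewrite exprMn nz ler_wpM2l ?sqr_ge0//; lra.
rewrite (_ : 4 = 2 ^+ 2); last by rewrite -natrX.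
by rewrite !expr2 ler_pM ?mulr_ge0 ?normc_ge0.
Qed.

Lemma circle_mu_set1 x : circle_mu R [set x] = 0%E.
Proof. exact: integral_set1. Qed.

Lemma circle_ae_neq a : {ae circle_mu R, forall x : circle R, x != a}.
Proof.
exists [set a]; split; [exact: measurable_set1|exact: circle_mu_set1|].
by move=> x /= /negP; rewrite negbK => /eqP.
Qed.

Lemma circle_ae_itv : {ae circle_mu R, forall x : circle R, 0 < x < 1}.
Proof.
have h : {ae circle_mu R, forall x : circle R, 0 <= x <= 1}.
  exists (~` `[0, 1]); split.
  - by apply: measurableC; exact: measurable_itv.
  - by rewrite /circle_mu/= /uniform_prob integral_uniform_pdf setICl integral_set0.
  - by move=> x /= h; rewrite in_itv.
apply: filterS3 h (circle_ae_neq 0) (circle_ae_neq 1) => x /andP[x0 x1] n0 n1.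
by rewrite !lt_neqAle x0 x1 eq_sym n0 n1.
Qed.

End circle_characters.

Section ae_bounds.
Context {R : realType} {d : measure_display} {T : measurableType d}.
Variable mu : probability T R.

Lemma norm1_le_ae_integral (f : T -> R[i]) (g : T -> R) : cL1 mu f ->
  mu.-integrable setT (EFin \o g) -> (forall x, 0 <= g x) ->
  {ae mu, forall x, normc (f x) <= g x} -> norm1 mu f <= \int[mu]_x g x.
Proof.
move=> L ig g0 fg; have i1 := cL1_normc L.
rewrite -lee_fin !fineK ?integrable_fin_num//.
apply: ae_ge0_le_integral => //.
- by move=> x _; rewrite lee_fin normc_ge0.
- exact: measurable_int i1.
- by move=> x _; rewrite lee_fin.
- exact: measurable_int ig.
- by apply: filterS fg => x h _; rewrite lee_fin.
Qed.

Lemma norm1_le_ae f M : cL1 mu f -> 0 <= M -> {ae mu, forall x, normc (f x) <= M} ->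
  norm1 mu f <= M.
Proof.
move=> L M0 fM; rewrite -[leRHS]mulr1 -(fine_probability_setT mu) -Rintegral_cst//.
by apply: norm1_le_ae_integral => //; exact: finite_measure_integrable_cst.
Qed.

Lemma cvg_norm1_dominated (f_ : nat -> T -> R[i]) f (g : T -> R) :
  (forall N, cL1 mu (f_ N)) -> cL1 mu f -> mu.-integrable setT (EFin \o g) ->
  (forall N x, normc (f_ N x - f x) <= g x) ->
  {ae mu, forall x, vanishes (fun N => normc (f_ N x - f x))} ->
  vanishes (fun N => norm1 mu (fun x => f_ N x - f x)).
Proof.
move=> Lf_ Lf ig fg cf; have LB N := cL1B (Lf_ N) Lf.
apply: ecvg_vanishes.
have [] := @dominated_convergence _ _ _ mu setT measurableT
  (fun N x => (normc (f_ N x - f x))%:E) (cst 0%E) (EFin \o g).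
- by move=> N; exact: measurable_int (cL1_normc (LB N)).
- exact: measurable_cst.
- apply: filterS cf => x /vanishes_cvg h _; apply/fine_cvgP; split.
    by near=> n.
  by apply: h => N; exact: normc_ge0.
- exact: ig.
- by apply: aeW => x n _; rewrite gee0_abs ?lee_fin ?normc_ge0.
move=> _ _; rewrite [X in _ --> X](_ : _ = 0%E); last exact: integral0.
by under eq_fun do rewrite -EFin_norm1//.
Unshelve. all: by end_near. Qed.

End ae_bounds.

Section circle_smoothing.
Context {R : realType}.

Local Notation K := (fkernel (@circle_char R) fejer_freq fejer_coef).
Local Notation S := (smooth (circle_mu R) (@circle_char R) fejer_freq fejer_coef).

Lemma vanishes_inv (k : R) : 0 <= k -> vanishes (fun N => k / N.+1%:R).
Proof. by move=> k0; apply: vanishesZ k0 (cvg_vanishes (@cvg_harmonic R)). Qed.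

(** The error is the kernel average of 1_E(y) - 1_E(x), where only the y on the other side of [a]
    count. For them |x - y| >= |x - a|, and |x - y| <= 1 - [delta] because x and y lie in (0, 1) and
    [delta] is at most x and 1 - x. On that region the kernel is uniformly O(1/N). *)
Lemma fejer_indic_cvg (a x : circle R) : 0 < x < 1 -> x != a ->
  vanishes (fun N => normc (S N (cindic `]-oo, a[%classic) x - cindic `]-oo, a[%classic x)).
Proof.
move=> /andP[x0 x1] xa; set E : set (circle R) := `]-oo, a[%classic.
have mE : measurable E by exact: measurable_itv.
pose delta : R := Num.min `|x - a| (Num.min x (1 - x)).
have d0 : 0 < delta by rewrite !lt_min normr_gt0 subr_eq0 xa x0 subr_gt0 x1.
have dxa : delta <= `|x - a| by rewrite ge_min lexx.
have dx : delta <= x by rewrite !ge_min lexx orbT.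
have d1x : delta <= 1 - x by rewrite !ge_min lexx !orbT.
pose k := 4 / (2 - 2 * cos (2 * pi * delta)).
have k0 : 0 <= k by rewrite divr_ge0// subr_ge0 ler_piMr// cos_le1.
apply: vanishes_le (vanishes_inv k0) _ => N.
have LE : cL1 (circle_mu R) (cindic E) := cL1_cindic _ mE.
have LD : cL1 (circle_mu R) (fun y => cindic E y - cindic E x) := cL1B LE (cL1_cst _ _).
have -> : S N (cindic E) x - cindic E x =
    cint (circle_mu R) (fun y => K N x y * (cindic E y - cindic E x)).
  rewrite (smoothE circle_kernel_system)//.
  have -> : cindic E x = cint (circle_mu R) (fun y => K N x y * cindic E x).
    rewrite cintZr ?(fkernel_int circle_kernel_system) ?mul1r//.
    exact: cL1_fkernel circle_kernel_system _ _.
  rewrite -cintB.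
  - congr (cint _ _); apply/funext => y.
    rewrite cintZr ?(fkernel_int circle_kernel_system) ?mul1r ?mulrBr//.
    exact: cL1_fkernel circle_kernel_system _ _.
  - exact: cL1_fkernel_mul circle_kernel_system _ _ _ LE.
  - by apply: (cL1_fkernel_mul circle_kernel_system); exact: cL1_cst.
have LK := cL1_fkernel_mul circle_kernel_system N x LD.
apply: le_trans (normc_cint_le LK) _; apply: norm1_le_ae => //.
  by rewrite divr_ge0.
apply: filterS circle_ae_itv => y /andP[y0 y1].
rewrite normcM; have [xyE|xyE] := eqVneq (y < a) (x < a).
  have -> : cindic E y = cindic E x :> R[i] by rewrite !cindicE !mem_setE !in_itv/= xyE.
  rewrite subrr [normc 0](_ : _ = 0) ?mulr0; last exact: normc0.
  by rewrite divr_ge0.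
have xy : delta <= `|x - y| <= 1 - delta.
  apply/andP; split; last by rewrite ler_norml; lra.
  apply: le_trans dxa _; move: xyE.
  case: (ltP y a) => ya; case: (ltP x a) => xa' // _.
    by rewrite !ger0_norm ?subr_ge0//; lra.
  by rewrite !ler0_norm ?subr_le0//; lra.
apply: le_trans (_ : k / N.+1%:R * 1 <= _); last by rewrite mulr1.
rewrite ler_pM ?normc_ge0//; first exact: fejer_kernel_le.
rewrite !cindicE -rmorphB normc_real.
by case: (y \in E); case: (x \in E); rewrite ?subrr ?subr0 ?sub0r ?normrN ?normr0 ?normr1.
Qed.

(** Open lower half-lines generate the Borel sets and are stable under intersection. For their
    indicators the means converge almost everywhere with errors at most 2, so dominated convergence
    applies. *)
Lemma circle_smooths_to f : cL1 (circle_mu R) f ->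
  smooths_to (circle_mu R) (@circle_char R) fejer_freq fejer_coef f.
Proof.
move: f; apply: (@smooths_to_cL1 _ _ _ _ _ _ _ _ circle_kernel_system (@RGenInftyO.G R)).
- exact: RGenInftyO.measurableE.
- move=> _ _ [a ->] [b ->]; exists (Num.min a b).
  by apply/seteqP; split=> x /=; rewrite !in_itv/= lt_min => /andP.
move=> _ [a ->]; have mE : measurable (`]-oo, a[%classic : set (circle R)).
  exact: measurable_itv.
have L := cL1_cindic (circle_mu R) mE.
apply: (@cvg_norm1_dominated _ _ _ _ _ _ (cst 2)) => //.
- by move=> N; exact: cL1_smooth circle_kernel_system _ _.
- exact: finite_measure_integrable_cst.
- move=> N x; apply: le_trans (normcB _ _) _; rewrite (_ : cst 2 x = 1 + 1)//.
  rewrite lerD ?cindic_le1//; apply: (normc_smooth_le circle_kernel_system) => // y.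
  exact: cindic_le1.
- by apply: filterS2 circle_ae_itv (circle_ae_neq a) => x; exact: fejer_indic_cvg.
Qed.

End circle_smoothing.

(** * Hardy spaces and bounded functionals *)

Section complex_limits.
Context {R : realType}.

Lemma real_cauchy_limit (u : nat -> R) (v : nat -> R) : vanishes v ->
  (forall n m, `|u n - u m| <= v n + v m) ->
  exists l, vanishes (fun n => `|u n - l|).
Proof.
move=> hv uv; have cu : cvg (u @ \oo).
  apply/cauchy_cvgP/cauchy_exP => e e0.
  have [N0 h] := hv (e / 4) (divr_gt0 e0 (ltr0Sn _ 3)).
  exists (u N0); exists N0 => // n /= Nn; rewrite /ball /=.
  by apply: le_lt_trans (uv _ _) _; have := h _ Nn; have := h _ (leqnn N0); lra.
exists (limn u); apply: cvg_vanishes.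
have /cvgrPdist_le h : u @ \oo --> limn u by [].
apply/cvgrPdist_le => e e0; apply: filterS (h _ e0) => n.
by rewrite sub0r normrN normr_id distrC.
Qed.

(** The Cauchy condition is put as a sum of two separate errors because this is what the triangle
    inequality through a common limit or through S_n f - f produces. *)
Lemma complex_cauchy_limit (u : nat -> R[i]) (v : nat -> R) : vanishes v ->
  (forall n m, normc (u n - u m) <= v n + v m) ->
  exists l, vanishes (fun n => normc (u n - l)).
Proof.
move=> hv uv.
have Re_sub (z w : R[i]) : complex.Re (z - w) = complex.Re z - complex.Re w.
  by case: z w => [? ?] [? ?].
have Im_sub (z w : R[i]) : complex.Im (z - w) = complex.Im z - complex.Im w.
  by case: z w => [? ?] [? ?].
have [|a ha] := @real_cauchy_limit (fun n => complex.Re (u n)) v hv.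
  by move=> n m; rewrite -Re_sub; exact: le_trans (Re_le_normc _) (uv n m).
have [|b hb] := @real_cauchy_limit (fun n => complex.Im (u n)) v hv.
  by move=> n m; rewrite -Im_sub; exact: le_trans (Im_le_normc _) (uv n m).
exists (a +i* b); apply: vanishes_le (vanishesD ha hb) _ => n.
by apply: le_trans (normc_le_ReIm _) _; rewrite Re_sub Im_sub.
Qed.

Lemma vanishes_normc_eq (z w : R[i]) v : vanishes v -> (forall n, normc (z - w) <= v n) -> z = w.
Proof.
move=> hv h; apply/eqP; rewrite -subr_eq0; apply/eqP/eq0_normc/eqP.
rewrite eq_le normc_ge0 andbT; apply: vanishes_const.
exact: vanishes_le hv h.
Qed.

Lemma vanishes_le_bound (x y : R) v : vanishes v -> (forall n, x <= y + v n) -> x <= y.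
Proof.
move=> hv h; rewrite -subr_le0; apply: vanishes_const.
by apply: vanishes_le hv _ => n; rewrite lerBlDl.
Qed.

End complex_limits.

Section summability.
Context {R : realType} {d : measure_display} {T : measurableType d}.
Variable mu : probability T R.
Variables (Z : countType) (e : Z -> T -> R[i]) (s : nat -> seq Z) (c : nat -> R).

Record summable_system : Prop := SummableSystem {
  summable_kernel : kernel_system mu e s c;
  summable_smooths : forall f, cL1 mu f -> smooths_to mu e s c f }.

Hypothesis SS : summable_system.
Let KS := summable_kernel SS.
Let HS := summable_smooths SS.
Local Notation S := (smooth mu e s c).
Implicit Types (f g b : T -> R[i]).

(** Equal coefficients give equal means, and these converge to both functions. *)
Lemma fourier_unique f g : cL1 mu f -> cL1 mu g ->
  (forall n, fourier_coef mu e f n = fourier_coef mu e g n) ->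
  norm1 mu (fun x => f x - g x) = 0.
Proof.
move=> Lf Lg fg; apply/eqP; rewrite eq_le norm1_ge0 andbT; apply: vanishes_const.
apply: vanishes_le (vanishesD (HS Lf) (HS Lg)) _ => N.
rewrite [X in _ <= X + _]norm1_distC.
have -> : S N g = S N f.
  by apply/funext => x; congr (_ * _); apply: eq_bigr => n _; rewrite fg.
by apply: norm1_tri => //; exact: cL1_smooth.
Qed.

Lemma fourier_unique_ae f g : cL1 mu f -> cL1 mu g ->
  (forall n, fourier_coef mu e f n = fourier_coef mu e g n) ->
  {ae mu, forall x, f x = g x}.
Proof. by move=> Lf Lg fg; apply: norm1_eq0_ae => //; exact: fourier_unique. Qed.

Lemma fourier_unique_norm1 f g : cL1 mu f -> cL1 mu g ->
  (forall n, fourier_coef mu e f n = fourier_coef mu e g n) -> norm1 mu f = norm1 mu g.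
Proof.
move=> Lf Lg fg; have fg0 := fourier_unique Lf Lg fg.
apply/eqP; rewrite eq_le; apply/andP; split.
  by have := norm1_le_dist Lf Lg; rewrite fg0 addr0.
by have := norm1_le_dist Lg Lf; rewrite norm1_distC fg0 addr0.
Qed.

(* [int (smooth f) b = int f (smooth b)], and [smooth b] tends to [b] in L^1. *)
Lemma cint_smooth_cvg f b : cL1 mu f -> bounded_fct f -> cL1 mu b ->
  vanishes (fun N => normc (cint mu (fun x => S N f x * b x) - cint mu (fun x => f x * b x))).
Proof.
move=> Lf [M fM] Lb; apply: vanishes_le (vanishesZ (k := `|M|) _ (HS Lb)) _ => // N.
have mf := cL1_cmeas Lf; have Lfb := cL1Ml Lb mf fM.
have LB := cL1B (cL1_smooth KS N b) Lb.
rewrite (cint_smoothC KS)// -cintB//; last exact: (cL1_Msmooth KS).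
have E x : f x * S N b x - f x * b x = (S N b x - b x) * f x by ring.
under [X in cint _ X]eq_fun do rewrite E.
apply: le_trans (normc_cint_le (cL1M LB mf fM)) _.
apply: norm1M => // x; exact: le_trans (fM x) (ler_norm _).
Qed.

Lemma mult_op_image m f : mult_in_L1 mu e m f -> mult_image mu e m f (mult_op mu e m f).
Proof. by move=> [g h]; apply: xgetPex; exists g. Qed.

Lemma mult_image_eq m f g g' : mult_image mu e m f g -> mult_image mu e m f g' ->
  forall n, fourier_coef mu e g n = fourier_coef mu e g' n.
Proof. by move=> [_ h] [_ h'] n; rewrite h h'. Qed.

(** [mult_op] selects one of the almost everywhere equal images; the norm does not see the
    selection. *)
Lemma norm1_mult_op m f g : mult_image mu e m f g -> norm1 mu (mult_op mu e m f) = norm1 mu g.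
Proof.
move=> h; have h' : mult_image mu e m f (mult_op mu e m f) by apply: mult_op_image; exists g.
by apply: fourier_unique_norm1; [exact: h'.1|exact: h.1|exact: mult_image_eq h' h].
Qed.

Lemma mult_image_lin m a f g f' g' : cL1 mu f -> cL1 mu g ->
  mult_image mu e m f f' -> mult_image mu e m g g' ->
  mult_image mu e m (fun x => a * f x + g x) (fun x => a * f' x + g' x).
Proof.
move=> Lf Lg [Lf' hf] [Lg' hg]; split; first by apply: cL1D => //; exact: cL1Z.
move=> n; rewrite !(fourier_coefD KS)//; [|exact: cL1Z..].
by rewrite !(fourier_coefZ KS)// hf hg; ring.
Qed.

Section H1.
Variables m1 m2 : Z -> R[i].

(** Explicit witnesses for the three transforms. The selected [mult_op] need not be linear or
    commute with the means as a map on functions, whereas witnesses can be combined and smoothed at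
    will. *)
Definition H1_data f g1 g2 g12 := [/\ cL1 mu f, mult_image mu e m1 f g1,
  mult_image mu e m2 f g2 & mult_image mu e m1 g2 g12].

Lemma H1Re_data f : H1Re mu e m1 m2 f -> exists g1 g2 g12, H1_data f g1 g2 g12.
Proof.
move=> [Lf h1 h2 h12].
exists (mult_op mu e m1 f), (mult_op mu e m2 f), (mult_op mu e m1 (mult_op mu e m2 f)).
by split=> //; exact: mult_op_image.
Qed.

Lemma H1_dataP f g1 g2 g12 : H1_data f g1 g2 g12 ->
  H1Re mu e m1 m2 f /\ H1Re_norm mu e m1 m2 f =
  norm1 mu f + norm1 mu g1 + norm1 mu g2 + norm1 mu g12.
Proof.
move=> [Lf h1 h2 h12].
have h2' : mult_image mu e m2 f (mult_op mu e m2 f) by apply: mult_op_image; exists g2.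
(* [g12] is a transform of the witness [g2], but the norm transforms the selected image; the two
   have the same coefficients. *)
have h12' : mult_image mu e m1 (mult_op mu e m2 f) g12.
  by split; [exact: h12.1|move=> n; rewrite h12.2 (mult_image_eq h2 h2')].
split; first by split=> //; [exists g1|exists g2|exists g12].
by rewrite /H1Re_norm (norm1_mult_op h1) (norm1_mult_op h2) (norm1_mult_op h12').
Qed.

Lemma H1_data_lin a f g1 g2 g12 f' g1' g2' g12' :
  H1_data f g1 g2 g12 -> H1_data f' g1' g2' g12' ->
  H1_data (fun x => a * f x + f' x) (fun x => a * g1 x + g1' x)
    (fun x => a * g2 x + g2' x) (fun x => a * g12 x + g12' x).
Proof.
move=> [L i1 i2 i12] [L' i1' i2' i12']; split.
- by apply: cL1D => //; exact: cL1Z.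
- exact: mult_image_lin.
- exact: mult_image_lin.
- by apply: mult_image_lin => //; [exact: i2.1|exact: i2'.1].
Qed.

Lemma H1_data_smooth N f g1 g2 g12 : H1_data f g1 g2 g12 ->
  H1_data (S N f) (S N g1) (S N g2) (S N g12).
Proof.
move=> [L i1 i2 i12]; split; first exact: cL1_smooth.
- exact: mult_image_smooth KS _ _ _ _ i1.
- exact: mult_image_smooth KS _ _ _ _ i2.
- exact: mult_image_smooth KS _ _ _ _ i12.
Qed.

Lemma H1_data0 : H1_data (fun=> 0) (fun=> 0) (fun=> 0) (fun=> 0).
Proof.
have L := cL1_cst mu (0 : R[i]).
have h m : mult_image mu e m (fun=> 0) (fun=> 0).
  split=> // n; rewrite (_ : fourier_coef _ _ _ _ = 0) ?mulr0//.
  by rewrite /fourier_coef; under eq_fun do rewrite mul0r; rewrite cint_cst.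
by split.
Qed.

End H1.

(** The common ground of the Hardy spaces and their sum: a seminormed space of integrable functions
    on which the means are contractions tending strongly to the identity. Uniqueness and extension
    of functionals are proved once at this level. *)
Record smoothable (V : set (T -> R[i])) (N : (T -> R[i]) -> R) : Prop := Smoothable {
  smoothable_cL1 : forall f, V f -> cL1 mu f;
  smoothable0 : V (fun=> 0);
  smoothable_lin : forall a f g, V f -> V g -> V (fun x => a * f x + g x);
  smoothable_ge0 : forall f, V f -> 0 <= N f;
  smoothable_norm : forall a f g, V f -> V g ->
    N (fun x => a * f x + g x) <= normc a * N f + N g;
  smoothable_smooth : forall n f, V f -> V (S n f);
  smoothable_contr : forall n f, V f -> N (S n f) <= N f;
  smoothable_cvg : forall f, V f -> vanishes (fun n => N (fun x => S n f x - f x)) }.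

(** Smoothing or combining witnesses yields witnesses, so each property reduces to four L^1
    statements, one per term of the norm. *)
Lemma H1Re_smoothable m1 m2 : smoothable (H1Re mu e m1 m2) (H1Re_norm mu e m1 m2).
Proof.
split.
- by move=> f [].
- by have [] := H1_dataP (H1_data0 m1 m2).
- move=> a f g /H1Re_data[f1 [f2 [f12 Df]]] /H1Re_data[g1 [g2 [g12 Dg]]].
  by have [] := H1_dataP (H1_data_lin a Df Dg).
- by move=> f _; rewrite /H1Re_norm !addr_ge0 ?norm1_ge0.
- move=> a f g /H1Re_data[f1 [f2 [f12 Df]]] /H1Re_data[g1 [g2 [g12 Dg]]].
  have [_ ->] := H1_dataP (H1_data_lin a Df Dg).
  have [_ ->] := H1_dataP Df; have [_ ->] := H1_dataP Dg.
  have [Lf [Lf1 _] [Lf2 _] [Lf12 _]] := Df; have [Lg [Lg1 _] [Lg2 _] [Lg12 _]] := Dg.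
  have h (u v : T -> R[i]) : cL1 mu u -> cL1 mu v ->
      norm1 mu (fun x => a * u x + v x) <= normc a * norm1 mu u + norm1 mu v.
    by move=> Lu Lv; rewrite -norm1Z//; apply: norm1D => //; exact: cL1Z.
  have := h _ _ Lf Lg; have := h _ _ Lf1 Lg1; have := h _ _ Lf2 Lg2; have := h _ _ Lf12 Lg12.
  lra.
- move=> n f /H1Re_data[f1 [f2 [f12 Df]]].
  by have [] := H1_dataP (H1_data_smooth n Df).
- move=> n f /H1Re_data[f1 [f2 [f12 Df]]].
  have [_ ->] := H1_dataP Df; have [_ ->] := H1_dataP (H1_data_smooth n Df).
  have [Lf [Lf1 _] [Lf2 _] [Lf12 _]] := Df.
  by rewrite !lerD// norm1_smooth.
- move=> f /H1Re_data[f1 [f2 [f12 Df]]].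
  have [Lf [Lf1 _] [Lf2 _] [Lf12 _]] := Df.
  apply: vanishes_le (vanishesD (vanishesD (vanishesD (HS Lf) (HS Lf1)) (HS Lf2)) (HS Lf12)) _ => n.
  have := H1_data_lin (-1) Df (H1_data_smooth n Df).
  have E (u : T -> R[i]) : (fun x => -1 * u x + S n u x) = (fun x => S n u x - u x).
    by apply/funext => x; rewrite mulN1r addrC.
  by rewrite !E => /H1_dataP[_ ->].
Qed.

Section smoothable_space.
Variables (V : set (T -> R[i])) (N : (T -> R[i]) -> R).
Hypothesis SV : smoothable V N.

Lemma smoothableB f g : V f -> V g -> V (fun x => f x - g x).
Proof.
move=> Vf Vg; rewrite (_ : (fun x => _) = fun x => -1 * g x + f x).
  exact: (smoothable_lin SV).
by apply/funext => x; rewrite mulN1r addrC.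
Qed.

Lemma smoothable_normB f g : V f -> V g -> N (fun x => f x - g x) <= N f + N g.
Proof.
move=> Vf Vg; rewrite (_ : (fun x => _) = fun x => -1 * g x + f x).
  by apply: le_trans (smoothable_norm SV (-1) Vg Vf) _; rewrite normcN normc1 mul1r addrC.
by apply/funext => x; rewrite mulN1r addrC.
Qed.

(** The norm inequality alone leaves the value at 0 open. Since S_n 0 = 0, the convergence axiom at
    0 forces it to vanish. *)
Lemma smoothable_norm0 : N (fun=> 0) = 0.
Proof.
apply/eqP; rewrite eq_le (smoothable_ge0 SV (smoothable0 SV)) andbT; apply: vanishes_const.
apply: vanishes_le (smoothable_cvg SV (smoothable0 SV)) _ => n.
rewrite (_ : (fun x => S n (fun=> 0) x - 0) = fun=> 0)//.
apply/funext => x; rewrite subr0 /smooth big1 ?mulr0// => k _.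
rewrite /fourier_coef; under eq_fun do rewrite mul0r.
by rewrite cint_cst mul0r.
Qed.

Lemma smoothable_normZ a f : V f -> N (fun x => a * f x) <= normc a * N f.
Proof.
move=> Vf; have := smoothable_norm SV a Vf (smoothable0 SV).
by rewrite smoothable_norm0 addr0; under eq_fun do rewrite addr0.
Qed.

Lemma smoothableZ a f : V f -> V (fun x => a * f x).
Proof.
move=> Vf; have := smoothable_lin SV a Vf (smoothable0 SV).
by under eq_fun do rewrite addr0.
Qed.

Section functionals.
Variable L : (T -> R[i]) -> R[i].
Hypothesis BL : bounded_functional V N L.

Lemma functional0 : L (fun=> 0) = 0.
Proof.
have := BL.1 1 _ _ (smoothable0 SV) (smoothable0 SV).
have -> : (fun x : T => 1 * (fun=> 0) x + (fun=> 0) x) = (fun=> 0) :> (T -> R[i]).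
  by apply/funext => x; rewrite mulr0 addr0.
by rewrite mul1r => /eqP; rewrite eq_sym -subr_eq0 addrK => /eqP.
Qed.

Lemma functionalZ a f : V f -> L (fun x => a * f x) = a * L f.
Proof.
move=> Vf; have := BL.1 a _ _ Vf (smoothable0 SV).
by rewrite functional0 addr0; under eq_fun do rewrite addr0.
Qed.

Lemma functionalB f g : V f -> V g -> L (fun x => f x - g x) = L f - L g.
Proof.
move=> Vf Vg; have := BL.1 (-1) _ _ Vg Vf; rewrite mulN1r addrC => <-.
by congr L; apply/funext => x; rewrite mulN1r addrC.
Qed.

Lemma functional_norm_ge0 : (0 <= functional_norm V N L)%E.
Proof.
apply: ereal_sup_ubound; exists (fun=> 0); last by rewrite functional0 normc0.
by split; [exact: (smoothable0 SV)|rewrite smoothable_norm0].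
Qed.

Lemma functional_norm_fin : functional_norm V N L \is a fin_num.
Proof.
have [C hC] := BL.2; rewrite ge0_fin_numE ?functional_norm_ge0//.
apply: (@le_lt_trans _ _ (`|C|)%:E); last exact: ltry.
apply: ge_ereal_sup => _ [f [Vf Nf] <-]; rewrite lee_fin.
apply: le_trans (hC f Vf) _; have N0 := smoothable_ge0 SV Vf.
apply: le_trans (_ : `|C| * N f <= _); first by rewrite ler_wpM2r// ler_norm.
by rewrite -[leRHS]mulr1 ler_wpM2l.
Qed.

Lemma functional_normP f : V f -> normc (L f) <= fine (functional_norm V N L) * N f.
Proof.
move=> Vf; have N0 := smoothable_ge0 SV Vf.
(* Rescaling to norm 1 is impossible when the seminorm vanishes; then any bound C already gives L f
   = 0. *)
have [Nf0|Nf0] := eqVneq (N f) 0.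
  by have [C hC] := BL.2; have := hC f Vf; rewrite Nf0 !mulr0.
have Nf : 0 < N f by rewrite lt_neqAle eq_sym Nf0.
pose a : R[i] := ((N f)^-1)%:C.
have na : normc a = (N f)^-1 by rewrite normc_real ger0_norm// invr_ge0.
rewrite -ler_pdivrMr// mulrC -na -normcM -functionalZ// -lee_fin fineK ?functional_norm_fin//.
apply: ereal_sup_ubound; exists (fun x => a * f x) => //; split; first exact: smoothableZ.
by apply: le_trans (smoothable_normZ _ Vf) _; rewrite na mulVf.
Qed.

Lemma functional_norm_le M : 0 <= M -> (forall f, V f -> normc (L f) <= M * N f) ->
  (functional_norm V N L <= M%:E)%E.
Proof.
move=> M0 h; apply: ge_ereal_sup => _ [f [Vf Nf] <-]; rewrite lee_fin.
by apply: le_trans (h f Vf) _; rewrite -[leRHS]mulr1 ler_wpM2l.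
Qed.

Lemma functional_smooth_cvg f : V f -> vanishes (fun n => normc (L (S n f) - L f)).
Proof.
move=> Vf; have M0 : 0 <= fine (functional_norm V N L) by rewrite fine_ge0// functional_norm_ge0.
apply: vanishes_le (vanishesZ M0 (smoothable_cvg SV Vf)) _ => n.
have VS := smoothable_smooth SV n Vf.
by rewrite -functionalB//; apply: functional_normP; exact: smoothableB.
Qed.

End functionals.

(** The means of [f] are bounded members of the space, so both functionals are given there by the
    integral against [b]; continuity does the rest. *)
Lemma functional_unique b L L' :
  bounded_functional V N L -> represents mu V b L ->
  bounded_functional V N L' -> represents mu V b L' -> forall f, V f -> L f = L' f.
Proof.
move=> BL RL BL' RL' f Vf.
have h := functional_smooth_cvg BL Vf; have h' := functional_smooth_cvg BL' Vf.
apply: vanishes_normc_eq (vanishesD h h') _ => n.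
have E : L (S n f) = L' (S n f).
  have VS := smoothable_smooth SV n Vf; have bS := smooth_bounded KS n f.
  by rewrite RL ?RL'.
rewrite (_ : L f - L' f = - (L (S n f) - L f) + (L' (S n f) - L' f)); last by rewrite E; ring.
by apply: le_trans (normcD _ _) _; rewrite normcN.
Qed.

(** For bounded [f] the pairings of S_n f with [b] tend to that of [f], so a bound checked on means
    suffices. *)
Lemma bounded_pairing_le b M : cL1 mu b -> 0 <= M ->
  (forall n f, V f -> normc (cint mu (fun x => S n f x * b x)) <= M * N f) ->
  forall f, V f -> bounded_fct f -> normc (cint mu (fun x => f x * b x)) <= M * N f.
Proof.
move=> Lb M0 h f Vf bf; have Lf := smoothable_cL1 SV Vf.
apply: (vanishes_le_bound (cint_smooth_cvg Lf bf Lb)) => n.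
apply: le_trans (lerD (h n f Vf) (lexx _)).
set A := cint _ (fun x => f x * b x); set B := cint _ _.
rewrite [X in normc X <= _](_ : A = B - (B - A)); last by ring.
exact: normcB.
Qed.

(** L f is the limit of the pairings of S_n f with [b]. They form a Cauchy sequence because S_n f -
    S_m f is itself a bounded member of the space, to which the hypothesis applies. *)
Lemma functional_extension b M : cL1 mu b -> 0 <= M ->
  (forall f, V f -> bounded_fct f -> normc (cint mu (fun x => f x * b x)) <= M * N f) ->
  exists L, [/\ bounded_functional V N L, represents mu V b L &
    forall f, V f -> normc (L f) <= M * N f].
Proof.
move=> Lb M0 h; pose l n f := cint mu (fun x => S n f x * b x).
have VS n f : V f -> V (S n f) by exact: (smoothable_smooth SV).
have lB n m f : V f -> l n f - l m f = cint mu (fun x => (S n f x - S m f x) * b x).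
  move=> Vf; rewrite /l -cintB; [|exact: cL1_smoothM..].
  by congr (cint _ _); apply/funext => x; rewrite mulrBl.
have bB n m f : bounded_fct (fun x => S n f x - S m f x).
  have [Mn hn] := smooth_bounded KS n f; have [Mm hm] := smooth_bounded KS m f.
  by exists (Mn + Mm) => x; apply: le_trans (normcB _ _) _; exact: lerD.
(* Outside the space the value is irrelevant and is set to 0. *)
have ex f : exists z, V f -> vanishes (fun n => normc (l n f - z)).
  have [Vf|nVf] := pselect (V f); last by exists 0.
  have [|z hz] := complex_cauchy_limit (vanishesZ M0 (smoothable_cvg SV Vf)) (u := l ^~ f).
    move=> n m; rewrite lB//.
    apply: le_trans (h _ (smoothableB (VS n f Vf) (VS m f Vf)) (bB _ _ _)) _.
    rewrite -mulrDr ler_wpM2l//.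
    have := smoothable_normB (smoothableB (VS n f Vf) Vf) (smoothableB (VS m f Vf) Vf).
    by under [X in N X <= _ -> _]eq_fun do rewrite opprB addrA subrK.
  by exists z.
have [L hL] := choice ex.
have bound f : V f -> normc (L f) <= M * N f.
  move=> Vf; apply: (vanishes_le_bound (hL f Vf)) => n.
  have h1 := h _ (VS n f Vf) (smooth_bounded KS n f).
  have h2 : M * N (S n f) <= M * N f by rewrite ler_wpM2l// (smoothable_contr SV).
  apply: le_trans (lerD (le_trans h1 h2) (lexx _)); rewrite -/(l n f).
  rewrite [X in normc X <= _](_ : L f = l n f - (l n f - L f)); last by ring.
  exact: normcB.
exists L; split=> //.
- split; last by exists M.
  move=> a f g Vf Vg; have Vfg := smoothable_lin SV a Vf Vg.
  have Lf := smoothable_cL1 SV Vf; have Lg := smoothable_cL1 SV Vg.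
  have hv := vanishesD (hL _ Vfg) (vanishesD (vanishesZ (normc_ge0 a) (hL _ Vf)) (hL _ Vg)).
  apply: vanishes_normc_eq hv _ => n.
  have E : l n (fun x => a * f x + g x) = a * l n f + l n g.
    rewrite /l -cintZ; last exact: cL1_smoothM.
    rewrite -cintD; [|by apply: cL1Z; exact: cL1_smoothM|exact: cL1_smoothM].
    congr (cint _ _); apply/funext => x.
    by rewrite (smoothD KS)//; [rewrite (smoothZ KS)//; ring|exact: cL1Z].
  have key (A B C A' B' C' : R[i]) : A = a * B + C ->
      A' - (a * B' + C') = - (A - A') + (a * (B - B') + (C - C')) by move=> ->; ring.
  rewrite (key _ _ _ _ _ _ E).
  apply: le_trans (normcD _ _) _; rewrite normcN lerD2l.
  by apply: le_trans (normcD _ _) _; rewrite normcM.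
- move=> f Vf bf; have Lf := smoothable_cL1 SV Vf.
  apply: vanishes_normc_eq (vanishesD (hL f Vf) (cint_smooth_cvg Lf bf Lb)) _ => n.
  set z := cint _ _; rewrite [X in normc X](_ : _ = - (l n f - L f) + (l n f - z)); last by ring.
  by apply: le_trans (normcD _ _) _; rewrite normcN.
Qed.

End smoothable_space.

(** * Sums of two spaces with the quotient norm *)

Section sums.
Variables (V1 V2 : set (T -> R[i])) (N1 N2 : (T -> R[i]) -> R).
Hypotheses (SV1 : smoothable V1 N1) (SV2 : smoothable V2 N2).

Definition gsum_space : set (T -> R[i]) :=
  [set h | exists f g, [/\ V1 f, V2 g & h = (fun x => f x + g x)]].

Definition gsum_norm (h : T -> R[i]) : R :=
  inf [set r : R | exists f g, [/\ V1 f, V2 g,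
         h = (fun x => f x + g x) & r = N1 f + N2 g]].

Lemma gsum_norm_le f g : V1 f -> V2 g -> gsum_norm (fun x => f x + g x) <= N1 f + N2 g.
Proof.
move=> Vf Vg; apply: ge_inf; last by exists f, g.
exists 0 => _ [f' [g' [Vf' Vg' _ ->]]].
by rewrite addr_ge0 ?(smoothable_ge0 SV1) ?(smoothable_ge0 SV2).
Qed.

Lemma gsum_norm_adherent h eps : gsum_space h -> 0 < eps ->
  exists f g, [/\ V1 f, V2 g, h = (fun x => f x + g x) & N1 f + N2 g < gsum_norm h + eps].
Proof.
move=> [f [g [Vf Vg hE]]] e0.
have [|_ [f' [g' [Vf' Vg' hE' ->]]] lt] := @inf_adherent R
  [set r : R | exists f g, [/\ V1 f, V2 g,
         h = (fun x => f x + g x) & r = N1 f + N2 g]] eps e0.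
  split; first by exists (N1 f + N2 g), f, g.
  exists 0 => _ [f' [g' [Vf' Vg' _ ->]]].
  by rewrite addr_ge0 ?(smoothable_ge0 SV1) ?(smoothable_ge0 SV2).
by exists f', g'.
Qed.

Lemma gsum_norm_inl f : V1 f -> gsum_space f /\ gsum_norm f <= N1 f.
Proof.
move=> Vf; have E : f = (fun x => f x + 0) by apply/funext => x; rewrite addr0.
split; first by exists f, (fun=> 0); split=> //; exact: smoothable0 SV2.
rewrite {1}E; apply: le_trans (gsum_norm_le Vf (smoothable0 SV2)) _.
by rewrite (smoothable_norm0 SV2) addr0.
Qed.

Lemma gsum_norm_inr g : V2 g -> gsum_space g /\ gsum_norm g <= N2 g.
Proof.
move=> Vg; have E : g = (fun x => 0 + g x) by apply/funext => x; rewrite add0r.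
split; first by exists (fun=> 0), g; split=> //; exact: smoothable0 SV1.
rewrite {1}E; apply: le_trans (gsum_norm_le (smoothable0 SV1) Vg) _.
by rewrite (smoothable_norm0 SV1) add0r.
Qed.

(** The means act on each summand of a decomposition, so contraction and convergence pass from the
    summands to the sum; the infimum is handled by near-optimal decompositions. *)
Lemma gsum_smoothable : smoothable gsum_space gsum_norm.
Proof.
have L1 := smoothable_cL1 SV1; have L2 := smoothable_cL1 SV2.
have SD n f g : V1 f -> V2 g -> S n (fun x => f x + g x) = fun x => S n f x + S n g x.
  by move=> /L1 Lf /L2 Lg; exact: smoothD.
have lin a f g f' g' : (fun x => a * (f x + g x) + (f' x + g' x)) =
    (fun x => (a * f x + f' x) + (a * g x + g' x)) :> (T -> R[i]).
  by apply/funext => x; ring.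
split.
- by move=> _ [f [g [/L1 Lf /L2 Lg ->]]]; exact: cL1D.
- by have [] := gsum_norm_inl (smoothable0 SV1).
- move=> a _ _ [f [g [Vf Vg ->]]] [f' [g' [Vf' Vg' ->]]]; rewrite lin.
  exists (fun x => a * f x + f' x), (fun x => a * g x + g' x); split=> //.
    exact: (smoothable_lin SV1).
  exact: (smoothable_lin SV2).
- move=> h [f [g [Vf Vg hE]]]; apply: lb_le_inf; first by exists (N1 f + N2 g), f, g.
  move=> _ [f' [g' [Vf' Vg' _ ->]]].
  by rewrite addr_ge0 ?(smoothable_ge0 SV1) ?(smoothable_ge0 SV2).
- move=> a h k Sh Sk; apply/ler_addgt0Pr => eps e0.
  (* The near-optimal decompositions of [h] and [k] cost |a| ep and ep respectively, together
     eps. *)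
  pose ep := eps / (normc a + 1).
  have a1 : 0 < normc a + 1 by rewrite ltr_wpDl ?normc_ge0.
  have ep0 : 0 < ep by rewrite divr_gt0.
  have [f [g [Vf Vg hE hlt]]] := gsum_norm_adherent Sh ep0.
  have [f' [g' [Vf' Vg' kE klt]]] := gsum_norm_adherent Sk ep0.
  rewrite [in X in X <= _]hE [in X in X <= _]kE lin.
  apply: le_trans (gsum_norm_le (smoothable_lin SV1 a Vf Vf') (smoothable_lin SV2 a Vg Vg')) _.
  apply: le_trans (lerD (smoothable_norm SV1 a Vf Vf') (smoothable_norm SV2 a Vg Vg')) _.
  have epE : ep * (normc a + 1) = eps by rewrite /ep divfK// gt_eqF.
  have := ler_wpM2l (normc_ge0 a) (ltW hlt); lra.
- move=> n _ [f [g [Vf Vg ->]]]; rewrite SD//; exists (S n f), (S n g); split=> //.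
    exact: (smoothable_smooth SV1).
  exact: (smoothable_smooth SV2).
- move=> n h Sh; apply/ler_addgt0Pr => eps e0.
  have [f [g [Vf Vg -> hlt]]] := gsum_norm_adherent Sh e0; rewrite SD//.
  apply: le_trans (gsum_norm_le (smoothable_smooth SV1 n Vf) (smoothable_smooth SV2 n Vg)) _.
  apply: le_trans (lerD (smoothable_contr SV1 n Vf) (smoothable_contr SV2 n Vg)) _.
  by rewrite ltW// {1}[X in gsum_norm X](_ : _ = h).
- move=> _ [f [g [Vf Vg ->]]].
  apply: vanishes_le (vanishesD (smoothable_cvg SV1 Vf) (smoothable_cvg SV2 Vg)) _ => n.
  rewrite SD// (_ : (fun x => _) = fun x => (S n f x - f x) + (S n g x - g x)).
    apply: gsum_norm_le.
      by apply: (smoothableB SV1) => //; exact: (smoothable_smooth SV1).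
    by apply: (smoothableB SV2) => //; exact: (smoothable_smooth SV2).
  by apply/funext => x; ring.
Qed.

End sums.

End summability.

(** * The Riesz-Fischer theorem *)

Section L1_completeness.
Context {R : realType} {d : measure_display} {T : measurableType d}.
Variable mu : probability T R.

(** The series G of the |g_(k+1) - g_k| has integral at most 1, hence is finite almost everywhere.
    Where it is finite, the sequence is Cauchy with the tail of G as rate, and G dominates the
    errors. *)
Lemma summable_differences_limit (g : nat -> T -> R[i]) : (forall k, cL1 mu (g k)) ->
  (forall k, norm1 mu (fun x => g k.+1 x - g k x) <= 1 / (2 ^ k.+1)%:R) ->
  exists f, cL1 mu f /\ vanishes (fun k => norm1 mu (fun x => g k x - f x)).
Proof.
move=> Lg gD; pose D k x := normc (g k.+1 x - g k x).
have LD k := cL1B (Lg k.+1) (Lg k).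
have D0 k x : 0 <= D k x by exact: normc_ge0.
pose G x : \bar R := (\sum_(k <oo) (D k x)%:E)%E.
have mD k : measurable_fun setT (fun x => (D k x)%:E).
  exact: measurable_int (cL1_normc (LD k)).
have mG : measurable_fun setT G.
  by apply: ge0_emeasurable_sum => // k x _ _; rewrite lee_fin.
have G0 x : (0 <= G x)%E by apply: nneseries_ge0 => k _ _; rewrite lee_fin.
have intG : mu.-integrable setT G.
  apply/integrableP; split=> //.
  under eq_integral do rewrite gee0_abs//.
  rewrite integral_nneseries//; last by move=> k x _; rewrite lee_fin.
  apply: (@le_lt_trans _ _ (1%:E)); last exact: ltry.
  apply: le_trans (epsilon_trick0 xpredT (@ler01 R)).
  apply: lee_nneseries => k _.
    by move=> _; apply: integral_ge0 => x _; rewrite lee_fin.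
  by rewrite -EFin_norm1// lee_fin.
pose A := [set x | G x \is a fin_num].
have mA : measurable A by rewrite -[A]setTI; exact: emeasurable_fin_num.
have aeA : {ae mu, forall x, A x}.
  by have := integrable_ae measurableT intG; apply: filterS => x; exact.
pose u x k := fine (G x) - \sum_(0 <= j < k) D j x.
have sumG x k : A x -> \sum_(0 <= j < k) D j x <= fine (G x).
  move=> Ax; rewrite -lee_fin fineK// -sumEFin.
  by apply: nneseries_lim_ge => j _ _; rewrite lee_fin.
have vu x : A x -> vanishes (u x).
  move=> Ax; have : (\sum_(0 <= j < k) (D j x)%:E)%E @[k --> \oo] --> (fine (G x))%:E.
    by rewrite fineK//; apply: is_cvg_nneseries => j _ _; rewrite lee_fin.
  under eq_fun do rewrite sumEFin.
  move=> /fine_cvgP[_ h]; apply: cvg_vanishes.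
  have -> : 0 = fine (G x) - fine (G x) by rewrite subrr.
  by apply: cvgB => //; exact: cvg_cst.
have tele x n m : (n <= m)%N -> normc (g n x - g m x) <= \sum_(n <= j < m) D j x.
  move=> nm; rewrite -normcN opprB -(telescope_sumr (fun k => g k x) nm).
  exact: normc_sum.
have gu x n m : A x -> (n <= m)%N -> normc (g n x - g m x) <= u x n.
  move=> Ax nm; apply: le_trans (tele x _ _ nm) _.
  by rewrite /u lerBrDl -(big_cat_nat _ _)//=; exact: sumG.
have u0 x n : A x -> 0 <= u x n by move=> Ax; rewrite subr_ge0 sumG.
have guu x n m : A x -> normc (g n x - g m x) <= u x n + u x m.
  move=> Ax; have [nm|/ltnW mn] := leqP n m.
    by apply: le_trans (gu x _ _ Ax nm) _; rewrite lerDl u0.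
  by rewrite -normcN opprB; apply: le_trans (gu x _ _ Ax mn) _; rewrite lerDr u0.
have ex x : exists l, [/\ A x -> vanishes (fun n => normc (g n x - l)) & ~ A x -> l = 0].
  have [Ax|nAx] := pselect (A x); last by exists 0; split.
  by have [l hl] := complex_cauchy_limit (vu x Ax) (fun n m => guu x n m Ax); exists l; split.
have [f hf] := choice ex.
(* Cut off to the set where G is finite, with limit 0 elsewhere, the sequence converges at every
   point, so its limit is measurable. *)
pose h k x := g k x * cindic A x.
have hA k x : A x -> h k x = g k x.
  by move=> Ax; rewrite /h cindicE (mem_set Ax) mulr1.
have hN k x : ~ A x -> h k x = 0.
  by move=> Ax; rewrite /h cindicE (memNset Ax) mulr0.
have ghf k x : A x -> normc (g k x - f x) <= u x k.
  move=> Ax; have [/(_ Ax) hx _] := hf x.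
  apply: (vanishes_le_bound (vanishesD (vu x Ax) hx)) => m.
  rewrite addrA; apply: le_trans (lerD (guu x k m Ax) (lexx _)).
  by apply: le_trans (normcD _ _); rewrite addrA subrK.
have hv x : vanishes (fun k => normc (h k x - f x)).
  have [Ax|nAx] := pselect (A x).
    apply: vanishes_le ((hf x).1 Ax) _ => k; rewrite hA//.
  apply: vanishes_le vanishes0 _ => k; rewrite hN// ((hf x).2 nAx) subrr.
  by rewrite (_ : normc 0 = 0)//; exact: normc0.
have Lh k : cL1 mu (h k) := cL1M (Lg k) (cmeas_cindic mA) (cindic_le1 A).
have mf : cmeas f.
  split.
    apply: (measurable_fun_cvg (h := fun k x => complex.Re (h k x))).
      by move=> k; exact: (cL1_cmeas (Lh k)).1.
    move=> x _; apply/cvgrPdist_le => eps e0; have [N0 hN0] := hv x eps e0.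
    exists N0 => // k /= /hN0; apply: le_trans; rewrite distrC.
    by have := Re_le_normc (h k x - f x); case: (h k x) (f x) => [? ?] [? ?].
  apply: (measurable_fun_cvg (h := fun k x => complex.Im (h k x))).
    by move=> k; exact: (cL1_cmeas (Lh k)).2.
  move=> x _; apply/cvgrPdist_le => eps e0; have [N0 hN0] := hv x eps e0.
  exists N0 => // k /= /hN0; apply: le_trans; rewrite distrC.
  by have := Im_le_normc (h k x - f x); case: (h k x) (f x) => [? ?] [? ?].
have iG : mu.-integrable setT (EFin \o (fun x => fine (G x))).
  apply: le_integrable intG => //.
    by apply/measurable_EFinP; exact: (measurableT_comp (fine_measurable _) mG).
  by move=> x _ /=; case: (G x) => [r| |] //=; rewrite ?normr0 ?leey.
have hfG k x : normc (h k x - f x) <= fine (G x).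
  have [Ax|nAx] := pselect (A x).
    rewrite hA//; apply: le_trans (ghf k x Ax) _.
    by rewrite /u gerBl sumr_ge0.
  rewrite hN// ((hf x).2 nAx) subrr (_ : normc 0 = 0); last exact: normc0.
  exact: fine_ge0.
have Lf : cL1 mu f.
  have iS := integrableD measurableT (cL1_normc (Lh 0%N)) iG.
  apply: (@cL1_dom _ _ _ _ _ (fun x => normc (h 0%N x) + fine (G x))) => // x.
  rewrite [X in normc X <= _](_ : f x = h 0%N x - (h 0%N x - f x)); last by ring.
  by apply: le_trans (normcB _ _) _; rewrite lerD2l.
exists f; split=> //.
have hc := @cvg_norm1_dominated _ _ _ mu h f _ Lh Lf iG hfG (aeW _ hv).
apply: vanishes_le hc _ => k.
apply: le_trans (norm1_tri (Lg k) (Lh k) Lf) _.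
rewrite -[leRHS]add0r lerD2r; apply: norm1_le_ae => //; first exact: cL1B.
apply: filterS aeA => x Ax; rewrite hA// subrr (_ : normc 0 = 0)//; exact: normc0.
Qed.

Lemma L1_complete (f_ : nat -> T -> R[i]) v : (forall n, cL1 mu (f_ n)) -> vanishes v ->
  (forall n m, norm1 mu (fun x => f_ n x - f_ m x) <= v n + v m) ->
  exists f, cL1 mu f /\ vanishes (fun n => norm1 mu (fun x => f_ n x - f x)).
Proof.
move=> Lf hv fv.
(* Half of 2^-(k+1) at index k leaves a total of at most 2^-(k+1) between consecutive terms of the
   subsequence. *)
have p2 k : 0 < (1 / (2 ^ k.+1)%:R) / 2 :> R.
  by rewrite !divr_gt0// ltr0n expn_gt0.
have [Nk hNk] := choice (fun k => hv _ (p2 k)).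
pose g k := f_ (Nk k).
have [|k|f [Lff hf]] := @summable_differences_limit g.
- by move=> k; exact: Lf.
- apply: le_trans (fv _ _) _.
  have h1 := hNk k.+1 _ (leqnn _); have h2 := hNk k _ (leqnn _).
  have h3 : 1 / (2 ^ k.+2)%:R <= 1 / (2 ^ k.+1)%:R :> R.
    by rewrite !div1r lef_pV2 ?posrE ?ltr0n ?expn_gt0// ler_nat leq_exp2l.
  by lra.
exists f; split=> //; apply: vanishes_le hv _ => n.
have hNv : vanishes (fun k => v (Nk k)).
  apply: vanishes_le (vanishes_inv ler01) _ => k; apply: le_trans (hNk k _ (leqnn _)) _.
  apply: le_trans (_ : 1 / (2 ^ k.+1)%:R <= _).
    by rewrite ler_pdivrMr// ler_peMr ?ler1n// div1r invr_ge0.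
  by rewrite !div1r lef_pV2 ?posrE ?ltr0n ?expn_gt0// ler_nat ltnW// ltn_expl.
apply: (vanishes_le_bound (vanishesD hNv hf)) => k.
apply: le_trans (norm1_tri (Lf n) (Lf (Nk k)) Lff) _.
by rewrite addrA lerD2r.
Qed.

End L1_completeness.

Section riesz_fischer.
Context {R : realType} {d : measure_display} {T : measurableType d}.
Variable mu : probability T R.
Variables (Z : countType) (e : Z -> T -> R[i]) (s : nat -> seq Z) (c : nat -> R).
Hypothesis KS : kernel_system mu e s c.

Definition trig_poly (F : seq Z) (a : Z -> R[i]) x := \sum_(n <- F) a n * e n x.

Lemma cmeas_trig_poly F a : cmeas (trig_poly F a).
Proof. by apply: cmeas_sum => n; apply: cmeasM; [exact: cmeas_cst|exact: (char_meas KS)]. Qed.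

Lemma trig_poly_bounded F a x : normc (trig_poly F a x) <= \sum_(n <- F) normc (a n).
Proof.
apply: le_trans (normc_sum _ _) _; apply: ler_sum => n _.
by rewrite normcM (char_norm KS) mulr1.
Qed.

Lemma cL1_trig_poly F a : cL1 mu (trig_poly F a).
Proof. exact: cL1_bounded (cmeas_trig_poly F a) (trig_poly_bounded F a). Qed.

Lemma fourier_coef_trig_poly F a n : uniq F ->
  fourier_coef mu e (trig_poly F a) n = if n \in F then a n else 0.
Proof.
move=> uF; rewrite (fourier_coef_sum KS); last by move=> k; apply: cL1Z; exact: (cL1_char KS).
rewrite (eq_bigr (fun k => if k == n then a k else 0)); last first.
  move=> k _; rewrite (fourier_coefZ KS); last exact: (cL1_char KS).
  by rewrite (fourier_coef_char KS); case: eqP => _; rewrite ?mulr1 ?mulr0.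
rewrite -big_mkcond /=; case: ifPn => [nF|nF].
  by rewrite -big_filter filter_pred1_uniq// big_seq1.
by rewrite big1_seq// => k /andP[/eqP-> kF]; rewrite kF in nF.
Qed.

(** Cauchy-Schwarz against the constant 1, obtained by integrating (|p| - m)^2 >= 0 with m the mean
    of |p|. *)
Lemma norm1_sqr_le (p : T -> R[i]) M : cmeas p -> (forall x, normc (p x) <= M) ->
  norm1 mu p ^+ 2 <= \int[mu]_x (normc (p x) ^+ 2).
Proof.
move=> mp pM; have Lp : cL1 mu p := cL1_bounded _ mp pM.
set m := norm1 mu p; have ip := cL1_normc Lp.
have ip2 : mu.-integrable setT (EFin \o (fun x => normc (p x) ^+ 2)).
  apply: measurable_bounded_integrable => //; first by rewrite ltey_eq fin_num_measure.
    by apply: measurable_funX; exact: measurable_normc.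
  exists (M ^+ 2); split=> [|M' M1 x _ /=]; first exact: num_real.
  apply: le_trans (ltW M1).
  rewrite ger0_norm ?sqr_ge0// !expr2.
  by have := normc_ge0 (p x); have := pM x; move=> *; rewrite ler_pM.
have i2 : mu.-integrable setT (EFin \o (fun x => 2 * m * normc (p x))).
  by rewrite [_ \o _](_ : _ = (fun x => (2 * m)%:E * (normc (p x))%:E)%E)//; exact: integrableZl.
have i3 : mu.-integrable setT (EFin \o cst (m ^+ 2)) by exact: finite_measure_integrable_cst.
have h : 0 <= \int[mu]_x (normc (p x) ^+ 2 - 2 * m * normc (p x) + m ^+ 2).
  apply: Rintegral_ge0 => x _.
  by rewrite (_ : _ + _ = (normc (p x) - m) ^+ 2) ?sqr_ge0//; ring.
rewrite RintegralD// in h; last first.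
  rewrite [_ \o _](_ : _ =
    (fun x => (normc (p x) ^+ 2)%:E - (2 * m * normc (p x))%:E)%E)//.
  exact: integrableB.
rewrite RintegralB// RintegralZl// Rintegral_cst// fine_probability_setT in h.
rewrite -/(norm1 mu p) -/m in h; nra.
Qed.

(** The right-hand side is the squared L^2 norm, by orthonormality of the characters. *)
Lemma norm1_trig_poly F a : uniq F ->
  norm1 mu (trig_poly F a) ^+ 2 <= \sum_(n <- F) normc (a n) ^+ 2.
Proof.
move=> uF; apply: le_trans (norm1_sqr_le (cmeas_trig_poly F a) (trig_poly_bounded F a)) _.
rewrite le_eqVlt; apply/orP; left; apply/eqP; apply: (@complexI R).
set p := trig_poly F a; have Lp : cL1 mu p := cL1_trig_poly F a.
have Lpp : cL1 mu (fun x => p x * Num.conj (p x)).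
  apply: (cL1M (M := \sum_(n <- F) normc (a n))) => //.
    by apply: cmeas_conj; exact: cmeas_trig_poly.
  by move=> x; rewrite normc_conj trig_poly_bounded.
transitivity (cint mu (fun x => p x * Num.conj (p x))).
  under [X in cint _ X]eq_fun do rewrite -csqr_normc.
  apply: complex_eq => //=.
  by rewrite Rintegral_cst// mul0r.
transitivity (cint mu (fun x => \sum_(n <- F) Num.conj (a n) * (p x * Num.conj (e n x)))).
  congr (cint _ _); apply/funext => x; rewrite rmorph_sum mulr_sumr.
  by apply: eq_bigr => n _; rewrite rmorphM /= mulrCA.
rewrite cint_sum; last by move=> n; apply: cL1Z; exact: (cL1_mul_conj KS).
rewrite rmorph_sum /= !big_seq; apply: eq_bigr => n nF.
rewrite cintZ; last exact: (cL1_mul_conj KS).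
rewrite -/(fourier_coef mu e p n) fourier_coef_trig_poly// nF.
by rewrite csqr_normc mulrC.
Qed.

(** Frequencies are enumerated by their codes, [F K] being those of code below K. The square sums
    [sg K] increase to S, and by orthogonality the partial sums from index J on stay within sqrt(S -
    sg J) of the J-th one, already in L^1. *)
Lemma riesz_fischer (a : Z -> R[i]) B :
  (forall F, uniq F -> \sum_(n <- F) normc (a n) ^+ 2 <= B) ->
  exists b, cL1 mu b /\ forall n, fourier_coef mu e b n = a n.
Proof.
move=> hB; pose F K := pmap (@pickle_inv Z) (iota 0 K).
pose G J K := pmap (@pickle_inv Z) (iota J (K - J)).
have uF K : uniq (F K) by apply: pmap_uniq (iota_uniq _ _); exact: pickle_invK.
have uG J K : uniq (G J K) by apply: pmap_uniq (iota_uniq _ _); exact: pickle_invK.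
have FG J K : (J <= K)%N -> F K = F J ++ G J K.
  by move=> JK; rewrite /F -{1}(subnKC JK) iotaD pmap_cat.
pose sg K := \sum_(n <- F K) normc (a n) ^+ 2.
have sgG J K : (J <= K)%N -> \sum_(n <- G J K) normc (a n) ^+ 2 = sg K - sg J.
  by move=> JK; rewrite /sg (FG J K JK) big_cat /= [RHS]addrC addKr.
have ndsg J K : (J <= K)%N -> sg J <= sg K.
  by move=> JK; rewrite -subr_ge0 -sgG// sumr_ge0// => n _; rewrite sqr_ge0.
pose S := sup (range sg).
have hS : has_sup (range sg).
  by split; [exists (sg 0%N); exists 0%N|exists B => _ [K _ <-]; exact: hB].
have sgS K : sg K <= S by apply: ub_le_sup; [exact: hS.2|exists K].
pose v K := Num.sqrt (S - sg K).
have hv : vanishes v.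
  move=> eps e0; have e2 : 0 < eps ^+ 2 by rewrite exprn_gt0.
  have [_ [J _ <-] SJ] := sup_adherent e2 hS.
  exists J => K /ndsg JK; rewrite -(ger0_norm (ltW e0)) -sqrtr_sqr ler_wsqrtr//.
  rewrite -/S in SJ; lra.
pose b_ K := trig_poly (F K) a.
have Lb K : cL1 mu (b_ K) by exact: cL1_trig_poly.
have bJK J K : (J <= K)%N -> norm1 mu (fun x => b_ J x - b_ K x) <= v J.
  move=> JK; rewrite norm1_distC.
  have -> : (fun x => b_ K x - b_ J x) = trig_poly (G J K) a.
    by apply/funext => x; rewrite /b_ /trig_poly (FG _ _ JK) big_cat /= [LHS]addrC addKr.
  rewrite -(ger0_norm (norm1_ge0 _ _)) -sqrtr_sqr ler_wsqrtr//.
  apply: le_trans (norm1_trig_poly _ (uG J K)) _.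
  by rewrite sgG// lerD2r.
have v0 K : 0 <= v K by exact: sqrtr_ge0.
have [|b [Lbb hb]] := L1_complete Lb hv.
  move=> J K; have [JK|/ltnW KJ] := leqP J K.
    by apply: le_trans (bJK _ _ JK) _; rewrite lerDl.
  by rewrite norm1_distC; apply: le_trans (bJK _ _ KJ) _; rewrite lerDr.
exists b; split=> // n.
suff : vanishes (fun K => normc (fourier_coef mu e b n - a n)).
  by move=> h; apply: vanishes_normc_eq h _.
move=> eps e0; have [N0 hN0] := hb eps e0.
(* The sequence is constant, so one good K is enough: beyond the code of [n] the partial sum has
   n-th coefficient exactly a n, and beyond N0 it is within eps of [b]. *)
exists 0%N => _ _; pose K := maxn N0 (pickle n).+1.
apply: le_trans (hN0 K (leq_maxl _ _)).
have nF : n \in F K.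
  rewrite mem_pmap; apply/mapP; exists (pickle n); last by rewrite pickleK_inv.
  by rewrite mem_iota /= add0n leq_maxr.
have <- : fourier_coef mu e (b_ K) n = a n by rewrite fourier_coef_trig_poly// nF.
rewrite -(fourier_coefB KS)// norm1_distC.
by apply: (normc_fourier_coef KS); exact: cL1B.
Qed.

End riesz_fischer.

Section ae_domination.
Context {R : realType} {d : measure_display} {T : measurableType d}.
Variable mu : probability T R.

(** The pointwise infimum of the g n has integral 0. The index obtained depends on the point:
    convergence of the integrals does not give almost everywhere convergence of the whole
    sequence. *)
Lemma ae_small_of_vanishing_integrals (g : nat -> T -> R) :
  (forall n, mu.-integrable setT (EFin \o g n)) -> (forall n x, 0 <= g n x) ->
  vanishes (fun n => \int[mu]_x g n x) ->
  {ae mu, forall x, forall eps, 0 < eps -> exists n, g n x <= eps}.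
Proof.
move=> ig g0 vg; pose h x := einfs (fun n => (g n x)%:E) 0%N.
have mh : measurable_fun setT h.
  by apply: measurable_fun_einfs => n; exact: measurable_int (ig n).
have h0 x : (0 <= h x)%E by apply: le_ereal_inf_tmp => _ [n _ <-]; rewrite lee_fin.
have hg n x : (h x <= (g n x)%:E)%E by apply: ereal_inf_lbound; exists n.
have intI : (\int[mu]_x h x = 0)%E.
  apply/eqP; rewrite eq_le; apply/andP; split; last exact: integral_ge0.
  apply/lee_addgt0Pr => eps e0; rewrite add0e; have [n /(_ n (leqnn n)) le_eps] := vg eps e0.
  apply: le_trans (_ : \int[mu]_x (g n x)%:E <= _)%E.
    apply: ge0_le_integral => //; first exact: measurable_int (ig n).

  by rewrite -(fineK (integrable_fin_num measurableT (ig n))) lee_fin.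
have aeI : ae_eq mu setT h (cst 0%E).
  apply/(ae_eq_integral_abs mu measurableT mh); rewrite -intI.
  by apply: eq_integral => x _; rewrite gee0_abs.
apply: filterS aeI => x /(_ I) hx0 eps e0.
have : (h x < eps%:E)%E by rewrite hx0 lte_fin.
by move=> /ereal_inf_lt[_ [n _ <-]]; rewrite lte_fin => /ltW le_eps; exists n.
Qed.

End ae_domination.

(** * Slices *)

Section slices.
Context {R : realType} {d1 d2 : measure_display}
  {T1 : measurableType d1} {T2 : measurableType d2}.
Variables (mu1 : probability T1 R) (mu2 : probability T2 R).
Variables (Z1 Z2 : countType) (e1 : Z1 -> T1 -> R[i]) (e2 : Z2 -> T2 -> R[i]).
Variables (s1 : nat -> seq Z1) (s2 : nat -> seq Z2) (c1 c2 : nat -> R).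
Hypotheses (SS1 : summable_system mu1 e1 s1 c1) (SS2 : summable_system mu2 e2 s2 c2).

Local Notation mu := (prod_prob mu1 mu2).
Local Notation e := (prod_char e1 e2).
Local Notation s := (prod_freq s1 s2).
Local Notation c := (prod_coef c1 c2).
Let KS1 := summable_kernel SS1.
Let KS2 := summable_kernel SS2.
Let KS : kernel_system mu e s c := prod_kernel_system KS1 KS2.

Lemma prod_summable_system : summable_system mu e s c.
Proof.
split; first exact: KS.
exact: prod_smooths_to KS1 KS2 (summable_smooths SS1) (summable_smooths SS2).
Qed.

Let SS := prod_summable_system.
Local Notation S := (smooth mu e s c).
Local Notation S1 := (smooth mu1 e1 s1 c1).

Lemma cmeas_slice (f : T1 * T2 -> R[i]) y : cmeas f -> cmeas (fun x => f (x, y)).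
Proof. by move=> mf; apply: cmeas_comp mf _; exact: pair2_measurable. Qed.

Lemma cL1_smooth_slice N f y : cL1 mu1 (fun x => S N f (x, y)).
Proof.
have [M h] := smooth_bounded KS N f.
exact: cL1_bounded (cmeas_slice y (cmeas_smooth KS N f)) (fun x => h (x, y)).
Qed.

Lemma fourier_coef_smooth_slice N f y k :
  fourier_coef mu1 e1 (fun x => S N f (x, y)) k =
  (c N)%:C * \sum_(n <- s N) fourier_coef mu e f n * e2 n.2 y * (n.1 == k)%:R.
Proof.
rewrite /smooth.
have L n : cL1 mu1 (fun x => fourier_coef mu e f n * e n (x, y)).
  apply: cL1Z; rewrite /prod_char /=.
  under eq_fun do rewrite mulrC; apply: cL1Z; exact: cL1_char KS1 n.1.
rewrite (fourier_coefZ KS1); last exact: cL1_sum.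
rewrite (fourier_coef_sum KS1)//; congr (_ * _); apply: eq_bigr => n _.
rewrite -(fourier_coef_char KS1).
rewrite (_ : (fun x => _) = fun x => (fourier_coef mu e f n * e2 n.2 y) * e1 n.1 x).
  by rewrite (fourier_coefZ KS1)//; exact: cL1_char KS1 n.1.
by apply/funext => x; rewrite /prod_char /=; ring.
Qed.

(** A slice of S_N f is a trigonometric polynomial whose coefficients are finite combinations of
    those of [f], so a multiplier in the first variable passes to the slice at every y. *)
Lemma mult_image_smooth_slice m N f g y : mult_image mu e (fun n => m n.1) f g ->
  mult_image mu1 e1 m (fun x => S N f (x, y)) (fun x => S N g (x, y)).
Proof.
move=> [_ h]; split=> [|k]; first exact: cL1_smooth_slice.
rewrite !fourier_coef_smooth_slice mulrCA; congr (_ * _).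
rewrite mulr_sumr; apply: eq_bigr => n _; rewrite h.
by case: eqP => [->|_]; rewrite ?mulr1 ?mulr0 ?mulrA// mulr0.
Qed.

Variables m1 m2 : Z1 -> R[i].
Local Notation V1 := (H1Re mu1 e1 m1 m2).
Local Notation N1 := (H1Re_norm mu1 e1 m1 m2).
Local Notation V := (H1Re mu e (fun n => m1 n.1) (fun n => m2 n.1)).
Local Notation NV := (H1Re_norm mu e (fun n => m1 n.1) (fun n => m2 n.1)).

(* Apply the bound for the slices to the trigonometric polynomial [S N f] and integrate. *)
Lemma pairing_le_of_slices (b : T1 * T2 -> R[i]) M : cL1 mu b -> 0 <= M ->
  {ae mu2, forall y, forall p, V1 p -> bounded_fct p ->
     normc (cint mu1 (fun x => p x * b (x, y))) <= M * N1 p} ->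
  forall N f, V f -> normc (cint mu (fun z => S N f z * b z)) <= M * NV f.
Proof.
move=> Lb M0 aeb N f /H1Re_data[g1 [g2 [g12 Df]]].
have [_ ->] := H1_dataP SS Df.
have [Lf i1 i2 i12] := Df; have [[L1 _] [L2 _] [L12 _]] := And3 i1 i2 i12.
have LSb : cL1 mu (fun z => S N f z * b z) by exact: cL1_smoothM KS _ _ _ Lb.
have [_ Lsl ->] := cfubini LSb.
apply: le_trans (normc_cint_le Lsl) _.
have LS (u : T1 * T2 -> R[i]) := cL1_smooth KS N u.
have [if_ ef] := norm1_fubini (LS f); have [ig1 eg1] := norm1_fubini (LS g1).
have [ig2 eg2] := norm1_fubini (LS g2); have [ig12 eg12] := norm1_fubini (LS g12).
pose G y := norm1 mu1 (fun x => S N f (x, y)) + norm1 mu1 (fun x => S N g1 (x, y)) +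
  norm1 mu1 (fun x => S N g2 (x, y)) + norm1 mu1 (fun x => S N g12 (x, y)).
have iD (u v : T2 -> R) : mu2.-integrable setT (EFin \o u) -> mu2.-integrable setT (EFin \o v) ->
    mu2.-integrable setT (EFin \o (fun y => u y + v y)).
  by move=> iu iv; rewrite [_ \o _](_ : _ = (fun x => (u x)%:E + (v x)%:E)%E)//; exact: integrableD.
have i2_ := iD _ _ if_ ig1; have i3_ := iD _ _ i2_ ig2.
have iG : mu2.-integrable setT (EFin \o G) := iD _ _ i3_ ig12.
have EG : \int[mu2]_y G y =
    norm1 mu (S N f) + norm1 mu (S N g1) + norm1 mu (S N g2) + norm1 mu (S N g12).
  rewrite ef eg1 eg2 eg12 /G.
  rewrite (RintegralD measurableT i3_ ig12) (RintegralD measurableT i2_ ig2).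
  by rewrite (RintegralD measurableT if_ ig1).
have iMG : mu2.-integrable setT (EFin \o (fun y => M * G y)).
  by rewrite [_ \o _](_ : _ = (fun x => M%:E * (G x)%:E)%E)//; exact: integrableZl.
apply: le_trans (norm1_le_ae_integral Lsl iMG _ _) _.
- by move=> y; rewrite mulr_ge0// !addr_ge0 ?norm1_ge0.
- apply: filterS aeb => y h.
  have Dy : H1_data mu1 e1 m1 m2 (fun x => S N f (x, y)) (fun x => S N g1 (x, y))
      (fun x => S N g2 (x, y)) (fun x => S N g12 (x, y)).
    split; [exact: cL1_smooth_slice|exact: mult_image_smooth_slice i1|
      exact: mult_image_smooth_slice i2|exact: mult_image_smooth_slice i12].
  have [Vy Ny] := H1_dataP SS1 Dy.
  have [Mb hb] := smooth_bounded KS N f.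
  by rewrite /G -Ny; apply: h => //; exists Mb => x; exact: hb.
rewrite RintegralZl// EG ler_wpM2l//.
by rewrite !lerD// (norm1_smooth KS).
Qed.

Lemma mult_image_tensor m (f g : T1 -> R[i]) (k : T2 -> R[i]) Mf Mg Mk :
  cmeas f -> (forall x, normc (f x) <= Mf) -> cmeas g -> (forall x, normc (g x) <= Mg) ->
  cmeas k -> (forall x, normc (k x) <= Mk) -> mult_image mu1 e1 m f g ->
  mult_image mu e (fun n => m n.1) (tensor f k) (tensor g k).
Proof.
move=> mf fM mg gM mk kM [_ h]; split; first exact: cL1_tensor mg gM mk kM.
move=> n; rewrite (fourier_coef_tensor KS1 KS2 n mf fM mk kM).
by rewrite (fourier_coef_tensor KS1 KS2 n mg gM mk kM) h mulrA.
Qed.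

Local Notation K2 := (fkernel e2 s2 c2).

(** The kernel of the product mean is a tensor product, and by symmetry its first factor can be
    moved onto [p]. A slice of S_N b tested against [p] thus becomes a pairing of [b] itself with a
    function on the product, for every y. *)
Lemma cint_mul_smooth_slice N (b : T1 * T2 -> R[i]) p y : cL1 mu b -> cL1 mu1 p ->
  cint mu1 (fun x => p x * S N b (x, y)) = cint mu (fun z => tensor (S1 N p) (K2 N y) z * b z).
Proof.
move=> Lb Lp.
pose a n := cint mu1 (fun x => p x * e1 n x).
transitivity ((c N)%:C * \sum_(n <- s N) a n.1 * e2 n.2 y * fourier_coef mu e b n).
  have L n : cL1 mu1 (fun x => fourier_coef mu e b n * e2 n.2 y * (p x * e1 n.1 x)).
    by apply: cL1Z; exact: cL1_mul_char KS1 _ _ Lp.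
  rewrite (_ : (fun x => _) = fun x => (c N)%:C *
      \sum_(n <- s N) fourier_coef mu e b n * e2 n.2 y * (p x * e1 n.1 x)); last first.
    apply/funext => x; rewrite /smooth mulrCA; congr (_ * _); rewrite mulr_sumr.
    by apply: eq_bigr => n _; rewrite /prod_char /=; ring.
  rewrite cintZ; last exact: cL1_sum.
  rewrite cint_sum//; congr (_ * _); apply: eq_bigr => n _.
  rewrite cintZ; last exact: cL1_mul_char KS1 _ _ Lp.
  by rewrite -/(a n.1); ring.
have L n : cL1 mu (fun z => a n.1 * e2 n.2 y * (b z * Num.conj (e n z))).
  by apply: cL1Z; exact: cL1_mul_conj KS _ _ Lb.
rewrite (_ : (fun z => tensor _ _ z * b z) = fun z => (c N)%:C *
    \sum_(n <- s N) a n.1 * e2 n.2 y * (b z * Num.conj (e n z))); last first.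
  apply/funext => z; rewrite /tensor (smoothE_conj KS1)// /fkernel /prod_coef rmorphM /=.
  have key (u v A B w : R[i]) : u * A * (v * B) * w = u * v * (A * B * w) by ring.
  rewrite key; congr (_ * _).
  rewrite big_distrl /= mulr_suml big_allpairs_dep /=; apply: eq_bigr => k _.
  rewrite big_distrr /= mulr_suml; apply: eq_bigr => j _.
  by rewrite /prod_char rmorphM /= -/(a k); ring.
rewrite cintZ; last exact: cL1_sum.
rewrite cint_sum//; congr (_ * _); apply: eq_bigr => n _.
by rewrite cintZ//; exact: cL1_mul_conj KS _ _ Lb.
Qed.

(* Test the bound on the tensor products of [p] with the kernels [K2 N y]. *)
Lemma slices_le_of_pairing (b : T1 * T2 -> R[i]) M : cL1 mu b -> 0 <= M ->
  (forall q, V q -> bounded_fct q -> normc (cint mu (fun z => q z * b z)) <= M * NV q) ->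
  {ae mu2, forall y, cL1 mu1 (fun x => b (x, y)) /\ forall p, V1 p -> bounded_fct p ->
     normc (cint mu1 (fun x => p x * b (x, y))) <= M * N1 p}.
Proof.
move=> Lb M0 hq.
have smooth_le N y p : V1 p -> bounded_fct p ->
    normc (cint mu1 (fun x => p x * S N b (x, y))) <= M * N1 p.
  move=> Vp bp; have Lp : cL1 mu1 p by case: Vp.
  have [g1 [g2 [g12 Dp]]] := H1Re_data Vp.
  have [_ ->] := H1_dataP SS1 Dp.
  have [_ j1 j2 j12] := Dp; have [[L1 _] [L2 _] [L12 _]] := And3 j1 j2 j12.
  have [_ i1 i2 i12] := H1_data_smooth SS1 N Dp.
  have mS u : cmeas (S1 N u) := cmeas_smooth KS1 N u.
  have [Mp hp] := smooth_bounded KS1 N p; have [Mg1 hg1] := smooth_bounded KS1 N g1.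
  have [Mg2 hg2] := smooth_bounded KS1 N g2; have [Mg12 hg12] := smooth_bounded KS1 N g12.
  have mK := cmeas_fkernel KS2 N y; have bK := fkernel_bounded KS2 N y.
  have Dq : H1_data mu e (fun n => m1 n.1) (fun n => m2 n.1)
      (tensor (S1 N p) (K2 N y)) (tensor (S1 N g1) (K2 N y))
      (tensor (S1 N g2) (K2 N y)) (tensor (S1 N g12) (K2 N y)).
    split; first exact: cL1_tensor (mS p) hp mK bK.
    - exact: mult_image_tensor (mS p) hp (mS g1) hg1 mK bK i1.
    - exact: mult_image_tensor (mS p) hp (mS g2) hg2 mK bK i2.
    - exact: mult_image_tensor (mS g2) hg2 (mS g12) hg12 mK bK i12.
  have [Vq Nq] := H1_dataP SS Dq.
  rewrite cint_mul_smooth_slice//; apply: le_trans (hq _ Vq _) _.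
    by eexists => z; exact: tensor_bounded hp bK z.
  have nK : norm1 mu2 (K2 N y) = 1 := norm1_fkernel KS2 N y.
  have hT u : cL1 mu1 u -> norm1 mu (tensor (S1 N u) (K2 N y)) <= norm1 mu1 u.
    move=> Lu; have [Mu hu] := smooth_bounded KS1 N u.
    have -> := norm1_tensor mu1 mu2 (mS u) hu mK bK.
    by rewrite nK mulr1; exact: norm1_smooth KS1 N _ Lu.
  rewrite Nq; apply: ler_wpM2l; first exact: M0.
  exact: lerD (lerD (lerD (hT _ Lp) (hT _ L1)) (hT _ L2)) (hT _ L12).
have LD N : cL1 mu (fun z => S N b z - b z) := cL1B (cL1_smooth KS N b) Lb.
pose g N y := norm1 mu1 (fun x => S N b (x, y) - b (x, y)).
have ig N : mu2.-integrable setT (EFin \o g N) := (norm1_fubini (LD N)).1.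
have vg : vanishes (fun N => \int[mu2]_y g N y).
  by apply: vanishes_le (summable_smooths SS Lb) _ => N; rewrite (norm1_fubini (LD N)).2.
(* This null set comes from [b] alone and therefore serves all test functions p; only the index N
   will depend on y and p. *)
have aeg := ae_small_of_vanishing_integrals ig (fun N y => norm1_ge0 _ _) vg.
have [aeL _ _] := cfubini Lb.
apply: filterS2 aeL aeg => y Ly gy; split=> // p Vp bp.
have [Mp hp] := bp; have Lp : cL1 mu1 p by case: Vp.
have mp := cL1_cmeas Lp.
apply/ler_addgt0Pr => eps e0.
have Mp1 : 0 < `|Mp| + 1 by rewrite ltr_wpDl.
have [N hN] := gy (eps / (`|Mp| + 1)) (divr_gt0 e0 Mp1).
have LSN := cL1_smooth_slice N b y.
have LSp : cL1 mu1 (fun x => p x * S N b (x, y)) := cL1Ml LSN mp hp.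
have Lbp : cL1 mu1 (fun x => p x * b (x, y)) := cL1Ml Ly mp hp.
have LB := cL1B LSN Ly.
set A := cint mu1 _; set B := cint mu1 (fun x => p x * S N b (x, y)).
rewrite [X in normc X](_ : A = B - (B - A)); last by ring.
apply: le_trans (normcB _ _) _; apply: lerD; first exact: smooth_le.
rewrite /A /B -cintB//.
rewrite (_ : (fun x => _) = (fun x => (S N b (x, y) - b (x, y)) * p x)); last first.
  by apply/funext => x; ring.
apply: le_trans (normc_cint_le (cL1M LB mp hp)) _.
apply: le_trans (norm1M LB mp (M := `|Mp| + 1) _) _.
  by move=> x; apply: le_trans (hp x) _; apply: le_trans (ler_norm _) _; rewrite lerDl.
by rewrite mulrC -ler_pdivlMr.
Qed.

End slices.

(** * Measure-preserving changes of variables *)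

Section measure_preserving.
Context {R : realType} {d : measure_display} {T : measurableType d}.
Variable mu : probability T R.

(** Put through integrals of nonnegative functions, the form that Tonelli's theorem delivers. *)
Definition measure_preserving (p : T -> T) := measurable_fun setT p /\
  forall F : T -> \bar R, measurable_fun setT F -> (forall x, 0 <= F x)%E ->
    (\int[mu]_x F (p x) = \int[mu]_x F x)%E.

Lemma measure_preserving_comp p q : measure_preserving p -> measure_preserving q ->
  measure_preserving (p \o q).
Proof.
move=> [mp hp] [mq hq]; split; first exact: measurableT_comp.
move=> F mF F0; transitivity (\int[mu]_x F (p x))%E; last exact: hp.
by apply: (hq (F \o p)) => [|x /=]; [exact: measurableT_comp|exact: F0].
Qed.

Variable p : T -> T.
Hypothesis hp : measure_preserving p.

Lemma integrable_measure_preserving (f : T -> R) : mu.-integrable setT (EFin \o f) ->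
  mu.-integrable setT (EFin \o (fun x => f (p x))) /\
  \int[mu]_x f (p x) = \int[mu]_x f x.
Proof.
case: hp => mp hF /integrableP[mf intf].
have mA : measurable_fun setT (fun x => `|(f x)%:E|)%E by exact: measurableT_comp.
split.
  apply/integrableP; split; first exact: (measurableT_comp mf mp).
  by rewrite (hF (fun x => `|(f x)%:E|%E)).
congr fine; rewrite integralE [RHS]integralE.
have [hpos hneg] := (hF _ (measurable_funepos mf), hF _ (measurable_funeneg mf)).
congr (_ - _)%E.
  rewrite -(hpos (funepos_ge0 _)); apply: eq_integral => x _.
  by rewrite !funeposE.
rewrite -(hneg (funeneg_ge0 _)); apply: eq_integral => x _.
by rewrite !funenegE.
Qed.

Lemma cint_measure_preserving (f : T -> R[i]) : cL1 mu f ->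
  cL1 mu (fun x => f (p x)) /\ cint mu (fun x => f (p x)) = cint mu f.
Proof.
move=> [/integrable_measure_preserving[i1 E1] /integrable_measure_preserving[i2 E2]].
by split; [split|apply: complex_eq].
Qed.

Lemma norm1_measure_preserving (f : T -> R[i]) : cL1 mu f ->
  norm1 mu (fun x => f (p x)) = norm1 mu f.
Proof. by move=> /cL1_normc/integrable_measure_preserving[]. Qed.

Variables (Z : countType) (e : Z -> T -> R[i]) (s : nat -> seq Z) (c : nat -> R).
Hypothesis SS : summable_system mu e s c.
Variable r : Z -> Z.
Hypothesis er : forall n x, e (r n) (p x) = e n x.

(** Since e_(r n) composed with [p] is e_n, the coefficient of u composed with [p] at n is that of u
    at r n: composition merely renames frequencies. *)
Lemma mult_image_measure_preserving m f g : cL1 mu f -> mult_image mu e m f g ->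
  mult_image mu e (fun n => m (r n)) (fun x => f (p x)) (fun x => g (p x)).
Proof.
have KS := summable_kernel SS.
have fc u n : cL1 mu u -> fourier_coef mu e (fun x => u (p x)) n = fourier_coef mu e u (r n).
  move=> Lu; rewrite /fourier_coef.
  have [_ <-] := cint_measure_preserving (cL1_mul_conj KS (r n) Lu).
  by congr (cint _ _); apply/funext => x; rewrite er.
move=> Lf [Lg h]; split; first by have [] := cint_measure_preserving Lg.
by move=> n; rewrite !fc// h.
Qed.

Lemma H1_data_measure_preserving m1 m2 f g1 g2 g12 : H1_data mu e m1 m2 f g1 g2 g12 ->
  H1_data mu e (fun n => m1 (r n)) (fun n => m2 (r n)) (fun x => f (p x))
    (fun x => g1 (p x)) (fun x => g2 (p x)) (fun x => g12 (p x)).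
Proof.
move=> [L i1 i2 i12]; split.
- by have [] := cint_measure_preserving L.
- exact: mult_image_measure_preserving.
- exact: mult_image_measure_preserving.
- by apply: mult_image_measure_preserving => //; exact: i2.1.
Qed.

Lemma H1Re_measure_preserving m1 m2 f : H1Re mu e m1 m2 f ->
  H1Re mu e (fun n => m1 (r n)) (fun n => m2 (r n)) (fun x => f (p x)) /\
  H1Re_norm mu e (fun n => m1 (r n)) (fun n => m2 (r n)) (fun x => f (p x)) =
  H1Re_norm mu e m1 m2 f.
Proof.
move=> /H1Re_data[g1 [g2 [g12 D]]].
have [_ ->] := H1_dataP SS D.
have [V ->] := H1_dataP SS (H1_data_measure_preserving D).
have [L [L1 _] [L2 _] [L12 _]] := D.
by rewrite !norm1_measure_preserving.
Qed.

End measure_preserving.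

(** * The three-dimensional torus *)

Section torus.
Context {R : realType}.

Local Notation C := (circle R).
Local Notation mu1 := (circle_mu R).
Local Notation mu2 := (torus2_mu R).
Local Notation mu3 := (torus3_mu R).
Local Notation s2 := (prod_freq fejer_freq fejer_freq).
Local Notation c2 := (prod_coef (@fejer_coef R) (@fejer_coef R)).
Local Notation s3 := (prod_freq s2 fejer_freq).
Local Notation c3 := (prod_coef c2 (@fejer_coef R)).

Lemma circle_system : summable_system mu1 (@circle_char R) fejer_freq fejer_coef.
Proof. by split; [exact: circle_kernel_system|exact: circle_smooths_to]. Qed.

Lemma torus2_system : summable_system mu2 (@torus2_char R) s2 c2.
Proof. exact: prod_summable_system circle_system circle_system. Qed.

Lemma torus3_system : summable_system mu3 (@torus3_char R) s3 c3.
Proof. exact: prod_summable_system torus2_system circle_system. Qed.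

(* The slices of [b] in the first variable are those of [b \o shift] in the last one. *)
Definition shift (z : torus3 R) : torus3 R := (z.2, z.1.1, z.1.2).

(** Both integrals are iterated integrals over three circles, which Tonelli's theorem allows to be
    reordered. *)
Lemma shift_preserving : measure_preserving mu3 shift.
Proof.
have ms : measurable_fun setT shift.
  apply: measurable_fun_pair; last first.
    by apply: (measurableT_comp measurable_snd); exact: measurable_fst.
  apply: measurable_fun_pair; first exact: measurable_snd.
  by apply: (measurableT_comp measurable_fst); exact: measurable_fst.
split=> // F mF F0.
have mFs : measurable_fun setT (fun z => F (shift z)) by exact: (measurableT_comp mF ms).
rewrite (@fubini_tonelli1 _ _ _ _ _ mu2 mu1 (fun z => F (shift z)))//.
rewrite (@fubini_tonelli2 _ _ _ _ _ mu1 mu1)//; last 2 first.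
- exact: measurable_fun_fubini_tonelli_F.
- by move=> x; exact: integral_ge0.
rewrite (@fubini_tonelli2 _ _ _ _ _ mu2 mu1 F)//.
apply: eq_integral => y2 _; rewrite /fubini_G.
rewrite (@fubini_tonelli2 _ _ _ _ _ mu1 mu1 (fun w => F (w, y2)))//.
exact: (measurableT_comp mF (pair2_measurable y2)).
Qed.

(** Replaces an infimum over functionals by an inequality on bounded test functions. The converse
    direction builds the functional by extension, so finiteness of the norm includes its
    existence. *)
Lemma BMO_norm_leP (b : torus2 R -> R[i]) M : cL1 mu2 b -> 0 <= M ->
  (BMO_norm b <= M%:E)%E <->
  forall p, H1_T2 p -> bounded_fct p ->
    normc (cint mu2 (fun y => p y * b y)) <= M * H1_T2_norm p.
Proof.
move=> Lb M0; have SV := H1Re_smoothable torus2_system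
  (fun n : int * int => hilbert_mult R n.1) (fun n : int * int => hilbert_mult R n.2).
split=> [bM p Vp bp|h].
  apply/ler_addgt0Pr => eps e0; have N0 := smoothable_ge0 SV Vp.
  (* The infimum is only approached: a functional of norm below M + k is used, and k times the norm
     of [p] is at most eps. *)
  pose k := eps / (H1_T2_norm p + 1).
  have N1 : 0 < H1_T2_norm p + 1 by rewrite ltr_wpDl.
  have k0 : 0 < k by rewrite divr_gt0.
  have /ereal_inf_lt[_ [L [_ BL rL] <-] ltL] : (BMO_norm b < (M + k)%:E)%E.
    by apply: le_lt_trans bM _; rewrite lte_fin ltrDl.
  rewrite -rL//; apply: le_trans (functional_normP SV BL Vp) _.
  have kE : k * (H1_T2_norm p + 1) = eps by rewrite /k divfK// gt_eqF.
  have fM : fine (functional_norm (@H1_T2 R) (@H1_T2_norm R) L) <= M + k.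
    by rewrite -lee_fin fineK ?(functional_norm_fin SV BL)// ltW.
  apply: le_trans (ler_wpM2r N0 fM) _; rewrite -/(H1_T2_norm p) mulrDl lerD2l -kE.
  by rewrite ler_pM2l// lerDl.
have [L [BL rL hL]] := functional_extension torus2_system SV Lb M0 h.
apply: ereal_inf_le; exists (functional_norm (@H1_T2 R) (@H1_T2_norm R) L).
  by exists L.
exact: functional_norm_le.
Qed.

Lemma ae_BMO_norm_leP (b : torus3 R -> R[i]) M : cL1 mu3 b -> 0 <= M ->
  {ae mu1, forall x3, BMO_norm (fun y => b (y.1, y.2, x3)) <= M%:E}%E <->
  forall q, H1_L1 q -> bounded_fct q ->
    normc (cint mu3 (fun z => q z * b z)) <= M * H1_L1_norm q.
Proof.
move=> Lb M0; have sl x3 : (fun y : torus2 R => b (y.1, y.2, x3)) = (fun y => b (y, x3)).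
  by apply/funext => -[].
have SV := H1Re_smoothable torus3_system
  (fun n : int * int * int => hilbert_mult R n.1.1)
  (fun n : int * int * int => hilbert_mult R n.1.2).
have [aeL _ _] := cfubini Lb.
split=> h.
  apply: (bounded_pairing_le torus3_system SV Lb M0).
  apply: (@pairing_le_of_slices _ _ _ _ _ _ _ _ _ _ _ _ _ _ _ torus2_system circle_system
    (fun n : int * int => hilbert_mult R n.1) (fun n : int * int => hilbert_mult R n.2) b M Lb M0).
  apply: filterS2 aeL h => x3 L3; rewrite sl => /(BMO_norm_leP L3 M0); exact.
have := @slices_le_of_pairing _ _ _ _ _ _ _ _ _ _ _ _ _ _ _ torus2_system circle_system
  (fun n : int * int => hilbert_mult R n.1) (fun n : int * int => hilbert_mult R n.2) b M Lb M0 h.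
by apply: filterS => x3 [L3 h3]; rewrite sl; apply/(BMO_norm_leP L3 M0).
Qed.

(** The double shift is (x1, x2, x3) -> (x2, x3, x1): it puts x2 and x3 into the two slots in which
    [q] has Hilbert transforms. *)
Lemma H1_L1_shift q : H1_L1 q -> L1_H1 (fun z => q (shift (shift z))) /\
  L1_H1_norm (fun z => q (shift (shift z))) = H1_L1_norm q.
Proof.
move=> /(@H1Re_measure_preserving _ _ _ _ (shift \o shift)
  (measure_preserving_comp shift_preserving shift_preserving) _ _ _ _ torus3_system
  (fun n : int * int * int => (n.1.2, n.2, n.1.1))).
apply=> -[[n1 n2] n3] [[x1 x2] x3].
by rewrite /torus3_char /torus2_char /=; ring.
Qed.

Lemma L1_H1_shift q : L1_H1 q -> H1_L1 (fun z => q (shift z)) /\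
  H1_L1_norm (fun z => q (shift z)) = L1_H1_norm q.
Proof.
move=> /(@H1Re_measure_preserving _ _ _ _ shift shift_preserving _ _ _ _ torus3_system
  (fun n : int * int * int => (n.2, n.1.1, n.1.2))).
apply=> -[[n1 n2] n3] [[x1 x2] x3].
by rewrite /torus3_char /torus2_char /=; ring.
Qed.

Lemma shift3 z : shift (shift (shift z)) = z.
Proof. by case: z => [[]]. Qed.

(** The case of x3 is applied to [b] composed with the shift. Test functions correspond under the
    shift and its inverse, the double shift, and the pairing is invariant. *)
Lemma ae_BMO_norm_leP' (b : torus3 R -> R[i]) M : cL1 mu3 b -> 0 <= M ->
  {ae mu1, forall x1, BMO_norm (fun y => b (x1, y.1, y.2)) <= M%:E}%E <->
  forall q, L1_H1 q -> bounded_fct q ->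
    normc (cint mu3 (fun z => q z * b z)) <= M * L1_H1_norm q.
Proof.
move=> Lb M0; have [Lbs _] := cint_measure_preserving shift_preserving Lb.
apply: (iff_trans (ae_BMO_norm_leP Lbs M0)).
have pair q : cL1 mu3 q -> bounded_fct q ->
    cint mu3 (fun z => q (shift z) * b (shift z)) = cint mu3 (fun z => q z * b z).
  move=> Lq [Mq hq].
  by have [_ ->] := cint_measure_preserving shift_preserving (cL1Ml Lb (cL1_cmeas Lq) hq).
split=> h q Vq bq.
  have Lq : cL1 mu3 q by case: Vq.
  have [Vs Ns] := L1_H1_shift Vq; have [Mq hq] := bq.
  have bs : bounded_fct (fun z => q (shift z)) by exists Mq => z; exact: hq.
  have := h (fun z => q (shift z)) Vs bs.
  by rewrite (pair q Lq bq) Ns.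
have [Vs Ns] := H1_L1_shift Vq; have [Mq hq] := bq.
have bs : bounded_fct (fun z => q (shift (shift z))) by exists Mq => z; exact: hq.
have Ls : cL1 mu3 (fun z => q (shift (shift z))) by case: Vs.
have := h _ Vs bs; rewrite -(pair _ Ls bs) Ns.
by under [X in cint _ X]eq_fun do rewrite shift3.
Qed.

Lemma BMO_13_2_norm_leP (b : torus3 R -> R[i]) M : cL1 mu3 b -> 0 <= M ->
  (BMO_13_2_norm b <= M%:E)%E <->
  (forall q, H1_L1 q -> bounded_fct q ->
    normc (cint mu3 (fun z => q z * b z)) <= M * H1_L1_norm q) /\
  (forall q, L1_H1 q -> bounded_fct q ->
    normc (cint mu3 (fun z => q z * b z)) <= M * L1_H1_norm q).
Proof.
move=> Lb M0; rewrite /BMO_13_2_norm ge_max; split.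
  move=> /andP[/ess_supP h1 /ess_supP h2].
  by split; [exact: (ae_BMO_norm_leP Lb M0).1 h1|exact: (ae_BMO_norm_leP' Lb M0).1 h2].
move=> [/(ae_BMO_norm_leP Lb M0) h1 /(ae_BMO_norm_leP' Lb M0) h2].
by apply/andP; split; apply/ess_supP.
Qed.

Lemma BMO_13_2_norm_ge0 (b : torus3 R -> R[i]) : (0 <= BMO_13_2_norm b)%E.
Proof.
have SV := H1Re_smoothable torus2_system
  (fun n : int * int => hilbert_mult R n.1) (fun n : int * int => hilbert_mult R n.2).
rewrite /BMO_13_2_norm le_max; apply/orP; left.
(* The essential supremum of the constant 0 is 0 because the measure is not zero. *)
have p1 : (0 < mu1 setT)%E by have -> : mu1 setT = 1%E := probability_setT mu1.
rewrite -(ess_sup_cst 0%E p1).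
apply: le_ess_sup; apply: aeW => x3; apply: le_ereal_inf_tmp => _ [L [_ BL _] <-].
exact: (functional_norm_ge0 SV BL).
Qed.

Let SA := H1Re_smoothable torus3_system
  (fun n : int * int * int => hilbert_mult R n.1.1)
  (fun n : int * int * int => hilbert_mult R n.1.2).
Let SB := H1Re_smoothable torus3_system
  (fun n : int * int * int => hilbert_mult R n.1.2) (fun n : int * int * int => hilbert_mult R n.2).

Lemma sum_space_smoothable :
  smoothable mu3 (@torus3_char R) s3 c3 (@sum_space R) (@sum_norm R).
Proof. exact: (gsum_smoothable torus3_system SA SB). Qed.

Let SV := sum_space_smoothable.

(** A near-optimal decomposition may have unbounded summands, to which the bounds do not apply. They
    do apply to the means of the summands, and the sum of these is the mean of the element. *)
Lemma functional_of_BMO (b : torus3 R -> R[i]) M : cL1 mu3 b -> 0 <= M ->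
  (BMO_13_2_norm b <= M%:E)%E ->
  exists L, [/\ bounded_functional (@sum_space R) (@sum_norm R) L,
    represents mu3 (@sum_space R) b L &
    forall f, sum_space f -> normc (L f) <= M * sum_norm f].
Proof.
move=> Lb M0 /(BMO_13_2_norm_leP Lb M0)[h1 h2].
apply: (functional_extension torus3_system SV Lb M0).
apply: (bounded_pairing_le torus3_system SV Lb M0) => n h Vh.
have KS := summable_kernel torus3_system.
apply/ler_addgt0Pr => eps e0.
have M1 : 0 < M + 1 by rewrite ltr_wpDl.
(* The excess eps / (M + 1) is later multiplied by M, leaving at most eps. *)
have [f [g [Vf Vg hE hlt]]] := gsum_norm_adherent SA SB Vh (divr_gt0 e0 M1).
have Lf := smoothable_cL1 SA Vf; have Lg := smoothable_cL1 SB Vg.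
rewrite {1}hE (smoothD KS)//.
pose S := smooth mu3 (@torus3_char R) s3 c3.
have -> : (fun z => (S n f z + S n g z) * b z) = (fun z => S n f z * b z + S n g z * b z).
  by apply/funext => z; rewrite mulrDl.
rewrite cintD; [|exact: (cL1_smoothM KS)..].
have a1 := h1 _ (smoothable_smooth SA n Vf) (smooth_bounded KS n f).
have a2 := h2 _ (smoothable_smooth SB n Vg) (smooth_bounded KS n g).
have b1 := ler_wpM2l M0 (smoothable_contr SA n Vf).
have b2 := ler_wpM2l M0 (smoothable_contr SB n Vg).
apply: le_trans (normcD _ _) _; apply: le_trans (lerD (le_trans a1 b1) (le_trans a2 b2)) _.
rewrite -mulrDr; apply: le_trans (ler_wpM2l M0 (ltW hlt)) _.
rewrite mulrDr lerD2l mulrCA ger_pMr// ler_pdivrMr// mul1r lerDl//.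
Qed.

(** Each Hardy space embeds in the sum space with norm at most 1, so the functional bounds the
    pairings with bounded elements of both. *)
Lemma BMO_of_functional (b : torus3 R -> R[i]) L : cL1 mu3 b ->
  bounded_functional (@sum_space R) (@sum_norm R) L ->
  represents mu3 (@sum_space R) b L ->
  (BMO_13_2_norm b <= functional_norm (@sum_space R) (@sum_norm R) L)%E.
Proof.
move=> Lb BL rL; rewrite -(fineK (functional_norm_fin SV BL)).
have M0 : 0 <= fine (functional_norm (@sum_space R) (@sum_norm R) L).
  by rewrite fine_ge0// (functional_norm_ge0 SV BL).
apply/(BMO_13_2_norm_leP Lb M0); split=> q Vq bq.
  have [Sq Nq] := gsum_norm_inl SA SB Vq.
  rewrite -rL//; apply: le_trans (functional_normP SV BL Sq) _.
  exact: ler_wpM2l.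
have [Sq Nq] := gsum_norm_inr SA SB Vq.
rewrite -rL//; apply: le_trans (functional_normP SV BL Sq) _.
exact: ler_wpM2l.
Qed.

Lemma normc_hilbert_mult n : normc (hilbert_mult R n) <= 1.
Proof.
by rewrite /hilbert_mult /= expr0n add0r sqrrN sqrtr_sqr; case: sgzP => _;
  rewrite ?rmorph0 ?rmorphN ?rmorph1 ?normrN ?normr0 ?normr1.
Qed.

Lemma H1_data_trig_poly (F : seq (int * int * int)) a : uniq F ->
  H1_data mu3 (@torus3_char R) (fun n => hilbert_mult R n.1.1) (fun n => hilbert_mult R n.1.2)
   (trig_poly (@torus3_char R) F a)
   (trig_poly (@torus3_char R) F (fun n => hilbert_mult R n.1.1 * a n))
   (trig_poly (@torus3_char R) F (fun n => hilbert_mult R n.1.2 * a n))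
   (trig_poly (@torus3_char R) F (fun n => hilbert_mult R n.1.1 * (hilbert_mult R n.1.2 * a n))).
Proof.
have KS := summable_kernel torus3_system.
move=> uF; have h m (a' : int * int * int -> R[i]) : mult_image mu3 (@torus3_char R) m
    (trig_poly (@torus3_char R) F a') (trig_poly (@torus3_char R) F (fun n => m n * a' n)).
  split; first exact: cL1_trig_poly KS _ _.
  by move=> n; rewrite !(fourier_coef_trig_poly KS)//; case: ifP; rewrite ?mulr0.
split; [exact: cL1_trig_poly KS _ _|exact: h|exact: h|exact: h].
Qed.

(** Frequencies may be repeated in [F], as they are in the lists defining the means. *)
Lemma functional_trig_poly L (F : seq (int * int * int)) a :
  bounded_functional (@sum_space R) (@sum_norm R) L ->
  sum_space (trig_poly (@torus3_char R) F a) /\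
  L (trig_poly (@torus3_char R) F a) = \sum_(n <- F) a n * L (torus3_char n).
Proof.
move=> BL; have KS := summable_kernel torus3_system.
have Ve n : sum_space (@torus3_char R n).
  have [V _] := H1_dataP torus3_system (H1_data_trig_poly (fun=> 1) (erefl : uniq [:: n])).
  have [] := gsum_norm_inl SA SB V; rewrite (_ : trig_poly _ _ _ = torus3_char n)//.
  by apply/funext => x; rewrite /trig_poly big_seq1 mul1r.
elim: F => [|n F [VF ih]].
  rewrite (_ : trig_poly _ _ _ = fun=> 0).
    by rewrite big_nil (functional0 SV BL); split=> //; exact: smoothable0 SV.
  by apply/funext => x; rewrite /trig_poly big_nil.
rewrite (_ : trig_poly _ _ _ = fun x => a n * torus3_char n x + trig_poly (@torus3_char R) F a x).
  by rewrite BL.1// big_cons ih; split=> //; exact: (smoothable_lin SV).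
by apply/funext => x; rewrite /trig_poly big_cons.
Qed.

(* The Hardy norm is dominated by the L^2 norm, so that the values of a bounded functional at the
   characters are square summable. *)
Lemma functional_bessel L : bounded_functional (@sum_space R) (@sum_norm R) L ->
  exists B, forall F : seq (int * int * int), uniq F ->
    \sum_(n <- F) normc (L (torus3_char n)) ^+ 2 <= B.
Proof.
move=> BL; pose K := fine (functional_norm (@sum_space R) (@sum_norm R) L).
have K0 : 0 <= K by rewrite fine_ge0// (functional_norm_ge0 SV BL).
have KS := summable_kernel torus3_system.
(* The polynomial with coefficients conj(L e_n) has L-value S = t^2, and its Hardy norm is at most 4
   t, one t for each of the four L^1 norms. Hence t^2 <= 4 K t. *)
exists ((4 * K) ^+ 2) => F uF.
pose a n := Num.conj (L (torus3_char n)).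
set S := \sum_(n <- F) _; pose t := Num.sqrt S.
have S0 : 0 <= S by apply: sumr_ge0 => n _; exact: sqr_ge0.
have tS : t ^+ 2 = S by rewrite sqr_sqrtr.
have t0 : 0 <= t by exact: sqrtr_ge0.
have nt a' : (forall n, normc (a' n) <= normc (a n)) ->
    norm1 mu3 (trig_poly (@torus3_char R) F a') <= t.
  move=> aa; rewrite -(ger0_norm (norm1_ge0 _ _)) -sqrtr_sqr ler_wsqrtr//.
  apply: le_trans (norm1_trig_poly KS _ uF) _; apply: ler_sum => n _.
  rewrite -(normc_conj (L _)) -/(a n) !expr2.
  by rewrite ler_pM ?normc_ge0.
have hm n (z : R[i]) w : normc z <= w -> normc (hilbert_mult R n * z) <= w.
  move=> zw; rewrite normcM; apply: le_trans zw.
  by rewrite ler_piMl ?normc_ge0// normc_hilbert_mult.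
have [Vp pE] := H1_dataP torus3_system (H1_data_trig_poly a uF).
have [Sp Np] := gsum_norm_inl SA SB Vp.
have [_ Lp] := functional_trig_poly F a BL.
have LS : L (trig_poly (@torus3_char R) F a) = S%:C.
  rewrite Lp rmorph_sum/=; apply: eq_bigr => n _.
  by rewrite csqr_normc mulrC.
have := functional_normP SV BL Sp; rewrite LS normc_real ger0_norm// -/K => hS.
have : S <= K * (4 * t).
  apply: le_trans hS _; apply: ler_wpM2l => //; apply: le_trans Np _; rewrite pE.
  have n1 := nt a (fun n => lexx _).
  have n2 : norm1 mu3 (trig_poly (@torus3_char R) F (fun n => hilbert_mult R n.1.1 * a n)) <= t.
    by apply: nt => n; exact: hm.
  have n3 : norm1 mu3 (trig_poly (@torus3_char R) F (fun n => hilbert_mult R n.1.2 * a n)) <= t.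
    by apply: nt => n; exact: hm.
  have n4 : norm1 mu3 (trig_poly (@torus3_char R) F
      (fun n => hilbert_mult R n.1.1 * (hilbert_mult R n.1.2 * a n))) <= t.
    by apply: nt => n; apply: (hm); exact: hm.
  lra.
rewrite -tS => ht; have [t00|t00] := eqVneq t 0; first by rewrite t00 expr0n sqr_ge0.
have tp : 0 < t by rewrite lt_neqAle eq_sym t00.
have : t <= 4 * K by rewrite -(ler_pM2r tp); lra.
by move=> tK; rewrite !expr2 ler_pM.
Qed.

(** The pairing is bilinear while Fourier coefficients conjugate the character, so [b] is the
    conjugate of a function with coefficients conj(L e_n). Then L and the pairing agree on
    characters, hence on means, hence in the limit on bounded elements. *)
Lemma functional_representation L : bounded_functional (@sum_space R) (@sum_norm R) L ->
  exists b, cL1 mu3 b /\ represents mu3 (@sum_space R) b L.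
Proof.
move=> BL; have KS := summable_kernel torus3_system.
have [B hB] := functional_bessel BL.
have [|b' [Lb' hb']] := riesz_fischer KS (a := fun n => Num.conj (L (torus3_char n))) (B := B).
  by move=> F uF; under eq_bigr do rewrite normc_conj; exact: hB.
pose b x := Num.conj (b' x); have Lb : cL1 mu3 b := cL1_conj Lb'.
have eb n : cint mu3 (fun x => torus3_char n x * b x) = L (torus3_char n).
  rewrite -[RHS]conjCK -hb' /fourier_coef -cint_conj; last exact: (cL1_mul_conj KS).
  by congr (cint _ _); apply/funext => x; rewrite rmorphM /= conjCK mulrC.
exists b; split=> // f Vf bf; have Lf := smoothable_cL1 SV Vf.
have v1 := functional_smooth_cvg SV BL Vf.
have v2 := cint_smooth_cvg torus3_system Lf bf Lb.
apply: vanishes_normc_eq (vanishesD v1 v2) _ => N.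
have E : L (smooth mu3 (@torus3_char R) s3 c3 N f) =
    cint mu3 (fun x => smooth mu3 (@torus3_char R) s3 c3 N f x * b x).
  pose a n := (c3 N)%:C * fourier_coef mu3 (@torus3_char R) f n.
  have -> : smooth mu3 (@torus3_char R) s3 c3 N f = trig_poly (@torus3_char R) (s3 N) a.
    apply/funext => x; rewrite /smooth mulr_sumr; apply: eq_bigr => n _.
    by rewrite mulrA.
  have [_ ->] := functional_trig_poly (s3 N) a BL.
  have Leb n : cL1 mu3 (fun x => torus3_char n x * b x).
    by have := cL1_mul_char KS n Lb; under eq_fun do rewrite mulrC.
  rewrite (_ : (fun x => _) = fun x => \sum_(n <- s3 N) a n * (torus3_char n x * b x)).
    rewrite cint_sum; last by move=> n; exact: cL1Z.
    by apply: eq_bigr => n _; rewrite cintZ// eb.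
  by apply/funext => x; rewrite /trig_poly mulr_suml; apply: eq_bigr => n _; rewrite mulrA.
set u := L f; set v := cint _ (fun x => f x * b x).
rewrite [X in normc X](_ : u - v = - (L (smooth mu3 (@torus3_char R) s3 c3 N f) - u) +
  (cint mu3 (fun x => smooth mu3 (@torus3_char R) s3 c3 N f x * b x) - v)).
  by apply: le_trans (normcD _ _) _; rewrite normcN.
by rewrite E; ring.
Qed.

(** Characters are bounded elements of the sum space, so L determines the Fourier coefficients of
    the conjugate of a representing function. *)
Lemma representing_unique L b b' : bounded_functional (@sum_space R) (@sum_norm R) L ->
  cL1 mu3 b -> represents mu3 (@sum_space R) b L ->
  cL1 mu3 b' -> represents mu3 (@sum_space R) b' L ->
  {ae mu3, forall x, b x = b' x}.
Proof.
move=> BL Lb rb Lb' rb'; have KS := summable_kernel torus3_system.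
have L1 := cL1_conj Lb; have L2 := cL1_conj Lb'.
have Ve n : sum_space (@torus3_char R n).
  have [] := functional_trig_poly [:: n] (fun=> 1) BL.
  rewrite (_ : trig_poly _ _ _ = torus3_char n)//.
  by apply/funext => x; rewrite /trig_poly big_seq1 mul1r.
have be n : bounded_fct (@torus3_char R n).
  by exists 1 => x; rewrite (char_norm KS).
have := fourier_unique_ae torus3_system L1 L2.
have fc u n : cL1 mu3 u -> fourier_coef mu3 (@torus3_char R) (fun x => Num.conj (u x)) n =
    Num.conj (cint mu3 (fun x => torus3_char n x * u x)).
  move=> Lu; rewrite -cint_conj; last first.
    by have := cL1_mul_char KS n Lu; under eq_fun do rewrite mulrC.
  by congr (cint _ _); apply/funext => x; rewrite [RHS]rmorphM /= mulrC.
move=> h; have : {ae mu3, forall x, Num.conj (b x) = Num.conj (b' x)}.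
  by apply: h => n; rewrite !fc// -rb// -rb'.
by apply: filterS => x /(congr1 Num.conj); rewrite !conjCK.
Qed.

End torus.

Theorem theorem2 (R : realType) :
  is_dual (torus3_mu R) (@sum_space R) (@sum_norm R)
    (@BMO_13_2 R) (@BMO_13_2_norm R).
Proof.
have SV := @sum_space_smoothable R.
have BMO_fin (b : torus3 R -> R[i]) : BMO_13_2 b ->
    [/\ cL1 (torus3_mu R) b, 0 <= fine (BMO_13_2_norm b) &
        (BMO_13_2_norm b = (fine (BMO_13_2_norm b))%:E)%E].
  move=> [Lb fin]; split=> //; first by rewrite fine_ge0// BMO_13_2_norm_ge0.
  by rewrite fineK// ge0_fin_numE// BMO_13_2_norm_ge0.
split.
- move=> b /BMO_fin[Lb M0 ME].
  have [|L [BL rL _]] := functional_of_BMO Lb M0; first by rewrite -ME.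
  by exists L.
- move=> b L L' _ BL rL BL' rL'.
  exact: (functional_unique (@torus3_system R) SV BL rL BL' rL').
- move=> L BL; have [b [Lb rb]] := functional_representation BL.
  exists b; split=> //; split=> //.
  apply: le_lt_trans (BMO_of_functional Lb BL rb) _.
  by rewrite ltey_eq (functional_norm_fin SV BL).
- by move=> L b b' BL [Lb _] rb [Lb' _] rb'; exact: representing_unique BL Lb rb Lb' rb'.
(* For these norms the duality is isometric. The upper bound comes from the functional constructed
   from [b], which coincides with L by uniqueness. *)
- exists 1, 1; split=> // b L /BMO_fin[Lb M0 ME] BL rL; rewrite !mul1e; split.
    exact: BMO_of_functional.
  have [|L' [BL' rL' hL']] := functional_of_BMO Lb M0; first by rewrite -ME.
  rewrite ME; apply: functional_norm_le => // f Vf.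
  by rewrite (functional_unique (@torus3_system R) SV BL rL BL' rL' Vf); exact: hL'.
Qed.
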